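(* Let $n\ge 2$, $d\ge 1$, and let $q:\mathcal{B}^d\to[-1,1]^n$ satisfy $q(m)\neq \mathbf{1}$ and $q(m)\ne-\mathbf{1}$ for all $m\in\mathcal{B}^d$. Let $g:\mathbb{R}^n\to\mathbb{R}$ be uniformly continuous and assume: (a) there exists $\theta_g>0$ such that $g(x+v)\ge g(x)+\theta_g\langle v,\mathbf{1}\rangle$ for all $x\in\mathbb{R}^n$, $v\in[0,\infty)^n$; (b) $g(sx)=s\,g(x)$ for all $x\in\mathbb{R}^n$, $s>0$. Let $u\in C(\mathbb{R}^n\times[0,1])$ be the unique viscosity solution of the final value problem (P) described in the context. Then, as $N\to\infty$, $$u_N^{\pm}\longrightarrow u\quad\text{uniformly on }\mathbb{R}^n\times[0,1].$$ Furthermore, if $g\in C^4(\mathbb{R}^n)$ with $[g]_{C^4(\mathbb{R}^n)}<\infty$, then there exist $C_1,C_2>0$, depending only on $n$, $\theta_g$ and $[g]_{C^4(\mathbb{R}^n)}$, such that for all $t\in[0,1]$ and all $$N\ge\max\left\{\frac{(d+1)^6}{d^2},\ \frac{C_1 d}{\vartheta_q^3}\right\}$$ it holds that $$\sup_{x\in\mathbb{R}^n}|u_N^{\pm}(x,t)-u(x,t)|\le C_2\left((1-t)d^{2/3}N^{-1/6}+d^{1/3}N^{-1/3}\right).$$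
   Context: Notation: $\mathcal{B}=\{-1,1\}$, $\mathbf{1}=(1,\dots,1)\in\mathbb{R}^n$. For $m=(m_1,\dots,m_d)\in\mathcal{B}^d$ and $b\in\mathcal{B}$, $m|b:=(m_2,\dots,m_d,b)\in\mathcal{B}^d$. $q=(q_1,\dots,q_n):\mathcal{B}^d\to[-1,1]^n$ is a fixed function (expert predictions). Value function: for $N\in\mathbb{N}$, $m\in\mathcal{B}^d$, $x\in\mathbb{R}^n$, $0\le\ell\le N$, set $V_N(x,N;m)=g(x)$ and, for $\ell\le N-1$, $$V_N(x,\ell;m)=\min_{|f_\ell|\le1}\max_{b_\ell=\pm1}\cdots\min_{|f_{N-1}|\le1}\max_{b_{N-1}=\pm1} g\Big(x+\sum_{i=\ell}^{N-1}b_i(q(m^i)-f_i\mathbf{1})\Big),$$ where $f_i\in\mathbb{R}$, $m^\ell=m$ and $m^{i+1}=m^i|b_i$. The rescaled value function is $u_N(x,t;m)=\frac{1}{\sqrt N}V_N(\sqrt N x,\lceil Nt\rceil;m)$ for $t\in[0,1]$, where $\lceil\cdot\rceil$ is the ceiling function, and $$u_N^+(x,t)=\max_{m\in\mathcal{B}^d}u_N(x,t;m),\qquad u_N^-(x,t)=\min_{m\in\mathcal{B}^d}u_N(x,t;m).$$ Constant: $\vartheta_q:=\min_{m\in\mathcal{B}^d}\min\{\sum_{i=1}^n(1-q_i(m)_+),\sum_{i=1}^n(1-q_i(m)_-)\}$, where $a_+=\max\{a,0\}$, $a_-=-\min\{a,0\}$. Semi-norm: $[g]_{C^k(\mathbb{R}^n)}=\sup_{x\in\mathbb{R}^n}\max_{1\le|\alpha|\le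 k}|D^\alpha g(x)|$. PDE: for $p\in\mathbb{R}^n$ with $\langle p,\mathbf{1}\rangle\ne0$ put $\xi(p,m)=q(m)-\frac{\langle p,q(m)\rangle}{\langle p,\mathbf{1}\rangle}\mathbf{1}$, and for a symmetric matrix $X$ put $F(X,p)=\frac1{2^{d+1}}\sum_{m\in\mathcal{B}^d}\langle X\xi(p,m),\xi(p,m)\rangle$ if $\langle p,\mathbf{1}\rangle\neq0$ and $F(X,p)=0$ if $\langle p,\mathbf{1}\rangle=0$. Problem (P) is $$u_t+F(\nabla^2u,\nabla u)=0\ \text{in }\mathbb{R}^n\times(0,1),\qquad u=g\ \text{on }\mathbb{R}^n\times\{t=1\}.$$ Viscosity solutions: an upper semicontinuous $u$ on $\mathbb{R}^n\times[0,1]$ is a viscosity subsolution if whenever $\varphi\in C^\infty(\mathbb{R}^n\times\mathbb{R})$ and $u-\varphi$ has a local maximum at $(x,t)\in\mathbb{R}^n\times(0,1)$, then $\varphi_t+F(\nabla^2\varphi,\nabla\varphi)\ge0$ at $(x,t)$; a lower semicontinuous $v$ is a viscosity supersolution if whenever $v-\varphi$ has a local minimum at $(x,t)\in\mathbb{R}^n\times(0,1)$, then $\varphi_t+F(\nabla^2\varphi,\nabla\varphi)\le0$ at $(x,t)$. A continuous function is a viscosity solution if it is both. ''The unique viscosity solution'' of (P) means the unique viscosity solution in $C(\mathbb{R}^n\times[0,1])$ with $u(\cdot,1)=g$ that has linear growth ($|u(x,t)|\le C(1+|x|)$ for some $C$) and is $\theta$-increasing for some $\theta>0$ ($u(x+s\mathbf{1},t)\ge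 u(x,t)+\theta s$ for all $(x,t)$ and $s\ge0$). *)

(* Defs.v *)
From HB Require Import structures.
From mathcomp Require Import all_boot all_order all_algebra.
From mathcomp Require Import all_classical all_reals all_analysis.
Set Implicit Arguments.
Unset Strict Implicit.
Unset Printing Implicit Defensive.
Import Order.TTheory GRing.Theory Num.Theory.
Import numFieldNormedType.Exports.
Local Open Scope classical_set_scope.
Local Open Scope ring_scope.

Definition one_vec {R : realType} {n : nat} : 'rV[R]_n := const_mx 1.

Definition dot {R : realType} {n : nat} (x y : 'rV[R]_n) : R :=
  \sum_(i < n) x 0 i * y 0 i.

(* {-1, 1} is encoded by bool, with true standing for 1. *)
Definition sgn {R : realType} (b : bool) : R := if b then 1 else -1.

Definition history (d : nat) := {ffun 'I_d -> bool}.

(* m|b : [insub i.+1] is [Some j], with j of value i + 1, iff i + 1 < d. *)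
Definition push {d : nat} (m : history d) (b : bool) : history d :=
  [ffun i : 'I_d => if insub i.+1 is Some j then m j else b].

(* As the index type is finite and inhabited by h0 := [ffun=> true], seeding
   the fold with the value at h0 gives the maximum (minimum) over all
   histories. *)
Definition max_hist {R : realType} {d : nat} (f : history d -> R) : R :=
  \big[Num.max/f [ffun=> true]]_(m : history d) f m.

Definition min_hist {R : realType} {d : nat} (f : history d -> R) : R :=
  \big[Num.min/f [ffun=> true]]_(m : history d) f m.

(* min_{|f|<=1} max_b ... min_{|f|<=1} max_b g (x + sum of all moves), with k
   rounds left, m the current history and s the sum of the moves
   b_i (q(m^i) - f_i 1) already made.  For continuous g the infima are attained,
   hence minima. *)
Fixpoint minmax {R : realType} {n d : nat} (q : history d -> 'rV[R]_n)
    (g : 'rV[R]_n -> R) (x : 'rV[R]_n) (k : nat) (m : history d)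
    (s : 'rV[R]_n) : R :=
  if k is k'.+1 then
    inf [set Num.max
           (minmax q g x k' (push m true)
              (s + sgn true *: (q m - f *: one_vec)))
           (minmax q g x k' (push m false)
              (s + sgn false *: (q m - f *: one_vec)))
        | f in [set f : R | `|f| <= 1]]
  else g (x + s).

Definition value {R : realType} {n d : nat} (q : history d -> 'rV[R]_n)
    (g : 'rV[R]_n -> R) (N : nat) (x : 'rV[R]_n) (l : nat) (m : history d) : R :=
  minmax q g x (N - l)%N m 0.

Definition rescaled {R : realType} {n d : nat} (q : history d -> 'rV[R]_n)
    (g : 'rV[R]_n -> R) (N : nat) (x : 'rV[R]_n) (t : R) (m : history d) : R :=
  (Num.sqrt N%:R)^-1
    * value q g N (Num.sqrt N%:R *: x) `|Num.ceil (N%:R * t)|%N m.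

(* Functions on R^n x [0, 1] are represented by functions on R^n x R of which
   only the values on [cylinder] matter. *)
Definition cylinder {R : realType} {n : nat} : set ('rV[R]_n * R) :=
  [set p | 0 <= p.2 <= 1].

Definition u_plus {R : realType} {n d : nat} (q : history d -> 'rV[R]_n)
    (g : 'rV[R]_n -> R) (N : nat) (p : 'rV[R]_n * R) : R :=
  max_hist (rescaled q g N p.1 p.2).

Definition u_minus {R : realType} {n d : nat} (q : history d -> 'rV[R]_n)
    (g : 'rV[R]_n -> R) (N : nat) (p : 'rV[R]_n * R) : R :=
  min_hist (rescaled q g N p.1 p.2).

Definition pos_part {R : realType} (a : R) : R := Num.max a 0.
Definition neg_part {R : realType} (a : R) : R := - Num.min a 0.

Definition vartheta {R : realType} {n d : nat} (q : history d -> 'rV[R]_n) : R :=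
  min_hist (fun m => Num.min (\sum_(i < n) (1 - pos_part (q m 0 i)))
                             (\sum_(i < n) (1 - neg_part (q m 0 i)))).

(* C^k via partial derivatives, E being the canonical basis of V: all partial
   derivatives of order at most k, in any order of differentiation, exist and
   are continuous. *)
Fixpoint Ck {R : realType} {V : normedModType R} (E : set V) (k : nat)
    (f : V -> R) : Prop :=
  if k is k'.+1 then
    continuous f /\
    forall v, E v -> (forall x, derivable f x v) /\ Ck E k' ('D_v f)
  else continuous f.

Definition evec {R : realType} {n : nat} (i : 'I_n) : 'rV[R]_n := delta_mx 0 i.

Definition space_basis {R : realType} {n : nat} : set 'rV[R]_n :=
  [set evec i | i in [set: 'I_n]].

Definition dir_x {R : realType} {n : nat} (i : 'I_n) : 'rV[R]_n * R := (evec i, 0).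
Definition dir_t {R : realType} {n : nat} : 'rV[R]_n * R := (0, 1).

Definition spacetime_basis {R : realType} {n : nat} : set ('rV[R]_n * R) :=
  [set dir_x i | i in [set: 'I_n]] `|` [set dir_t].

Definition mderiv {R : realType} {n : nat} (alpha : {ffun 'I_n -> nat})
    (g : 'rV[R]_n -> R) : 'rV[R]_n -> R :=
  foldr (fun i h => iter (alpha i) (fun h' => 'D_(evec i) h') h) g (enum 'I_n).

Definition Ck_seminorm {R : realType} {n : nat} (k : nat)
    (g : 'rV[R]_n -> R) : \bar R :=
  ereal_sup [set y : \bar R | exists (x : 'rV[R]_n) (alpha : {ffun 'I_n -> nat}),
    (1 <= \sum_(i < n) alpha i <= k)%N /\ y = (`|mderiv alpha g x|)%:E].

Definition xi {R : realType} {n d : nat} (q : history d -> 'rV[R]_n)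
    (p : 'rV[R]_n) (m : history d) : 'rV[R]_n :=
  q m - (dot p (q m) / dot p one_vec) *: one_vec.

(* Vectors are rows, so the matrix X acts on v by v *m X^T. *)
Definition Fop {R : realType} {n d : nat} (q : history d -> 'rV[R]_n)
    (X : 'M[R]_n) (p : 'rV[R]_n) : R :=
  if dot p one_vec == 0 then 0
  else (2 ^+ d.+1)^-1 *
    \sum_(m : history d) dot (xi q p m *m X^T) (xi q p m).

Definition time_deriv {R : realType} {n : nat} (phi : 'rV[R]_n * R -> R)
    (p : 'rV[R]_n * R) : R := 'D_dir_t phi p.

Definition grad {R : realType} {n : nat} (phi : 'rV[R]_n * R -> R)
    (p : 'rV[R]_n * R) : 'rV[R]_n := \row_i 'D_(dir_x i) phi p.

Definition hess {R : realType} {n : nat} (phi : 'rV[R]_n * R -> R)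
    (p : 'rV[R]_n * R) : 'M[R]_n :=
  \matrix_(i, j) 'D_(dir_x i) ('D_(dir_x j) phi) p.

Definition smooth {R : realType} {n : nat} (phi : 'rV[R]_n * R -> R) : Prop :=
  forall k, Ck spacetime_basis k phi.

Definition usc_within {R : realType} {T : topologicalType} (D : set T)
    (f : T -> R) : Prop :=
  forall x a, D x -> f x < a -> \forall y \near within D (nbhs x), f y < a.

Definition lsc_within {R : realType} {T : topologicalType} (D : set T)
    (f : T -> R) : Prop :=
  forall x a, D x -> a < f x -> \forall y \near within D (nbhs x), a < f y.

Definition local_max {R : realType} {T : topologicalType} (f : T -> R) (x : T) :=
  \forall y \near x, f y <= f x.

Definition local_min {R : realType} {T : topologicalType} (f : T -> R) (x : T) :=
  \forall y \near x, f x <= f y.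

Definition viscosity_subsolution {R : realType} {n d : nat}
    (q : history d -> 'rV[R]_n) (u : 'rV[R]_n * R -> R) : Prop :=
  usc_within cylinder u /\
  forall (phi : 'rV[R]_n * R -> R) (p : 'rV[R]_n * R),
    smooth phi -> 0 < p.2 < 1 -> local_max (fun y => u y - phi y) p ->
    0 <= time_deriv phi p + Fop q (hess phi p) (grad phi p).

Definition viscosity_supersolution {R : realType} {n d : nat}
    (q : history d -> 'rV[R]_n) (v : 'rV[R]_n * R -> R) : Prop :=
  lsc_within cylinder v /\
  forall (phi : 'rV[R]_n * R -> R) (p : 'rV[R]_n * R),
    smooth phi -> 0 < p.2 < 1 -> local_min (fun y => v y - phi y) p ->
    time_deriv phi p + Fop q (hess phi p) (grad phi p) <= 0.

Definition linear_growth {R : realType} {n : nat} (u : 'rV[R]_n * R -> R) : Prop :=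
  exists C : R, forall (x : 'rV[R]_n) (t : R), 0 <= t <= 1 ->
    `|u (x, t)| <= C * (1 + `|x|).

Definition theta_increasing {R : realType} {n : nat} (theta : R)
    (u : 'rV[R]_n * R -> R) : Prop :=
  forall (x : 'rV[R]_n) (t s : R), 0 <= t <= 1 -> 0 <= s ->
    u (x, t) + theta * s <= u (x + s *: one_vec, t).

(* u is a viscosity solution of the final value problem in the class in which
   the latter is uniquely solvable. *)
Definition solves_P {R : realType} {n d : nat} (q : history d -> 'rV[R]_n)
    (g : 'rV[R]_n -> R) (u : 'rV[R]_n * R -> R) : Prop :=
  [/\ {within cylinder, continuous u},
      viscosity_subsolution q u /\ viscosity_supersolution q u,
      forall x, u (x, 1) = g x,
      linear_growth u &
      exists2 theta, 0 < theta & theta_increasing theta u].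

Definition expert_predictions {R : realType} {n d : nat}
    (q : history d -> 'rV[R]_n) : Prop :=
  forall m, (forall i, -1 <= q m 0 i <= 1) /\ q m <> one_vec /\ q m <> - one_vec.

Definition payoff_monotone {R : realType} {n : nat} (theta : R)
    (g : 'rV[R]_n -> R) : Prop :=
  forall x v : 'rV[R]_n, (forall i, 0 <= v 0 i) ->
    g x + theta * dot v one_vec <= g (x + v).

Definition payoff_homogeneous {R : realType} {n : nat}
    (g : 'rV[R]_n -> R) : Prop :=
  forall (x : 'rV[R]_n) (s : R), 0 < s -> g (s *: x) = s * g x.

Definition sup_dist {R : realType} {n : nat} (v u : 'rV[R]_n * R -> R) (t : R) :
    \bar R :=
  ereal_sup [set (`|v (x, t) - u (x, t)|)%:E | x in [set: 'rV[R]_n]].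

(* Main.v *)
(* The equation is geometric: by monotonicity every level set of u(., t) is a graph
   over the hyperplane orthogonal to (1, ..., 1), and the height of this graph
   solves a linear heat equation, whose generator is the average over m of half
   the second derivatives in the directions q(m).  On the side of the game, as
   long as the optimal f respects the bound |f| <= 1 (it does, since g is
   increasing and q(m) differs from (1, ..., 1) and -(1, ..., 1)), both values of b
   are made equally good, and the height y of the graph of a level set obeys the
   recursion y'(x; m) = (y(x + l q(m); m|1) + y(x - l q(m); m|-1)) / 2 with
   l = N^(-1/2).  A corrector of order l^2 averages out the history, which is
   uniform after d rounds, and turns this into an explicit Euler scheme for the
   heat equation.
   The scheme is compared with the viscosity solution on mollified initial
   heights, one time step after the other, with quartic polynomials as barriers.
   Homogeneity makes g Lipschitz continuous and the resulting bounds uniform in x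
   and in the level.
   The rate is trivial: a homogeneous C^1 function is linear, so that under the
   assumptions of the second part u_N = g for all N >= 1, and thus u = g. *)
Require Import Defs.
From HB Require Import structures.
From mathcomp Require Import all_boot all_order all_algebra.
From mathcomp Require Import ring lra.
From mathcomp Require Import all_classical all_reals all_analysis.
Set Implicit Arguments.
Unset Strict Implicit.
Unset Printing Implicit Defensive.
Import Order.TTheory GRing.Theory Num.Theory.
Import numFieldNormedType.Exports.
Local Open Scope classical_set_scope.
Local Open Scope ring_scope.

(** * Vectors and polynomial test functions *)

Section Vectors.
Context {R : realType} {n : nat}.
Implicit Types (x y v w h : 'rV[R]_n) (a s : R).

(** [Fop] is singular where the gradient is orthogonal to [one_vec], and u is merely continuous. So
    each set {u >= c} is trapped on its own by polynomial graphs, and a graph touching a level set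
    has to be turned into a test function touching u. Monotonicity along [one_vec] makes this
    possible, and it keeps the gradient of the test function off the singular set. Only one side is
    estimated: the other one is the same estimate for -u(-x, t), a subsolution because [Fop] is odd
    in the Hessian. As there are about lam^-2 rounds, each must be accurate to o(lam^2). The cubic
    remainders in [jet] give this with a constant K that blows up as the mollification parameter eps
    tends to 0. Hence eps is fixed first, which fixes K for all levels at once, and lam is taken
    small afterwards. The corrector has size lam^2 and thus perturbs the optimal f by O(lam) only;
    the bound |f| <= 1 survives since the heights have slope at most 1 - rho along each q(m), with
    rho > 0 independent of the level. Finally, the levels c and c + k are separated by a height of
    at least k / L, with L a Lipschitz constant of g, so that errors in height become errors in
    value. *)

Lemma dotC x y : dot x y = dot y x.
Proof. by apply: eq_bigr => i _; rewrite mulrC. Qed.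

Lemma dotDl x y v : dot (x + y) v = dot x v + dot y v.
Proof. by rewrite -big_split; apply: eq_bigr => i _; rewrite mxE mulrDl. Qed.

Lemma dotZl a x v : dot (a *: x) v = a * dot x v.
Proof. by rewrite mulr_sumr; apply: eq_bigr => i _; rewrite mxE mulrA. Qed.

Lemma dotDr x y v : dot v (x + y) = dot v x + dot v y.
Proof. by rewrite dotC dotDl !(dotC v). Qed.

Lemma dotZr a x v : dot v (a *: x) = a * dot v x.
Proof. by rewrite dotC dotZl (dotC v). Qed.

Lemma dotNl x v : dot (- x) v = - dot x v.
Proof. by rewrite -scaleN1r dotZl mulN1r. Qed.

Lemma dotNr x v : dot v (- x) = - dot v x.
Proof. by rewrite dotC dotNl (dotC v). Qed.

Lemma dot0l v : dot 0 v = 0.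
Proof. by rewrite -(scale0r 0) dotZl mul0r. Qed.

Lemma dot0r v : dot v 0 = 0.
Proof. by rewrite dotC dot0l. Qed.

Lemma dot_evec v i : dot v (evec i) = v 0 i.
Proof.
rewrite /dot (bigD1 i) //= big1 ?addr0; first by rewrite mxE !eqxx mulr1.
by move=> j ji; rewrite mxE eqxx (negbTE ji) mulr0.
Qed.

Lemma dot_ge0 x : 0 <= dot x x.
Proof. by apply: sumr_ge0 => i _; rewrite -expr2 sqr_ge0. Qed.

Lemma coord_le_norm x i : `|x 0 i| <= `|x|.
Proof. by rewrite [leRHS]mx_normrE; exact: (@le_bigmax _ _ _ 0 (fun k => `|x k.1 k.2|) (0, i)). Qed.

Lemma norm_le_coord x a : 0 <= a -> (forall i, `|x 0 i| <= a) -> `|x| <= a.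
Proof.
move=> a0 xa; rewrite [leLHS]mx_normrE.
by apply/bigmax_leP; split => // -[i j] _ /=; rewrite (ord1 i).
Qed.

(** [|x|] is the largest modulus of a coordinate, whereas the polynomial test functions involve the
    Euclidean square [dot x x]; this passes from the former to the latter. *)
Lemma sqr_norm_le_dot x : `|x| ^+ 2 <= dot x x.
Proof.
rewrite -[leRHS]sqr_sqrtr ?dot_ge0// lerXn2r ?nnegrE ?sqrtr_ge0//.
apply: norm_le_coord => [|i]; first exact: sqrtr_ge0.
rewrite -sqrtr_sqr ler_wsqrtr// /dot (bigD1 i)//= -expr2 lerDl.
by apply: sumr_ge0 => j _; rewrite -expr2 sqr_ge0.
Qed.

Lemma dot_le_norm x y : `|dot x y| <= n%:R * (`|x| * `|y|).
Proof.
apply: (le_trans (ler_norm_sum _ _ _)).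
rewrite mulr_natl -[X in _ *+ X]card_ord -sumr_const; apply: ler_sum => i _.
by rewrite normrM ler_pM// coord_le_norm.
Qed.

Definition mean h : R := dot h one_vec / n%:R.
Definition perp h := h - mean h *: one_vec.

Lemma meanD x y : mean (x + y) = mean x + mean y.
Proof. by rewrite /mean dotDl mulrDl. Qed.

Lemma meanZ a x : mean (a *: x) = a * mean x.
Proof. by rewrite /mean dotZl mulrA. Qed.

Lemma perpD x y : perp (x + y) = perp x + perp y.
Proof. by rewrite /perp meanD scalerDl opprD addrACA. Qed.

Lemma perpZ a x : perp (a *: x) = a *: perp x.
Proof. by rewrite /perp meanZ scalerBr scalerA. Qed.

Lemma perp0 : perp 0 = 0.
Proof. by rewrite /perp /mean dot0l mul0r scale0r subrr. Qed.

Lemma perp_mean x : x = perp x + mean x *: one_vec.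
Proof. by rewrite subrK. Qed.

Hypothesis n_gt0 : (0 < n)%N.

Lemma mean_one : mean one_vec = 1.
Proof.
rewrite /mean /dot (eq_bigr (fun=> 1)) => [|i _]; last by rewrite !mxE mulr1.
by rewrite sumr_const card_ord divff// pnatr_eq0 -lt0n.
Qed.

Lemma perp_one : perp one_vec = 0.
Proof. by rewrite /perp mean_one scale1r subrr. Qed.

Lemma norm_one_vec : `|one_vec : 'rV[R]_n| = 1.
Proof.
apply/le_anti/andP; split.
  by apply: norm_le_coord => // i; rewrite mxE normr1.
have := coord_le_norm one_vec (Ordinal n_gt0); by rewrite mxE normr1.
Qed.

Lemma mean_le x : `|mean x| <= `|x|.
Proof.
rewrite /mean normrM normfV normr_nat ler_pdivrMr ?ltr0n//.
by apply: (le_trans (dot_le_norm _ _)); rewrite norm_one_vec mulr1 mulrC.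
Qed.

Lemma perp_le x : `|perp x| <= 2 * `|x|.
Proof.
apply: (le_trans (ler_normB _ _)).
rewrite normrZ norm_one_vec mulr1; have := mean_le x; lra.
Qed.

End Vectors.

(* Polynomial functions of (x, t), as formal expressions over affine forms: they
   are the only test functions that are needed. *)
Inductive pexp (R : realType) (n : nat) : Type :=
  | Aff of R & 'rV[R]_n & R
  | Padd of pexp R n & pexp R n
  | Pmul of pexp R n & pexp R n.
Arguments Aff {R n}.
Arguments Padd {R n}.
Arguments Pmul {R n}.

Section PolynomialFunctions.
Context {R : realType} {n : nat}.
Implicit Types (e : pexp R n) (p v w : 'rV[R]_n * R).

Fixpoint peval e p : R :=
  match e with
  | Aff a c b => a + dot c p.1 + b * p.2
  | Padd e1 e2 => peval e1 p + peval e2 p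
  | Pmul e1 e2 => peval e1 p * peval e2 p
  end.

Fixpoint pd v e : pexp R n :=
  match e with
  | Aff a c b => Aff (dot c v.1 + b * v.2) 0 0
  | Padd e1 e2 => Padd (pd v e1) (pd v e2)
  | Pmul e1 e2 => Padd (Pmul (pd v e1) e2) (Pmul e1 (pd v e2))
  end.

Definition Pcst a : pexp R n := Aff a 0 0.
Definition Pscale a e := Pmul (Pcst a) e.
Definition Psum (I : Type) (r : seq I) (F : I -> pexp R n) :=
  foldr (fun i e => Padd (F i) e) (Pcst 0) r.

Lemma eval_cst a p : peval (Pcst a) p = a.
Proof. by rewrite /= dot0l mul0r !addr0. Qed.

Lemma pevalD e1 e2 p : peval (Padd e1 e2) p = peval e1 p + peval e2 p.
Proof. by []. Qed.

Lemma pevalM e1 e2 p : peval (Pmul e1 e2) p = peval e1 p * peval e2 p.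
Proof. by []. Qed.

Lemma pevalZ a e p : peval (Pscale a e) p = a * peval e p.
Proof. by rewrite pevalM eval_cst. Qed.

Lemma eval_sum (I : Type) (r : seq I) (F : I -> pexp R n) p :
  peval (Psum r F) p = \sum_(i <- r) peval (F i) p.
Proof.
by elim: r => [|i r IH]; rewrite ?big_nil ?big_cons; rewrite ?eval_cst//= IH.
Qed.

Lemma is_derive_eval e p v : is_derive p v (peval e) (peval (pd v e) p).
Proof.
elim: e p => [a c b|e1 IH1 e2 IH2|e1 IH1 e2 IH2] p /=.
- have E : \forall h \near 0^', dot c v.1 + b * v.2 =
    h^-1 *: ((peval (Aff a c b) \o shift p) (h *: v) - peval (Aff a c b) p).
    near=> h; have h0 : h != 0 by near: h; exact: nbhs_dnbhs_neq.
    rewrite /= dotDr dotZr; apply: (scalerI h0); rewrite scalerA divff// scale1r.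
    rewrite /GRing.scale /=; ring.
  have H : h^-1 *: ((peval (Aff a c b) \o shift p) (h *: v) - peval (Aff a c b) p)
     @[h --> 0^'] --> dot c v.1 + b * v.2.
    apply: cvg_trans (near_eq_cvg E) _; exact: cvg_cst.
  apply: DeriveDef; first by apply/cvg_ex; exists (dot c v.1 + b * v.2).
  by rewrite dot0l mul0r !addr0; exact: cvg_lim H.
- have := is_deriveD (IH1 p) (IH2 p); exact.
- have := is_deriveM (IH1 p) (IH2 p) => H.
  apply: is_derive_eq H _; rewrite /GRing.scale /=; ring.
Unshelve. all: by end_near.
Qed.

Lemma derive_eval v e : 'D_v (peval e) = peval (pd v e).
Proof. by apply/funext => p; have [_] := is_derive_eval e p v. Qed.

Lemma derive_evalE v e p : 'D_v (peval e) p = peval (pd v e) p.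
Proof. by have [_] := is_derive_eval e p v. Qed.

Lemma continuous_dot (c : 'rV[R]_n) : continuous (dot c).
Proof.
have H i : xpredT i -> continuous (fun y : 'rV[R]_n => c 0 i * y 0 i).
  by move=> _ y; exact: (cvgM (cvg_cst (c 0 i)) (@coord_continuous R 1 n 0 i y)).
exact: (continuous_big (x0 := 0) (@add_continuous R^o) H).
Qed.

Lemma continuous_eval e : continuous (peval e).
Proof.
elim: e => [a c b|e1 IH1 e2 IH2|e1 IH1 e2 IH2] p /=.
- apply: cvgD; last by apply: cvgM; [exact: cvg_cst|exact: cvg_snd].
  apply: cvgD; first exact: cvg_cst.
  by apply: (continuous_comp (f := fst)); [exact: cvg_fst|exact: continuous_dot].
- exact: cvgD (IH1 p) (IH2 p).
- exact: cvgM (IH1 p) (IH2 p).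
Qed.

Lemma smooth_eval e : smooth (peval e).
Proof.
move=> k; elim: k e => [|k IH] e /=; first exact: continuous_eval.
split=> [|v _]; first exact: continuous_eval.
by split=> [p|]; [have [] := is_derive_eval e p v|rewrite derive_eval].
Qed.

Lemma pair_shift p (x : 'rV[R]_n) (s : R) :
  p + s *: (x, 0) = (p.1 + s *: x, p.2).
Proof. by rewrite [LHS]surjective_pairing /= scaler0 addr0. Qed.

(** Restriction of [e] to a line as a univariate polynomial, whose low coefficients are the
    directional derivatives. *)
Fixpoint line p w e : {poly R} :=
  match e with
  | Aff a c b => (peval (Aff a c b) p)%:P + (dot c w.1 + b * w.2)%:P * 'X
  | Padd e1 e2 => line p w e1 + line p w e2
  | Pmul e1 e2 => line p w e1 * line p w e2
  end.

Lemma horner_line p w e s : (line p w e).[s] = peval e (p + s *: w).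
Proof.
elim: e => [a c b|e1 IH1 e2 IH2|e1 IH1 e2 IH2] /=; rewrite ?hornerE ?IH1 ?IH2//.
by rewrite dotDr dotZr; rewrite /GRing.scale /=; ring.
Qed.

Lemma coef_line p w e :
  [/\ (line p w e)`_0 = peval e p, (line p w e)`_1 = peval (pd w e) p &
      (line p w e)`_2 *+ 2 = peval (pd w (pd w e)) p].
Proof.
elim: e => [a c b|e1 [A1 B1 C1] e2 [A2 B2 C2]|e1 [A1 B1 C1] e2 [A2 B2 C2]] /=.
- rewrite !coefD !coefCM !coefX !coefC /= !dot0l !mul0r.
  by split; rewrite ?mulr0 ?mulr1 ?addr0 ?add0r ?mul0rn.
- by rewrite !coefD A1 A2 B1 B2 mulrnDl C1 C2.
- rewrite !coefM !big_ord_recr !big_ord0 /= A1 A2 B1 B2 -C1 -C2; split; ring.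
Qed.

Lemma horner_inj (r1 r2 : {poly R}) : (forall s, r1.[s] = r2.[s]) -> r1 = r2.
Proof.
move=> E; apply/eqP; rewrite -subr_eq0; apply/eqP.
pose rs : seq R := [seq k%:R | k <- iota 0 (size (r1 - r2))].
apply: (@roots_geq_poly_eq0 _ _ rs).
- by apply/allP => s _; rewrite /root hornerD hornerN E subrr.
- by rewrite map_inj_uniq ?iota_uniq// => i j /eqP; rewrite eqr_nat => /eqP.
- by rewrite size_map size_iota.
Qed.

(* Derivatives along a line are read off from the restriction to this line. *)
Lemma pd_line p w e (r : {poly R}) :
  (forall s, peval e (p + s *: w) = r.[s]) ->
  peval (pd w e) p = r`_1 /\ peval (pd w (pd w e)) p = r`_2 *+ 2.
Proof.
move=> E; have -> : r = line p w e by apply: horner_inj => s; rewrite horner_line.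
by have [_ -> ->] := coef_line p w e.
Qed.

Lemma pdD v w e p : peval (pd (v + w) e) p = peval (pd v e) p + peval (pd w e) p.
Proof.
by elim: e => [a c b|e1 IH1 e2 IH2|e1 IH1 e2 IH2] /=;
  rewrite ?IH1 ?IH2 ?dotDr; try rewrite !dot0l; ring.
Qed.

Lemma pdZ a v e p : peval (pd (a *: v) e) p = a * peval (pd v e) p.
Proof.
by elim: e => [a' c b|e1 IH1 e2 IH2|e1 IH1 e2 IH2] /=;
  rewrite ?IH1 ?IH2 ?dotZr /GRing.scale /=; try rewrite !dot0l; ring.
Qed.

Lemma pdC v w e p : peval (pd v (pd w e)) p = peval (pd w (pd v e)) p.
Proof.
elim: e p => [a c b|e1 IH1 e2 IH2|e1 IH1 e2 IH2] p /=; rewrite ?dot0l; try ring.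
  by rewrite IH1 IH2.
rewrite IH1 IH2; ring.
Qed.

Lemma pd_coord (x : 'rV[R]_n) e p :
  peval (pd (x, 0) e) p = \sum_i x 0 i * peval (pd (dir_x i) e) p.
Proof.
have -> : (x, 0 : R) = \sum_i x 0 i *: (dir_x i : 'rV[R]_n * R).
  rewrite [RHS]surjective_pairing; congr (_, _).
    rewrite raddf_sum {1}[x]row_sum_delta //.
  by rewrite raddf_sum /= big1// => i _; rewrite /GRing.scale /= mulr0.
elim/big_rec2: _ => [|i y z _ IH]; last by rewrite pdD pdZ IH.
by rewrite -(scale0r 0) pdZ mul0r.
Qed.

End PolynomialFunctions.

(** * Level sets and the linear heat equation *)

Lemma closed_le_fun (R : realType) (T : topologicalType) (f : T -> R) a :
  continuous f -> closed [set x | f x <= a].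
Proof. by move/continuous_closedP => /(_ _ (@closed_le R a)). Qed.

Lemma closed_ge_fun (R : realType) (T : topologicalType) (f : T -> R) a :
  continuous f -> closed [set x | a <= f x].
Proof. by move/continuous_closedP => /(_ _ (@closed_ge R a)). Qed.

Lemma continuous_normB (R : realType) (V : normedModType R) (p : V) :
  continuous (fun x : V => `|x - p|).
Proof.
by move=> x; apply: cvg_norm; apply: cvgB; [exact: cvg_id|exact: cvg_cst].
Qed.

Lemma continuous_norm_fst (R : realType) (V W : normedModType R) (p : V) :
  continuous (fun y : V * W => `|y.1 - p|).
Proof.
move=> y; have H : fst @ y --> y.1 by exact: cvg_fst.
exact: (continuous_comp H (@continuous_normB _ _ p _)).
Qed.

Lemma continuous_norm_snd (R : realType) (V W : normedModType R) (p : W) :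
  continuous (fun y : V * W => `|y.2 - p|).
Proof.
move=> y; have H : snd @ y --> y.2 by exact: cvg_snd.
exact: (continuous_comp H (@continuous_normB _ _ p _)).
Qed.

Section Boxes.
Context {R : realType} {n : nat}.
Implicit Types (p y : 'rV[R]_n * R) (Q : 'rV[R]_n * R -> Prop).

(** Closed product neighbourhoods: being compact, they serve both the local statements and the
    extreme value theorem. *)
Definition box p (r : R) : set ('rV[R]_n * R) :=
  [set y | `|y.1 - p.1| <= r /\ `|y.2 - p.2| <= r].

Lemma near_box p Q : (\forall y \near p, Q y) ->
  exists2 r, 0 < r & forall y, box p r y -> Q y.
Proof.
move=> /nbhs_ballP[r /= r0 H]; exists (r / 2); first by rewrite divr_gt0.
move=> y [H1 H2]; apply: H; split; rewrite -ball_normE /= distrC;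
  by apply: (le_lt_trans (y := r / 2)) => //; lra.
Qed.

Lemma box_near p r Q : 0 < r -> (forall y, box p r y -> Q y) ->
  \forall y \near p, Q y.
Proof.
move=> r0 H; apply/nbhs_ballP; exists r => //= y [].
by rewrite -!ball_normE /= => H1 H2; apply: H; split; rewrite distrC ltW.
Qed.

Lemma box_compact p r : compact (box p r).
Proof.
have -> : box p r = [set x | `|x - p.1| <= r] `*` `[p.2 - r, p.2 + r].
  rewrite set_itvcc.
  by apply/seteqP; split => y /= [H1 H2]; split => //; rewrite ler_distl in H2 *.
apply: compact_setX; last exact: segment_compact.
apply: bounded_closed_compact.
  exists (r + `|p.1|); split=> [|M rM x /= H]; first exact: num_real.
  apply/ltW/(le_lt_trans _ rM); rewrite -[x in leLHS](subrK p.1).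
  by apply: (le_trans (ler_normD _ _)); rewrite lerD2r.
exact/closed_le_fun/continuous_normB.
Qed.

End Boxes.

(** * Level sets touched by polynomial graphs *)

Section LevelSetTest.
Context {R : realType} {n d : nat}.
Variable q : history d -> 'rV[R]_n.
Implicit Types (e : pexp R n) (p y : 'rV[R]_n * R) (x : 'rV[R]_n) (t s : R).

(** The heat operator as a formal expression, from which the continuity of [heat e] follows. *)
Definition Pheat e : pexp R n := Padd (pd dir_t e)
  (Pscale (2 ^+ d.+1)^-1
     (Psum (index_enum (history d)) (fun m => pd (q m, 0) (pd (q m, 0) e)))).

Definition heat e p : R := peval (pd dir_t e) p +
  (2 ^+ d.+1)^-1 * \sum_m peval (pd (q m, 0) (pd (q m, 0) e)) p.

Lemma peval_heat e : peval (Pheat e) = heat e.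
Proof.
by apply/funext => p; rewrite /Pheat /Pscale /= eval_sum !dot0l mul0r !addr0.
Qed.

Lemma continuous_heat e : continuous (heat e).
Proof. rewrite -peval_heat; exact: continuous_eval. Qed.

Lemma heatD e1 e2 p : heat (Padd e1 e2) p = heat e1 p + heat e2 p.
Proof. by rewrite /heat /= big_split /=; ring. Qed.

Lemma heatZ a e p : heat (Pscale a e) p = a * heat e p.
Proof.
rewrite /heat /= !dot0l mulrDr [in RHS]mulrCA [in RHS]mulr_sumr.
congr (_ + _ * _); first ring.
by apply: eq_bigr => m _; rewrite ?dot0l; ring.
Qed.

Definition poly_subsolution (u : 'rV[R]_n * R -> R) := forall e p,
  0 < p.2 < 1 -> local_max (fun y => u y - peval e y) p ->
  0 <= time_deriv (peval e) p + Fop q (hess (peval e) p) (grad (peval e) p).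

(* The zero level set of e(., t) is the graph of a function over the hyperplane
   orthogonal to the all-ones vector. *)
Definition graphlike e := forall x t s,
  peval e (x + s *: one_vec, t) = peval e (x, t) - s.

Definition theta_incr (theta : R) (u : 'rV[R]_n * R -> R) := forall x t s,
  0 <= s -> u (x, t) + theta * s <= u (x + s *: one_vec, t).

Lemma grad_dot e p x : dot (grad (peval e) p) x = peval (pd (x, 0) e) p.
Proof.
rewrite pd_coord dotC; apply: eq_bigr => i _.
by rewrite mxE derive_evalE.
Qed.

Lemma hess_dot e p x : dot (x *m (hess (peval e) p)^T) x =
  peval (pd (x, 0) (pd (x, 0) e)) p.
Proof.
rewrite pd_coord dotC; apply: eq_bigr => i _; congr (_ * _).
rewrite pdC pd_coord mxE; apply: eq_bigr => j _; congr (_ * _).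
by rewrite !mxE derive_eval derive_evalE pdC.
Qed.

(* The nonlinear operator is geometric, so that the relabelling phi of the level
   sets of e only contributes the factor H' to the linear heat operator. *)
Lemma Fop_relabel e (lam mu : R) p :
  (forall x t s, peval e (x + s *: one_vec, t) = peval e (x, t) + s) ->
  let phi := Padd (Pscale lam e) (Pscale mu (Pmul e e)) in
  let H' := lam + 2 * mu * peval e p in
  H' != 0 ->
  time_deriv (peval phi) p +
    Fop q (hess (peval phi) p) (grad (peval phi) p) = H' * heat e p.
Proof.
move=> einv phi H' H'0.
have D v : peval (pd v phi) p = H' * peval (pd v e) p.
  by rewrite /= !dot0l /H'; ring.
have D2 v : peval (pd v (pd v phi)) p =
    H' * peval (pd v (pd v e)) p + 2 * mu * peval (pd v e) p ^+ 2.
  by rewrite /= !dot0l /H'; ring.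
have D1 : peval (pd (one_vec, 0) e) p = 1.
  have [|-> _] := @pd_line R n p (one_vec, 0) e ((peval e p)%:P + 'X).
    by move=> s; rewrite !hornerE pair_shift einv -surjective_pairing addrC.
  by rewrite coefD coefC coefX /= add0r.
have Dxi m (k := dot (grad (peval phi) p) (q m) / H') :
    peval (pd (q m - k *: one_vec, 0) (pd (q m - k *: one_vec, 0) e)) p =
    peval (pd (q m, 0) (pd (q m, 0) e)) p.
  have [|_ ->] := @pd_line R n p (q m - k *: one_vec, 0) e
     (line p (q m, 0) e - k%:P * 'X).
    move=> s; rewrite !hornerE horner_line !pair_shift scalerBr addrA scalerA.
    by rewrite -scaleNr einv [s * k]mulrC.
  rewrite coefB coefCM coefX /= mulr0 subr0.
  by have [_ _ ->] := coef_line p (q m, 0) e.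
have G1 : dot (grad (peval phi) p) one_vec = H'.
  by rewrite grad_dot D D1 mulr1.
rewrite /time_deriv derive_evalE D /Fop G1 (negbTE H'0).
rewrite /heat mulrDr [in RHS]mulrCA; congr (_ + _ * _).
rewrite mulr_sumr; apply: eq_bigr => m _.
rewrite hess_dot D2 /xi G1 Dxi.
have : peval (pd (xi q (grad (peval phi) p) m, 0) phi) p = 0.
  by rewrite -grad_dot /xi dotDr dotNr dotZr G1 divfK// subrr.
rewrite D => /eqP; rewrite mulf_eq0 (negbTE H'0) /= => /eqP.
by rewrite /xi G1 => ->; ring.
Qed.

Definition Pperp x0 (i : 'I_n) : pexp R n :=
  let c := evec i - n%:R^-1 *: one_vec in Aff (- dot c x0) c 0.

Definition Psq x0 : pexp R n :=
  Psum (index_enum 'I_n) (fun i => Pmul (Pperp x0 i) (Pperp x0 i)).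

Lemma peval_perp x0 i y : peval (Pperp x0 i) y = perp (y.1 - x0) 0 i.
Proof.
rewrite /= mul0r addr0 addrC -dotNr -dotDr dotDl dotNl dotZl.
rewrite [dot (evec i) _]dotC dot_evec [dot one_vec _]dotC.
move: (y.1 - x0) => h.
by rewrite /perp !mxE mulr1 /mean [_ / _]mulrC.
Qed.

Lemma peval_sq x0 y :
  peval (Psq x0) y = dot (perp (y.1 - x0)) (perp (y.1 - x0)).
Proof.
rewrite eval_sum /dot; apply: eq_bigr => i _.
by rewrite -!peval_perp.
Qed.

Hypothesis n_gt0 : (0 < n)%N.

Lemma perp_shift x s : perp (x + s *: one_vec) = perp x.
Proof. by rewrite perpD perpZ perp_one// scaler0 addr0. Qed.

(** The points with e > 0 lie below the graph e = 0, so {u > c} stays above this graph near p0 and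
    the level set is touched from one side. A test function for u is obtained as a quadratic
    function [phi] of a strict perturbation [v] of -e, steep enough for u - phi to attain its
    maximum inside a box. *)
Lemma level_set_test (u : 'rV[R]_n * R -> R) theta c e p0 :
  continuous u -> 0 < theta -> theta_incr theta u -> poly_subsolution u ->
  graphlike e -> 0 < p0.2 < 1 -> u p0 = c -> peval e p0 = 0 ->
  (\forall y \near p0, 0 <= peval e y -> u y <= c) ->
  heat e p0 <= 0.
Proof.
move=> cu th0 uth usub einv p01 up0 ep0 ucle.
rewrite leNgt; apply/negP => he.
pose tau : pexp R n := Aff (- p0.2) 0 1.
(* Adding eps * sig makes the contact at p0 strict, while eps is so small that the heat operator
   keeps its sign. *)
pose sig := Padd (Psq p0.1) (Pmul tau tau).
have sigE y : peval sig y =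
    dot (perp (y.1 - p0.1)) (perp (y.1 - p0.1)) + (y.2 - p0.2) ^+ 2.
  by rewrite [LHS]/= peval_sq dot0l; ring.
have sig0 y : 0 <= peval sig y.
  by rewrite sigE addr_ge0 ?sqr_ge0 ?dot_ge0.
have [eps eps0 heps] : exists2 eps, 0 < eps & eps * heat sig p0 < heat e p0.
  have [h0|h0] := leP (heat sig p0) 0.
    by exists 1 => //; rewrite mul1r; lra.
  exists (heat e p0 / (2 * heat sig p0)); first by rewrite divr_gt0 ?mulr_gt0.
  by rewrite invfM mulrA mulfVK ?gt_eqF//; lra.
pose v := Padd (Pscale (- 1) e) (Pscale eps sig).
have vE y : peval v y = - peval e y + eps * peval sig y.
  by rewrite pevalD !pevalZ mulN1r.
have vinv x t s : peval v (x + s *: one_vec, t) = peval v (x, t) + s.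
  have -> : peval v (x + s *: one_vec, t) =
      - peval e (x + s *: one_vec, t) + eps * peval sig (x, t).
    by rewrite vE !sigE /= [x + _ - _]addrAC perp_shift.
  by rewrite vE einv; ring.
have hv0 : heat v p0 < 0 by rewrite heatD !heatZ; lra.
have vsig0 y : 0 <= - peval e y -> - peval e y + eps * peval sig y <= 0 -> y = p0.
  move=> e0 H.
  have sy : peval sig y = 0.
    apply/le_anti; rewrite sig0 andbT.
    have : eps * peval sig y <= 0 by lra.
    by rewrite pmulr_rle0.
  have ey : peval e y = 0 by move: H; rewrite sy mulr0; lra.
  move: (sy); rewrite sigE => /eqP; rewrite paddr_eq0 ?sqr_ge0 ?dot_ge0//.
  rewrite sqrf_eq0 subr_eq0 => /andP[/eqP d0 /eqP ty].
  have pr0 : perp (y.1 - p0.1) = 0.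
    apply/normr0_eq0/eqP; rewrite -sqrf_eq0 eq_le sqr_ge0 andbT.
    by rewrite -[leRHS]d0 sqr_norm_le_dot.
  have yE : y.1 = p0.1 + mean (y.1 - p0.1) *: one_vec.
    by rewrite -[LHS](subrKC p0.1) {1}[y.1 - p0.1]perp_mean pr0 add0r.
  have yE' : y = (p0.1 + mean (y.1 - p0.1) *: one_vec, p0.2).
    by rewrite -yE -ty; case: (y).
  have : peval e y = peval e p0 - mean (y.1 - p0.1).
    by rewrite {1}yE' einv -surjective_pairing.
  rewrite ey ep0 => k0; have {}k0 : mean (y.1 - p0.1) = 0 by lra.
  by rewrite yE' k0 scale0r addr0 -surjective_pairing.
have nheat : \forall y \near p0, heat v y < 0.
  have := @cvgr_lt _ _ (nbhs p0) _ (heat v) (heat v p0).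
  by apply => //; exact: continuous_heat.
have [r1 r10 Hr1] : exists2 r, 0 < r & forall y, box p0 r y ->
    [/\ heat v y < 0, 0 < y.2 < 1 & 0 <= peval e y -> u y <= c].
  apply: near_box; near=> y; split.
  - by near: y.
  - near: y; move/andP: p01 => [p010 p011].
    have cy2 : (fun y : 'rV[R]_n * R => y.2) @ p0 --> p0.2 by exact: cvg_snd.
    near=> y; apply/andP; split; near: y.
      exact: cvgr_gt cy2 _ p010.
    exact: cvgr_lt cy2 _ p011.
  - by near: y.
have [r2 r20 Hr2] : exists2 r, 0 < r & forall y, box p0 r y ->
    `|peval e y| <= r1 / 2.
  apply: near_box.
  have ce : (fun y => `|peval e y|) @ p0 --> `|peval e p0|.
    by apply: cvg_norm; exact: continuous_eval.
  have H : `|peval e p0| < r1 / 2 by rewrite ep0 normr0 divr_gt0.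
  near=> y; apply: ltW; near: y; exact: cvgr_lt ce _ H.
pose r := Num.min r2 (r1 / 2).
have r0 : 0 < r by rewrite lt_min r20 divr_gt0.
have inD y : box p0 r y -> [/\ box p0 r1 y, box p0 r2 y & `|peval e y| <= r1 / 2].
  move=> [y1 y2]; have rr1 : r <= r1 by rewrite ge_min; apply/orP; right; lra.
  have rr2 : r <= r2 by rewrite ge_min lexx.
  by split; [split; lra|split; lra|apply: Hr2; split; lra].
(* Below the graph, moving up by e(y) reaches the graph, where u <= c; hence u(y) <= c - theta e(y).
   A slope smaller than theta leaves room for strictness. *)
pose lam := theta / 2.
have claim1 mu y : 0 <= mu -> box p0 r y -> 0 <= peval e y -> y <> p0 ->
    u y - c - (lam * peval v y + mu * peval v y ^+ 2) < 0.
  move=> mu0 Dy ey yp0.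
  have [_ _ ey1] := inD _ Dy.
  have [] := Hr1 (y.1 + peval e y *: one_vec, y.2).
    case: Dy => /= y1 y2; split => /=.
      rewrite addrAC; apply: (le_trans (ler_normD _ _)).
      rewrite normrZ norm_one_vec// mulr1.
      have : r <= r1 / 2 by rewrite ge_min lexx orbT.
      lra.
    have : r <= r1 / 2 by rewrite ge_min lexx orbT.
    lra.
  rewrite einv -surjective_pairing subrr lexx => _ _ /(_ isT) uc.
  have := uth y.1 y.2 _ ey; rewrite -surjective_pairing => uy.
  have S0 : 0 <= eps * peval sig y by rewrite mulr_ge0 // ltW.
  have SE : 0 < peval e y + eps * peval sig y.
    rewrite lt_neqAle addr_ge0// andbT; apply/eqP => E.
    by apply: yp0; apply: vsig0; lra.
  have : 0 <= mu * peval v y ^+ 2 by rewrite mulr_ge0 ?sqr_ge0.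
  have := mulr_gt0 th0 SE; rewrite vE /lam; nra.
have cU := continuous_subspaceT cu.
have D0 : box p0 r !=set0.
  by exists p0; split; rewrite subrr normr0 ltW.
have [ym _ ymax] := compact_EVT_max D0 (@box_compact _ _ p0 r) (cU _).
(* On or above the graph u may exceed c, but on the faces of the box v is bounded below by some v0 >
   0, and the coefficient mu of v^2 is chosen to dominate u - c there. *)
pose B := box p0 r `&` ([set y | peval e y <= 0] `&`
   ([set y | r <= `|y.1 - p0.1|] `|` [set y | r <= `|y.2 - p0.2|])).
have cB : compact B.
  apply: compact_closedI; first exact: box_compact.
  apply: closedI; first exact/closed_le_fun/continuous_eval.
  apply: closedU; apply: closed_ge_fun => y.
    exact: continuous_norm_fst.
  exact: continuous_norm_snd.
have Bp0 y : B y -> y <> p0.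
  by move=> [_ [_ /= []]] H yp; move: H; rewrite yp subrr normr0 leNgt r0.
have [v0 v00 Hv0] : exists2 v0, 0 < v0 & forall y, B y -> v0 <= peval v y.
  have [B0|/set0P B0] := eqVneq B set0.
    by exists 1 => // y; rewrite B0.
  have [yb /set_mem Byb ymin] := compact_EVT_min B0 cB
    (continuous_subspaceT (@continuous_eval _ _ v)).
  exists (peval v yb) => [|y By]; last by apply: ymin; rewrite inE.
  rewrite ltNge; apply/negP; rewrite vE => vneg; apply: (Bp0 _ Byb).
  by apply: vsig0 => //; case: Byb => _ [] /= ? _; lra.
pose mu := (`|u ym - c| + 1) / v0 ^+ 2.
have mu0 : 0 <= mu by rewrite divr_ge0 ?sqr_ge0 ?addr_ge0.
pose phi := Padd (Pscale lam v) (Pscale mu (Pmul v v)).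
have phiE y : peval phi y = lam * peval v y + mu * peval v y ^+ 2.
  by rewrite pevalD !pevalZ pevalM expr2.
have cPhi : continuous (fun y => u y - peval phi y).
  by move=> y; apply: cvgB; [exact: cu|exact: continuous_eval].
have [yh /set_mem Dyh hmax] := compact_EVT_max D0 (@box_compact _ _ p0 r)
  (continuous_subspaceT cPhi).
have vp0 : peval v p0 = 0.
  by rewrite vE ep0 sigE !subrr perp0 dot0l expr0n /= oppr0 !add0r mulr0.
have Phi0 : c <= u yh - peval phi yh.
  have /hmax : p0 \in box p0 r by rewrite inE; split; rewrite subrr normr0 ltW.
  by rewrite up0 (phiE p0) vp0 expr2 !mulr0 addr0 subr0.
have yhint : `|yh.1 - p0.1| < r /\ `|yh.2 - p0.2| < r.
  apply: contrapT => nint.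
  have yhp0 : yh <> p0.
    by move=> E; apply: nint; rewrite E !subrr !normr0.
  move: Phi0; rewrite phiE => Phi0.
  have [ey|ey] := leP 0 (peval e yh).
    by have := claim1 mu yh mu0 Dyh ey yhp0; lra.
  have Byh : B yh.
    split => //; split => /=; first exact: ltW.
    have [H1|H1] := leP r `|yh.1 - p0.1|; first by left.
    have [H2|H2] := leP r `|yh.2 - p0.2|; first by right.
    by case: nint.
  have vv0 := Hv0 _ Byh.
  have uy : u yh <= u ym by apply: ymax; rewrite inE.
  have mv : `|u ym - c| + 1 <= mu * peval v yh ^+ 2.
    rewrite -[leLHS](@divfK _ (v0 ^+ 2)) ?gt_eqF ?exprn_gt0//.
    by rewrite ler_wpM2l// lerXn2r// nnegrE ltW// (lt_le_trans v00).
  have lv : 0 <= lam * peval v yh.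
    by rewrite mulr_ge0 ?divr_ge0 ?ltW// (lt_le_trans v00).
  by have := ler_norm (u ym - c); lra.
have [del del0 Hdel] : exists2 del, 0 < del & forall y, box yh del y -> box p0 r y.
  exists (Num.min (r - `|yh.1 - p0.1|) (r - `|yh.2 - p0.2|)).
    by rewrite lt_min !subr_gt0; case: yhint => -> ->.
  move=> y []; rewrite !le_min => /andP[H1 _] /andP[_ H2]; split.
    by apply: (le_trans (ler_distD yh.1 _ _)); lra.
  by apply: (le_trans (ler_distD yh.2 _ _)); lra.
have lmax y : box yh del y -> u y - peval phi y <= u yh - peval phi yh.
  by move=> /Hdel Dy; apply: hmax; rewrite inE.
have [/Hr1[hv yh01 _] _ _] := inD _ Dyh.
have := usub phi yh yh01 (box_near del0 lmax).
(* A shift of the maximum point by s along [one_vec] raises u by at least theta s and phi by s H' +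
   mu s^2, where H' is the derivative of the relabelling. Maximality gives H' >= theta - mu s >
   0. *)
pose s := Num.min del (theta / (2 * (mu + 1))).
have s0 : 0 < s by rewrite lt_min del0 divr_gt0 ?mulr_gt0 ?ltr_wpDl.
have mus : mu * s <= theta / 2.
  have : s * (2 * (mu + 1)) <= theta.
    by rewrite -ler_pdivlMr ?mulr_gt0 ?ltr_wpDl// ge_min lexx orbT.
  nra.
have H'0 : 0 < lam + 2 * mu * peval v yh.
  have /lmax : box yh del (yh.1 + s *: one_vec, yh.2).
    split => /=; last by rewrite subrr normr0 ltW.
    by rewrite addrC addKr normrZ norm_one_vec// mulr1 gtr0_norm// ge_min lexx.
  rewrite !phiE vinv -!surjective_pairing => H.
  have := uth yh.1 yh.2 _ (ltW s0); rewrite -surjective_pairing => H'.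
  have : s * (lam + 2 * mu * peval v yh) >= s * (theta - mu * s) by nra.
  by rewrite ler_pM2l//; rewrite /lam; lra.
rewrite (Fop_relabel vinv) ?gt_eqF// pmulr_rge0// leNgt hv.
Unshelve. all: by end_near.
Qed.

End LevelSetTest.

(** * Barriers *)

Lemma bernoulli (R : realType) (rho : R) j :
  1 <= rho -> 1 + j%:R * (rho - 1) <= rho ^+ j.
Proof.
move=> rho1; elim: j => [|j IH]; first by rewrite expr0; lra.
rewrite exprS -natr1; apply: (le_trans _ (ler_wpM2l _ IH)); last lra.
have : 0 <= j%:R * (rho - 1) ^+ 2 by rewrite mulr_ge0 ?sqr_ge0.
rewrite expr2; lra.
Qed.

Lemma exp_unbounded (R : realType) (rho B : R) : 1 < rho ->
  exists j, B < rho ^+ j.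
Proof.
move=> rho1; exists (Num.trunc (`|B| / (rho - 1))).+1.
apply: lt_le_trans (bernoulli _ (ltW rho1)).
have : `|B| / (rho - 1) < (Num.trunc (`|B| / (rho - 1))).+1%:R.
  by apply: truncnS_gt.
rewrite ltr_pdivrMr ?subr_gt0// => H.
by have := ler_norm B; lra.
Qed.

Lemma near_gt (R : realType) (T : topologicalType) (f : T -> R) a x :
  continuous f -> a < f x -> \forall y \near x, a < f y.
Proof. by move=> cf; apply: cvgr_gt; exact: cf. Qed.

Section Barrier.
Context {R : realType} {n d : nat}.
Variable q : history d -> 'rV[R]_n.
Implicit Types (e : pexp R n) (p y : 'rV[R]_n * R) (x : 'rV[R]_n) (t s : R).

Fixpoint Ppow e j := if j is j'.+1 then Pmul e (Ppow e j') else Pcst 1.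

Lemma peval_pow e j p : peval (Ppow e j) p = peval e p ^+ j.
Proof. by elim: j => [|j IH]; rewrite ?eval_cst// exprS -IH. Qed.

Lemma heat_pow_time (a b : R) j p (tau := Aff a 0 b : pexp R n) :
  b <= 0 -> 0 <= peval tau p -> heat q (Ppow tau j) p <= 0.
Proof.
move=> b0 taup; rewrite /heat.
have dx (w : 'rV[R]_n) y : peval (pd (w, 0) tau) y = 0.
  by rewrite /= !dot0l; ring.
have -> : \sum_m peval (pd (q m, 0) (pd (q m, 0) (Ppow tau j))) p = 0.
  apply: big1 => m _.
  elim: j => [|j IH]; first by rewrite /= !dot0l; ring.
  by rewrite /= in IH *; rewrite !dot0l IH; ring.
rewrite mulr0 addr0; elim: j => [|j IH]; first by rewrite /= !dot0l; lra.
rewrite [leLHS]/= peval_pow -/(peval tau p) !dot0l mulr1 add0r.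
have tE : a + 0 + b * p.2 = peval tau p by rewrite /= dot0l.
rewrite tE mul0r !addr0 -[leRHS]addr0; apply: lerD; first by rewrite mulr_le0_ge0 ?exprn_ge0.
exact: mulr_ge0_le0.
Qed.

Hypothesis n_gt0 : (0 < n)%N.

Lemma shift_down (u : 'rV[R]_n * R -> R) c x t : continuous u -> c < u (x, t) ->
  exists2 s, 0 < s & c <= u (x + (- s) *: one_vec, t).
Proof.
move=> cu uc.
have [r r0 Hr] : exists2 r, 0 < r & forall y, box (x, t) r y -> c < u y.
  exact/near_box/near_gt.
exists r => //; apply/ltW/Hr; split => /=; last by rewrite subrr normr0 ltW.
by rewrite addrC addKr normrZ norm_one_vec// mulr1 normrN gtr0_norm.
Qed.

(** A maximum principle on the set {u >= c}: at a positive maximum of e, the graph through the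
    maximum point touches the level set, which [level_set_test] forbids when the heat operator is
    positive on e. *)
Lemma barrier (u : 'rV[R]_n * R -> R) theta c e t0 t1 :
  continuous u -> 0 < theta -> theta_incr theta u -> poly_subsolution q u ->
  graphlike e -> 0 <= t0 -> t1 <= 1 ->
  (forall x, c <= u (x, t1) -> peval e (x, t1) <= 0) ->
  (exists M, forall x t, t0 <= t <= t1 -> c <= u (x, t) ->
     0 <= peval e (x, t) -> `|x| <= M) ->
  (forall x t, t0 < t < t1 -> u (x, t) = c -> 0 < peval e (x, t) ->
     0 < heat q e (x, t)) ->
  forall x t, t0 < t <= t1 -> c <= u (x, t) -> peval e (x, t) <= 0.
Proof.
move=> cu th0 uth usub einv t00 t11 final [M bnd] strict xs ts /andP[t0s st1] us.
rewrite leNgt; apply/negP => es.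
have {}st1 : ts < t1.
  rewrite lt_neqAle st1 andbT; apply/eqP => E.
  by move: es; rewrite ltNge E; apply/negP/negPn/final; rewrite -E.
pose K : set ('rV[R]_n * R) := box (0, t0) (Num.max M (t1 - t0)) `&`
  ([set y | c <= u y] `&` ([set y | 0 <= peval e y] `&`
  ([set y | t0 <= y.2] `&` [set y | y.2 <= t1]))).
have cK : compact K.
  have c2 : continuous (snd : 'rV[R]_n * R -> R) by move=> y; exact: cvg_snd.
  apply: compact_closedI; first exact: box_compact.
  apply: closedI; first exact: closed_ge_fun.
  apply: closedI; first exact/closed_ge_fun/continuous_eval.
  by apply: closedI; [exact: closed_ge_fun|exact: closed_le_fun].
have KP x t : t0 <= t <= t1 -> c <= u (x, t) -> 0 <= peval e (x, t) -> K (x, t).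
  move=> tt H1 H2; have /andP[tt1 tt2] := tt.
  do ! split => //=; rewrite le_max; apply/orP; [left|right].
    by rewrite subr0; exact: bnd H2.
  by rewrite ger0_norm ?subr_ge0// lerB.
have Ks : K (xs, ts) by apply: KP => //; rewrite ?ltW ?t0s ?st1.
have K0 : K !=set0 by exists (xs, ts).
have [yB _ Bmax] := compact_EVT_max K0 cK (continuous_subspaceT (@continuous_eval _ _ e)).
pose del := peval e (xs, ts).
(* To keep the maximum off the time t0, del / 2 * tau^j is subtracted, with tau affine in time,
   equal to 1 at ts and to this ratio at t0. For large j the penalty at t0 exceeds the maximum of e,
   while it costs only half of e(xs, ts) at ts. As tau decreases in time, the subtraction can only
   raise the heat operator. *)
have rho1 : 1 < (t1 - t0) / (t1 - ts).
  by rewrite ltr_pdivlMr ?subr_gt0// mul1r; lra.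
have [j Hj] := exp_unbounded (peval e yB / (del / 2)) rho1.
pose tau : pexp R n := Aff (t1 / (t1 - ts)) 0 (- (t1 - ts)^-1).
have tauE y : peval tau y = (t1 - y.2) / (t1 - ts).
  by rewrite /= dot0l; ring.
have tau0 y : y.2 <= t1 -> 0 <= peval tau y.
  by move=> yt; rewrite tauE divr_ge0 ?subr_ge0// ltW.
pose e' := Padd e (Pscale (- (del / 2)) (Ppow tau j)).
have e'E y : peval e' y = peval e y - del / 2 * peval tau y ^+ j.
  by rewrite pevalD pevalZ peval_pow mulNr.
have e'le y : y.2 <= t1 -> peval e' y <= peval e y.
  move=> yt; rewrite e'E gerBl mulr_ge0 ?divr_ge0 ?exprn_ge0 ?tau0//.
  exact: ltW.
have e'inv : graphlike e'.
  by move=> x t s; rewrite !e'E !tauE /= einv; ring.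
have [yh /set_mem Kyh hmax] :=
  compact_EVT_max K0 cK (continuous_subspaceT (@continuous_eval _ _ e')).
have e's : del / 2 <= peval e' yh.
  have := hmax (xs, ts); rewrite inE => /(_ Ks); apply: le_trans.
  by rewrite e'E tauE /= divff ?gt_eqF ?subr_gt0// expr1n mulr1 -/del; lra.
have del0 : 0 < del by [].
have [_ [uyh [eyh [/= t0yh yht1]]]] := Kyh.
have eyh0 : 0 < peval e yh.
  by apply: lt_le_trans (e'le _ yht1); lra.
have t0h : t0 < yh.2.
  rewrite lt_neqAle t0yh andbT; apply/eqP => E.
  have : peval e yh <= peval e yB by apply: Bmax; rewrite inE.
  move: Hj e's; rewrite e'E tauE -E ltr_pdivrMr ?divr_gt0//; lra.
have ht1 : yh.2 < t1.
  rewrite lt_neqAle yht1 andbT; apply/eqP => E.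
  move: eyh0; rewrite [yh]surjective_pairing E ltNge.
  by apply/negP/negPn/final; rewrite -E -surjective_pairing.
(* If u(y) > c, a small shift down keeps u >= c and increases e', against maximality at yh. *)
have ule y : t0 <= y.2 <= t1 -> peval e' yh <= peval e' y -> u y <= c.
  case: y => x t tt ey; rewrite leNgt; apply/negP => uc.
  have [s s0 us'] := shift_down cu uc.
  have xt1 : (x + (- s) *: one_vec, t).2 <= t1 by case/andP: tt.
  have K' : K (x + (- s) *: one_vec, t).
    apply: KP => //; apply: le_trans (e'le _ xt1); rewrite e'inv; lra.
  by have := hmax _ (mem_set K'); rewrite e'inv; lra.
have uyhc : u yh = c.
  by apply/le_anti; rewrite uyh andbT; apply: ule => //; rewrite t0yh.
pose e'' := Padd e' (Pcst (- peval e' yh)).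
have : heat q e'' yh <= 0.
  apply: (@level_set_test _ _ _ _ n_gt0 u theta c) => //.
  - by move=> x t s; rewrite pevalD eval_cst e'inv [in RHS]pevalD eval_cst; ring.
  - by apply/andP; split; lra.
  - by rewrite pevalD eval_cst subrr.
  - have c2 : (snd : 'rV[R]_n * R -> R) @ yh --> yh.2 by exact: cvg_snd.
    near=> y; rewrite pevalD eval_cst subr_ge0; apply: ule.
    apply/andP; split; apply: ltW; near: y.
      exact: cvgr_gt c2 _ t0h.
    exact: cvgr_lt c2 _ ht1.
rewrite heatD heatD heatZ.
have hp : heat q (Ppow tau j) yh <= 0.
  by apply: heat_pow_time; [rewrite oppr_le0 invr_ge0 subr_ge0 ltW|exact: tau0].
have {}hp : 0 <= - (del / 2) * heat q (Ppow tau j) yh.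
  by rewrite mulNr oppr_ge0 mulr_ge0_le0// divr_ge0// ltW.
have -> : heat q (Pcst (- peval e' yh)) yh = 0.
  rewrite /heat big1 => [|m _]; rewrite /= !dot0l; ring.
have := strict yh.1 yh.2; rewrite -surjective_pairing t0h ht1.
by move=> /(_ isT uyhc eyh0); lra.
Unshelve. all: by end_near.
Qed.

(** Time t0 is reached by continuity: a violation there, moved up a little so that u > c while still
    e > 0, persists at slightly later times. *)
Lemma barrier_closed (u : 'rV[R]_n * R -> R) theta c e t0 t1 :
  continuous u -> 0 < theta -> theta_incr theta u -> poly_subsolution q u ->
  graphlike e -> 0 <= t0 < t1 -> t1 <= 1 ->
  (forall x, c <= u (x, t1) -> peval e (x, t1) <= 0) ->
  (exists M, forall x t, t0 <= t <= t1 -> c <= u (x, t) ->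
     0 <= peval e (x, t) -> `|x| <= M) ->
  (forall x t, t0 < t < t1 -> u (x, t) = c -> 0 < peval e (x, t) ->
     0 < heat q e (x, t)) ->
  forall x t, t0 <= t <= t1 -> c <= u (x, t) -> peval e (x, t) <= 0.
Proof.
move=> cu th0 uth usub einv /andP[t00 t01] t11 final bnd strict x t /andP[t0t tt1].
have H := barrier cu th0 uth usub einv t00 t11 final bnd strict.
move: t0t; rewrite le_eqVlt => /predU1P[<- uc|t0t uc]; last first.
  by apply: H => //; rewrite t0t.
rewrite leNgt; apply/negP => ex.
pose s := peval e (x, t0) / 2.
have s0 : 0 < s by rewrite divr_gt0.
have u1 : c < u (x + s *: one_vec, t0).
  apply: lt_le_trans (uth _ _ _ (ltW s0)); have := mulr_gt0 th0 s0; lra.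
have e1 : 0 < peval e (x + s *: one_vec, t0).
  by rewrite einv /s; lra.
have [r r0 Hr] := near_box (near_gt cu u1).
have [r' r'0 Hr'] := near_box (near_gt (@continuous_eval _ _ e) e1).
pose h := Num.min (Num.min r r') (t1 - t0).
have h0 : 0 < h by rewrite !lt_min r0 r'0 subr_gt0.
have h1 : h <= t1 - t0 by rewrite ge_min lexx orbT.
have hr : h <= r by rewrite !ge_min lexx.
have hr' : h <= r' by rewrite !ge_min lexx orbT.
have ht : t0 < t0 + h <= t1 by apply/andP; split; lra.
have bx k : h <= k -> box (x + s *: one_vec, t0) k (x + s *: one_vec, t0 + h).
  move=> hk; split; rewrite /= ?subrr ?normr0 ?(le_trans (ltW h0))//.
  by rewrite addrC addKr gtr0_norm.
have := H _ _ ht (ltW (Hr _ (bx _ hr))).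
by rewrite leNgt (Hr' _ (bx _ hr')).
Qed.

End Barrier.

(** * Explicit Euler steps of the heat flow *)

Section Jets.
Context {R : realType} {n : nat}.
Implicit Types (f : 'rV[R]_n -> R) (x h p : 'rV[R]_n) (X : 'M[R]_n).

Definition quad X h := dot (h *m X) h.

(** p and X play the gradient and the Hessian, X through its quadratic form alone. The first bound
    is the sharper one for large h, the third for small h, and all three survive averaging over
    translates. *)
Definition jet (K : R) f := forall x, exists p X, forall h,
  [/\ `|f (x + h) - f x - dot p h| <= K * `|h| ^+ 2,
      `|quad X h| <= K * `|h| ^+ 2 &
      `|f (x + h) - f x - dot p h - quad X h / 2| <= K * `|h| ^+ 3].

(** f(x) is the signed distance along [one_vec] from x to the graph f = 0. *)
Definition profile f := forall x s, f (x + s *: one_vec) = f x - s.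

Lemma quadZ X a h : quad X (a *: h) = a ^+ 2 * quad X h.
Proof. by rewrite /quad -scalemxAl dotZl dotZr mulrA expr2. Qed.

Lemma quadD X h k :
  quad X (h + k) = quad X h + (dot (h *m X) k + dot (k *m X) h) + quad X k.
Proof. by rewrite /quad mulmxDl dotDl !dotDr; ring. Qed.

Lemma quadN X h : quad X (- h) = quad X h.
Proof. by rewrite -scaleN1r quadZ sqrrN expr1n mul1r. Qed.

Lemma quad0 h : quad 0 h = 0.
Proof. by rewrite /quad mulmx0 dot0l. Qed.

Lemma quadE X h : quad X h = \sum_j (\sum_i h 0 i * X i j) * h 0 j.
Proof. by apply: eq_bigr => j _; rewrite mxE. Qed.

Lemma profile_perp f x h : profile f -> f (x + h) = f (x + perp h) - mean h.
Proof. by move=> fP; rewrite {1}(perp_mean h) addrA fP. Qed.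

End Jets.

(** * Taylor polynomials with a quartic penalty *)

Section QuarticBarrier.
Context {R : realType} {n d : nat}.
Variable q : history d -> 'rV[R]_n.
Hypothesis n_gt0 : (0 < n)%N.
Implicit Types (p x h : 'rV[R]_n) (X : 'M[R]_n).

(** The second-order expansion of a profile at x0, in the variable [perp (x - x0)] so as to be
    graphlike, moving with speed sigma; alpha and beta penalise the distance from x0 within the
    hyperplane. *)
Definition Pbarrier x0 (a : R) p X (alpha beta sigma : R) : pexp R n :=
  Padd (Aff (a + mean x0) (- n%:R^-1 *: one_vec) sigma)
  (Padd (Psum (index_enum 'I_n) (fun i => Pscale (p 0 i) (Pperp x0 i)))
  (Padd (Pscale 2^-1 (Psum (index_enum 'I_n) (fun j =>
     Pmul (Psum (index_enum 'I_n) (fun i => Pscale (X i j) (Pperp x0 i)))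
          (Pperp x0 j))))
  (Padd (Pscale (- alpha) (Psq x0)) (Pscale (- beta) (Pmul (Psq x0) (Psq x0)))))).

Lemma peval_barrier x0 a p X alpha beta sigma y
    (k := perp (y.1 - x0)) :
  peval (Pbarrier x0 a p X alpha beta sigma) y =
  a + sigma * y.2 - mean (y.1 - x0) + dot p k + quad X k / 2 -
  alpha * dot k k - beta * dot k k ^+ 2.
Proof.
rewrite /Pbarrier !pevalD !pevalZ pevalM !peval_sq -/k !eval_sum.
rewrite (eq_bigr (fun i => p 0 i * k 0 i)) => [|i _]; last first.
  by rewrite pevalZ peval_perp.
rewrite [\sum_(i <- _) peval (Pmul _ _) y](_ : _ = quad X k); last first.
  rewrite quadE; apply: eq_bigr => j _; rewrite pevalM peval_perp eval_sum.
  by congr (_ * _); apply: eq_bigr => i _; rewrite pevalZ peval_perp mulrC.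
rewrite [peval (Aff _ _ _) _]/= dotZl.
have -> : mean (y.1 - x0) = mean y.1 - mean x0.
  by rewrite /mean dotDl dotNl mulrBl.
rewrite -/(dot p k) /mean [dot one_vec _]dotC; ring.
Qed.

Lemma barrier_graphlike x0 a p X alpha beta sigma :
  graphlike (Pbarrier x0 a p X alpha beta sigma).
Proof.
move=> x t s; rewrite !peval_barrier /= [x + _ - _]addrAC perp_shift//.
by rewrite meanD meanZ mean_one// mulr1; ring.
Qed.

Lemma pd2_quartic e w (y : 'rV[R]_n * R) (c0 c1 c2 c3 c4 : R) :
  (forall s, peval e (y + s *: w) =
     c0 + c1 * s + c2 * s ^+ 2 + c3 * s ^+ 3 + c4 * s ^+ 4) ->
  peval (pd w e) y = c1 /\ peval (pd w (pd w e)) y = 2 * c2.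
Proof.
move=> H.
have [|-> ->] := @pd_line R n y w e
  (c0%:P + c1%:P * 'X + c2%:P * 'X^2 + c3%:P * 'X^3 + c4%:P * 'X^4).
  by move=> s; rewrite H !hornerE.
by rewrite !coefD !coefCM !coefXn !coefX !coefC /= !mulr0 !mulr1 !addr0 !add0r mulr_natl.
Qed.

Lemma heat_barrier x0 a p X alpha beta sigma y (k := perp (y.1 - x0)) :
  heat q (Pbarrier x0 a p X alpha beta sigma) y = sigma + (2 ^+ d.+1)^-1 *
   \sum_m let v := perp (q m) in
     (quad X v - 2 * alpha * dot v v -
      beta * (4 * dot k k * dot v v + 8 * dot k v ^+ 2)).
Proof.
rewrite /heat; congr (_ + _ * _).
  have [|-> _] := @pd2_quartic (Pbarrier x0 a p X alpha beta sigma) dir_t y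
    (peval (Pbarrier x0 a p X alpha beta sigma) y) sigma 0 0 0 => //.
  by move=> s; rewrite !peval_barrier /= scaler0 addr0 /GRing.scale /= mulr1; ring.
apply: eq_bigr => m _; set v := perp (q m).
have [|_ ->] := @pd2_quartic (Pbarrier x0 a p X alpha beta sigma) (q m, 0) y
  (peval (Pbarrier x0 a p X alpha beta sigma) y)
  (- mean (q m) + dot p v + (dot (k *m X) v + dot (v *m X) k) / 2
     - 2 * alpha * dot k v - 4 * beta * dot k k * dot k v)
  (quad X v / 2 - alpha * dot v v - beta * (2 * dot k k * dot v v + 4 * dot k v ^+ 2))
  (- 4 * beta * dot k v * dot v v) (- beta * dot v v ^+ 2).
  move=> s; rewrite pair_shift !peval_barrier /= -/k.
  rewrite [_ + s *: _ - _]addrAC perpD perpZ -/k -/v; clearbody k v.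
  rewrite meanD meanZ quadD quadZ -scalemxAl !dotDl !dotDr !dotZl !dotZr.
  by rewrite [dot v k]dotC; ring.
by rewrite /=; field.
Qed.

End QuarticBarrier.

(** * Motion of super-level sets over Euler steps *)

Section HeatStep.
Context {R : realType} {n d : nat}.
Variable q : history d -> 'rV[R]_n.
Hypothesis n_gt0 : (0 < n)%N.
Hypothesis q_le1 : forall m, `|q m| <= 1.
Implicit Types (p x h : 'rV[R]_n) (X : 'M[R]_n) (f : 'rV[R]_n -> R).
Implicit Types (u : 'rV[R]_n * R -> R) (t : R).

(** An explicit Euler step of length lam^2, backwards in time: to second order it adds to f the mean
    over m of lam^2 / 2 times the second derivative along q(m). *)
Definition Tstep (lam : R) f x : R :=
  (2 ^+ d)^-1 * \sum_m (f (x + lam *: q m) + f (x - lam *: q m)) / 2.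

Definition super_level u (c : R) f E t := forall x, c <= u (x, t) -> f x <= E.

(** Conditions shared by the solution, extended to all times, and by its reflection, so that one set
    of estimates yields both sides. *)
Definition admissible u := [/\ continuous u,
  exists2 theta, 0 < theta & theta_incr theta u,
  exists C, forall x t, u (x, t) <= C * (1 + `|x|) & poly_subsolution q u].

Lemma card_history : #|history d| = (2 ^ d)%N.
Proof. by rewrite card_ffun card_bool card_ord. Qed.

Lemma avg_le (F : history d -> R) a : (forall m, F m <= a) ->
  (2 ^+ d)^-1 * \sum_m F m <= a.
Proof.
move=> H; rewrite mulrC ler_pdivrMr ?exprn_gt0//.
apply: (le_trans (ler_sum _ (fun m _ => H m))).
by rewrite sumr_const card_history -natrX mulr_natr.
Qed.

Lemma avg_ge (F : history d -> R) a : (forall m, a <= F m) ->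
  a <= (2 ^+ d)^-1 * \sum_m F m.
Proof.
move=> H; rewrite mulrC ler_pdivlMr ?exprn_gt0//.
apply: (le_trans _ (ler_sum _ (fun m _ => H m))).
by rewrite sumr_const card_history -natrX mulr_natr.
Qed.

Lemma avg_cst (a : R) : (2 ^+ d)^-1 * \sum_(m : history d) a = a.
Proof. by apply/le_anti; rewrite avg_le ?avg_ge. Qed.

Lemma perp_q m : `|perp (q m)| <= 2.
Proof. by apply: (le_trans (perp_le _ _)) => //; have := q_le1 m; lra. Qed.

Lemma dot_perp_q m : dot (perp (q m)) (perp (q m)) <= 4 * n%:R.
Proof.
apply: (le_trans (ler_norm _)); apply: (le_trans (dot_le_norm _ _)).
rewrite [leRHS]mulrC ler_wpM2l//.
have := perp_q m; have := normr_ge0 (perp (q m)); nra.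
Qed.

(** Where u >= c, monotonicity and linear growth bound -mean by a linear function of |perp|. The
    term -k |perp|^2 then bounds |perp|, and thereby the mean. *)
Lemma coercive u c x0 (A B k : R) : admissible u -> 0 < k -> 0 <= B ->
  exists M, forall x t, c <= u (x, t) ->
    0 <= A - mean (x - x0) + B * `|perp (x - x0)| - k * `|perp (x - x0)| ^+ 2 ->
    `|x| <= M.
Proof.
move=> [_ [th th0 uth] [C uC] _] k0 B0.
pose D0 := (`|C| * (1 + `|x0|) + `|c|) / th.
pose D1 := `|C| / th.
have D00 : 0 <= D0 by rewrite divr_ge0 ?(ltW th0)// addr_ge0// mulr_ge0// addr_ge0.
have D10 : 0 <= D1 by rewrite divr_ge0 ?(ltW th0).
pose Z := (`|A| + D0 + (B + D1)) / k + 1.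
have Z1 : 1 <= Z by rewrite lerDr divr_ge0 ?(ltW k0)// !addr_ge0.
exists (`|x0| + (Z + (`|A| + D0 + (B + D1) * Z))) => x t cu.
set m := mean _; set z := `|perp _| => H.
have z0 : 0 <= z by exact: normr_ge0.
have mlow : - m <= D0 + D1 * z.
  have [m0|m0] := leP 0 m.
    by apply: (@le_trans _ _ 0); rewrite ?oppr_le0// addr_ge0// mulr_ge0.
  have xE : x + (- m) *: one_vec = x0 + perp (x - x0).
    by rewrite /perp -/m scaleNr addrA subrKC.
  have := uth x t (- m); rewrite xE oppr_ge0 => /(_ (ltW m0)) H1.
  have H2 := uC (x0 + perp (x - x0)) t.
  have H3 : C * (1 + `|x0 + perp (x - x0)|) <= `|C| * (1 + (`|x0| + z)).
    apply: (@le_trans _ _ (`|C| * (1 + `|x0 + perp (x - x0)|))).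
      by rewrite ler_wpM2r ?ler_norm ?addr_ge0.
    by rewrite ler_wpM2l// lerD2l ler_normD.
  have : th * (- m) <= `|C| * (1 + (`|x0| + z)) + `|c|.
    have := ler_norm (- c); rewrite normrN; lra.
  rewrite mulrC -ler_pdivlMr// => /le_trans; apply.
  by rewrite /D0 /D1 le_eqVlt; apply/orP; left; apply/eqP; field; rewrite gt_eqF.
have zZ : z <= Z.
  rewrite leNgt; apply/negP => Zz.
  have h1 : k * z ^+ 2 <= `|A| + D0 + (B + D1) * z by have := ler_norm A; lra.
  have kZ : k * Z = `|A| + D0 + (B + D1) + k.
    by rewrite /Z; field; rewrite gt_eqF.
  have h2 : k * Z * z <= k * z ^+ 2.
    by rewrite expr2 mulrA ler_wpM2r// ler_wpM2l ?ltW.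
  have h3 : `|A| + D0 <= (`|A| + D0) * z.
    by rewrite ler_peMr ?addr_ge0//; lra.
  have h4 : 0 < k * z by rewrite mulr_gt0//; lra.
  by move: h2; rewrite kZ; lra.
have mup : m <= `|A| + B * z.
  have := ler_norm A; have := mulr_ge0 (ltW k0) (sqr_ge0 z); lra.
have mabs : `|m| <= `|A| + D0 + (B + D1) * Z.
  have A0 : 0 <= `|A| by [].
  have z1 : B * z <= B * Z by rewrite ler_wpM2l.
  have z2 : D1 * z <= D1 * Z by rewrite ler_wpM2l.
  have z3 : 0 <= D1 * Z by rewrite mulr_ge0//; lra.
  have z4 : 0 <= B * Z by rewrite mulr_ge0//; lra.
  by rewrite ler_norml; apply/andP; split; lra.
rewrite -[x](subrKC x0) [x - x0]perp_mean -/m.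
apply: (le_trans (ler_normD _ _)); rewrite lerD2l.
apply: (le_trans (ler_normD _ _)); rewrite -/z normrZ norm_one_vec// mulr1.
exact: lerD.
Qed.

Lemma jet_at f K x0 : profile f -> jet K f -> exists p X, forall x,
  let k := perp (x - x0) in
  [/\ f x0 - mean (x - x0) + dot p k - K * `|k| ^+ 2 <= f x,
      `|quad X k| <= K * `|k| ^+ 2,
      f x0 - mean (x - x0) + dot p k + quad X k / 2 - K * `|k| ^+ 3 <= f x &
      f x <= f x0 - mean (x - x0) + dot p k + quad X k / 2 + K * `|k| ^+ 3].
Proof.
move=> fP /(_ x0)[p [X J]]; exists p, X => x k.
have [J1 J2 J3] := J k.
have -> : f x = f (x0 + k) - mean (x - x0).
  by rewrite -profile_perp// subrKC.
rewrite !ler_norml in J1 J3; case/andP: J1 => J1 _; case/andP: J3 => J3 J4.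
by split => //; lra.
Qed.

Lemma sqr_dot_perp_q k m : dot k (perp (q m)) ^+ 2 <= 4 * n%:R ^+ 2 * dot k k.
Proof.
rewrite -real_normK ?num_real//.
apply: (@le_trans _ _ ((n%:R * (`|k| * 2)) ^+ 2)).
  rewrite lerXn2r// ?nnegrE ?mulr_ge0//; apply: (le_trans (dot_le_norm _ _)).
  by rewrite ler_wpM2l// ler_wpM2l// perp_q.
have := ler_wpM2l (mulr_ge0 (ler0n R 4) (sqr_ge0 (n%:R : R))) (sqr_norm_le_dot k).
lra.
Qed.

Lemma heat_barrier_ge x0 a p X alpha beta sigma y (k := perp (y.1 - x0)) :
  0 <= alpha -> 0 <= beta ->
  sigma + ((2 ^+ d)^-1 * \sum_m quad X (perp (q m))) / 2
    - 4 * n%:R * alpha - 24 * n%:R ^+ 2 * (beta * dot k k) <=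
  heat q (Pbarrier x0 a p X alpha beta sigma) y.
Proof.
move=> a0 b0; rewrite heat_barrier// -/k.
have -> : (2 ^+ d.+1)^-1 = 2^-1 * (2 ^+ d)^-1 :> R by rewrite exprS invfM.
rewrite sumrB big_split /= sumrN.
pose c := 8 * n%:R * alpha + 48 * n%:R ^+ 2 * (beta * dot k k).
have n1 : 1 <= n%:R :> R by rewrite ler1n.
have k0 := dot_ge0 k.
have H1 := @avg_le (fun m => 2 * alpha * dot (perp (q m)) (perp (q m)))
  (8 * n%:R * alpha).
have H2 := @avg_le (fun m => beta * (4 * dot k k *
  dot (perp (q m)) (perp (q m)) + 8 * dot k (perp (q m)) ^+ 2))
  (48 * n%:R ^+ 2 * (beta * dot k k)).
rewrite !mulrDr !mulrN -!mulrA.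
have {}H1 := H1 _; have {}H2 := H2 _.
suff : (2 ^+ d)^-1 * (\sum_m 2 * alpha * dot (perp (q m)) (perp (q m))) <=
   8 * n%:R * alpha /\ (2 ^+ d)^-1 * (\sum_m beta * (4 * dot k k *
  dot (perp (q m)) (perp (q m)) + 8 * dot k (perp (q m)) ^+ 2)) <=
  48 * n%:R ^+ 2 * (beta * dot k k).
  case; set A := \sum_m quad _ _; set B := \sum_m _; set D := \sum_m _.
  set T := (2 ^+ d)^-1; lra.
split; [apply: H1 => m|apply: H2 => m].
  by have := ler_wpM2l a0 (dot_perp_q m); lra.
have h1 := ler_wpM2l k0 (dot_perp_q m).
have h2 := sqr_dot_perp_q k m.
have h3 : n%:R * dot k k <= n%:R ^+ 2 * dot k k.
  by rewrite ler_wpM2r// expr2 ler_peMr.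
rewrite [leRHS]mulrCA ler_wpM2l//; lra.
Qed.

(** A barrier with X = 0 and alpha = K, which absorbs the remainder of the first-order expansion.
    This penalty lowers the heat operator by at most 4 n K, and the extra 1 in the speed makes the
    inequality strict. *)
Lemma apriori u c f K E t1 : admissible u -> profile f -> 0 < K -> jet K f ->
  t1 <= 1 -> super_level u c f E t1 ->
  forall t, 0 <= t <= t1 ->
    super_level u c f (E + (4 * n%:R * K + 1) * (t1 - t)) t.
Proof.
move=> au fP K0 fJ t11 fin t0 /andP[t00].
rewrite le_eqVlt => /predU1P[->|t01]; first by rewrite subrr mulr0 addr0.
have [cu [theta th0 uth] _ usub] := au.
move=> x0 ux0; set sig := 4 * n%:R * K + 1.
have [p [X J]] := jet_at x0 fP fJ.
pose e := Pbarrier x0 (f x0 - E - sig * t1) p 0 K 0 sig.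
have eE y : peval e y = f x0 - E - mean (y.1 - x0) + dot p (perp (y.1 - x0))
    - K * dot (perp (y.1 - x0)) (perp (y.1 - x0)) - sig * (t1 - y.2).
  by rewrite peval_barrier quad0; ring.
have ele y : peval e y <= f x0 - E - mean (y.1 - x0) + dot p (perp (y.1 - x0))
    - K * `|perp (y.1 - x0)| ^+ 2 - sig * (t1 - y.2).
  by rewrite eE; have := ler_wpM2l (ltW K0) (sqr_norm_le_dot (perp (y.1 - x0))); lra.
have sig0 : 0 <= sig by rewrite addr_ge0// mulr_ge0 ?mulr_ge0// ltW.
have t01' : 0 <= t0 < t1 by rewrite t00.
have : peval e (x0, t0) <= 0.
  apply: (barrier_closed n_gt0 cu th0 uth usub _ t01' t11) (ux0).
  - exact: barrier_graphlike.
  - move=> x /fin fx; apply: (le_trans (ele _)).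
    by have [H _ _ _] := J x; rewrite /= subrr mulr0; lra.
  - have [M HM] := coercive c x0 (f x0 - E) au K0
      (mulr_ge0 (ler0n R n) (normr_ge0 p)).
    exists M => x t /andP[_ tt1] uc /le_trans/(_ (ele _)) ex.
    apply: HM uc _; apply: (le_trans ex) => /=.
    have := ler_norm (dot p (perp (x - x0))); have := dot_le_norm p (perp (x - x0)).
    have : 0 <= sig * (t1 - t) by rewrite mulr_ge0// subr_ge0.
    lra.
  - move=> x t _ _ _; apply: lt_le_trans (heat_barrier_ge _ _ _ _ _ _ _ _) => //;
      last exact: ltW.
    rewrite big1 => [|m _]; last exact: quad0.
    by rewrite /sig; lra.
  - by rewrite lexx ltW.
rewrite eE /= subrr perp0 dot0r dot0r /mean dot0l mul0r; lra.
Qed.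

(** The quartic penalty is harmless only near x0. The a priori bound localises: within a time lam^2,
    a point with u = c and e > 0 is so close to x0, in the hyperplane, that the quartic contribution
    to the heat operator is below eta / 8. *)
Lemma refined (K eta : R) : 0 < K -> 0 < eta -> exists2 lam0, 0 < lam0 &
  forall lam, 0 < lam <= lam0 -> forall u c f E t1, admissible u ->
  profile f -> jet K f -> lam ^+ 2 <= t1 <= 1 -> super_level u c f E t1 ->
  super_level u c (Tstep lam f) (E + eta * lam ^+ 2) (t1 - lam ^+ 2).
Proof.
move=> K0 eta0.
have n0 : 0 < n%:R :> R by rewrite ltr0n.
(* By K z^3 <= (K r z^2 + (K / r) z^4) / 2, the choices alpha = K r and b = K / r absorb the cubic
   remainder, with half of the penalty to spare; r is such that 4 n alpha = eta / 8. *)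
pose r := eta / (32 * n%:R * K).
have r0 : 0 < r by rewrite divr_gt0// mulr_gt0// mulr_gt0.
pose b := K / r; have b0 : 0 < b by rewrite divr_gt0.
(* C bounds the difference between the speed in [apriori] and that of the barrier; A * lam^2 will
   bound the square of the quartic contribution 24 n^2 b S. *)
pose C := 4 * n%:R * K + 1 + 2 * K + eta.
have C0 : 0 < C by rewrite !addr_gt0// ?mulr_gt0// mulr_gt0.
pose A := (24 * n%:R ^+ 2) ^+ 2 * (2 * b * C).
have A0 : 0 < A.
  have n20 : 0 < 24 * n%:R ^+ 2 :> R by rewrite mulr_gt0 ?exprn_gt0.
  by apply: mulr_gt0; [exact: (exprn_gt0 _ n20)|do 2 apply: mulr_gt0 => //].
exists (Num.min (eta / (16 * K)) (eta / (8 * (1 + A)))).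
  by rewrite lt_min !divr_gt0// mulr_gt0// addr_gt0.
move=> lam /andP[lam_gt0]; rewrite le_min => /andP[lam1 lam2].
move=> u c f E t1 au fP fJ /andP[t1l t11] fin x0 ux0.
have lamK : 8 * K * lam <= eta / 2.
  by move: lam1; rewrite ler_pdivlMr ?mulr_gt0//; lra.
have lamA : A * lam ^+ 2 <= (eta / 8) ^+ 2.
  have h : (1 + A) * lam <= eta / 8.
    by move: lam2; rewrite ler_pdivlMr ?mulr_gt0 ?addr_gt0//; lra.
  apply: (@le_trans _ _ (((1 + A) * lam) ^+ 2)); last first.
    have h0 : 0 <= (1 + A) * lam by rewrite mulr_ge0 ?addr_ge0// ltW.
    by rewrite lerXn2r// nnegrE (le_trans h0).
  rewrite exprMn ler_wpM2r ?sqr_ge0//.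
  by have := sqr_ge0 A; rewrite !expr2; lra.
have [cu [theta th0 uth] _ usub] := au.
have [p [X J]] := jet_at x0 fP fJ.
pose Q := (2 ^+ d)^-1 * \sum_m quad X (perp (q m)).
have quad_q m : `|quad X (perp (q m))| <= 4 * K.
  have [_ + _ _] := J (x0 + q m).
  rewrite addrAC subrr add0r => /le_trans; apply.
  rewrite mulrC ler_wpM2r ?(ltW K0)//.
  have := perp_q m; have := normr_ge0 (perp (q m)); rewrite expr2; nra.
have QK : Q <= 4 * K.
  by apply: avg_le => m; have := quad_q m; rewrite ler_norml => /andP[].
pose sig := eta / 2 - Q / 2.
pose alpha := K * r.
have alpha0 : 0 <= alpha by rewrite mulr_ge0 // ltW.
pose e := Pbarrier x0 (f x0 - E - sig * t1) p X alpha b sig.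
have cube (k : 'rV[R]_n) : K * `|k| ^+ 3 <= (alpha * dot k k + b * dot k k ^+ 2) / 2.
  have z0 : 0 <= b * (`|k| * (`|k| - r)) ^+ 2 by rewrite mulr_ge0 ?sqr_ge0 ?ltW.
  have S1 := ler_wpM2l alpha0 (sqr_norm_le_dot k).
  have S2 : b * (`|k| ^+ 2) ^+ 2 <= b * dot k k ^+ 2.
    by rewrite ler_wpM2l ?(ltW b0)// lerXn2r ?nnegrE ?sqr_ge0 ?dot_ge0 ?sqr_norm_le_dot.
  have br : K = b * r by rewrite divfK ?gt_eqF.
  rewrite /alpha in S1 *; rewrite br in S1 *; lra.
have ele y : peval e y <= f y.1 - E - sig * (t1 - y.2) -
    (alpha * dot (perp (y.1 - x0)) (perp (y.1 - x0)) +
     b * dot (perp (y.1 - x0)) (perp (y.1 - x0)) ^+ 2) / 2.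
  rewrite peval_barrier; have [_ _ H _] := J y.1.
  have := cube (perp (y.1 - x0)); lra.
have posS (k : 'rV[R]_n) : 0 <= alpha * dot k k + b * dot k k ^+ 2.
  by rewrite addr_ge0// mulr_ge0// ?dot_ge0 ?sqr_ge0// ltW.
have l20 : 0 < lam ^+ 2 by rewrite exprn_gt0.
have t01' : 0 <= t1 - lam ^+ 2 < t1 by apply/andP; split; lra.
have : peval e (x0, t1 - lam ^+ 2) <= 0.
  apply: (barrier_closed n_gt0 cu th0 uth usub _ t01' t11) (ux0).
  - exact: barrier_graphlike.
  - move=> x /fin fx; apply: (le_trans (ele _)).
    by have := posS (perp (x - x0)); rewrite /= subrr mulr0; lra.
  - have [M HM] := coercive c x0 (`|f x0 - E| + `|sig| + (1 + K / 2) ^+ 2 / (4 * b)) au ltr01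
      (mulr_ge0 (ler0n R n) (normr_ge0 p)).
    exists M => x t /andP[t1t tt1] uc ex.
    apply: HM uc _; apply: (le_trans ex); rewrite peval_barrier /=.
    set k := perp _; have [_ + _ _] := J x; rewrite -/k => qk.
    have {}qk : quad X k <= K * `|k| ^+ 2 by apply: le_trans qk; exact: ler_norm.
    have pk : dot p k <= n%:R * (`|p| * `|k|).
      by apply: le_trans (dot_le_norm _ _); exact: ler_norm.
    have S0 := mulr_ge0 alpha0 (dot_ge0 k).
    have S2 : b * (`|k| ^+ 2) ^+ 2 <= b * dot k k ^+ 2.
      by rewrite ler_wpM2l ?(ltW b0)// lerXn2r ?nnegrE ?sqr_ge0 ?dot_ge0 ?sqr_norm_le_dot.
    (* Completing the square: up to a constant the quartic penalty beats (1 + K / 2) |k|^2, which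
       absorbs the quadratic form and leaves the -|k|^2 that [coercive] requires. *)
    have W : 0 <= (1 + K / 2) ^+ 2 / (4 * b) + b * (`|k| ^+ 2) ^+ 2 - (1 + K / 2) * `|k| ^+ 2.
      rewrite [leRHS](_ : _ = b * (`|k| ^+ 2 - (1 + K / 2) / (2 * b)) ^+ 2).
        by rewrite mulr_ge0 ?sqr_ge0 ?ltW.
      by field; rewrite gt_eqF.
    have sg : - (sig * (t1 - t)) <= `|sig|.
      apply: (le_trans (ler_norm _)); rewrite normrN normrM ler_piMr//.
      by rewrite ger0_norm ?subr_ge0//; lra.
    have := ler_norm (f x0 - E); lra.
  - move=> x t /andP[tt0 tt1] uxt ext.
    apply: lt_le_trans (heat_barrier_ge _ _ _ _ _ _ alpha0 (ltW b0)).
    rewrite -/Q /=; set S := dot _ _.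
    have fx : f x <= E + (4 * n%:R * K + 1) * (t1 - t).
      apply: (apriori au fP K0 fJ t11 fin); last by rewrite uxt.
      by apply/andP; split; lra.
    (* Positivity of e bounds half of the penalty by f(x) - E - sig (t1 - t), and [apriori] bounds
       f(x) - E. *)
    have bS : b * S ^+ 2 <= 2 * C * lam ^+ 2.
      have := lt_le_trans ext (ele (x, t)); rewrite /= -/S => ex.
      have Sa : 0 <= alpha * S by rewrite mulr_ge0 ?dot_ge0.
      have : (4 * n%:R * K + 1 - sig) * (t1 - t) <= C * lam ^+ 2.
        apply: (@le_trans _ _ (C * (t1 - t))).
          by rewrite ler_wpM2r ?subr_ge0 ?(ltW tt1)// /C /sig; lra.
        by rewrite ler_wpM2l ?(ltW C0)//; lra.
      lra.
    have W : 24 * n%:R ^+ 2 * (b * S) <= eta / 8.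
      have n20 : 0 <= 24 * n%:R ^+ 2 :> R by rewrite mulr_ge0 ?sqr_ge0.
      have W0 := mulr_ge0 n20 (mulr_ge0 (ltW b0) (dot_ge0 (perp (x - x0)))).
      have e80 : 0 <= eta / 8 by rewrite divr_ge0 ?(ltW eta0).
      rewrite -(@ler_pXn2r _ 2)//.
      apply: le_trans lamA; rewrite /A.
      have := ler_wpM2l (sqr_ge0 (24 * n%:R ^+ 2)) (ler_wpM2l (ltW b0) bS); lra.
    have : 4 * n%:R * alpha = eta / 8.
      by rewrite /alpha /r; field; rewrite !gt_eqF.
    rewrite /sig; lra.
  - by apply/andP; split; lra.
rewrite peval_barrier /= subrr perp0 dot0r dot0r /mean dot0l mul0r => e0.
(* In the expansions of f at x0 + lam q(m) and x0 - lam q(m) the linear terms cancel; each cubic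
   remainder is at most K (2 lam)^3. *)
have : Tstep lam f x0 <= f x0 + lam ^+ 2 * (Q / 2) + 8 * K * lam ^+ 3.
  have -> : lam ^+ 2 * (Q / 2) = (2 ^+ d)^-1 *
      \sum_m lam ^+ 2 * quad X (perp (q m)) / 2.
    by rewrite -mulr_suml -mulr_sumr /Q; ring.
  rewrite -addrA addrC -lerBlDr -[X in _ - X](avg_cst (f x0)) /Tstep -mulrBr -sumrB.
  rewrite -lerBlDl -mulrBr -sumrB; apply: avg_le => m.
  have [_ _ _ H1] := J (x0 + lam *: q m).
  have [_ _ _ H2] := J (x0 - lam *: q m).
  rewrite [x0 + _ - x0]addrAC subrr add0r perpZ dotZr quadZ meanZ normrZ gtr0_norm// in H1.
  rewrite [x0 - _ - x0]addrAC subrr add0r -scaleNr perpZ dotZr quadZ meanZ normrZ sqrrN in H2.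
  rewrite scaleNr normrN gtr0_norm// in H2.
  have pq : (lam * `|perp (q m)|) ^+ 3 <= 8 * lam ^+ 3.
    rewrite exprMn mulrC ler_wpM2r ?exprn_ge0 ?(ltW lam_gt0)//.
    rewrite (_ : 8 = 2 ^+ 3 :> R); last by rewrite -natrX.
    by rewrite lerXn2r ?nnegrE// perp_q.
  have := ler_wpM2l (ltW K0) pq; lra.
rewrite /quad mul0mx dot0l in e0.
have : 8 * K * lam ^+ 3 <= eta / 2 * lam ^+ 2.
  by rewrite exprS mulrA ler_wpM2r// ltW.
rewrite /sig in e0; lra.
Qed.

Lemma avg_norm_le (F : history d -> R) a : (forall m, `|F m| <= a) ->
  `|(2 ^+ d)^-1 * \sum_m F m| <= a.
Proof.
move=> H; rewrite ler_norml avg_le ?avg_ge// => m.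
  by have := H m; rewrite ler_norml => /andP[].
by have := H m; rewrite ler_norml => /andP[].
Qed.

Lemma Tstep_profile lam f : profile f -> profile (Tstep lam f).
Proof.
move=> fP x s; rewrite /Tstep -[s in RHS]avg_cst -mulrBr -sumrB.
congr (_ * _); apply: eq_bigr => m _.
by rewrite addrAC fP [x + _ - _]addrAC fP; field.
Qed.

Lemma jet_Tstep lam K f : jet K f -> jet K (Tstep lam f).
Proof.
move=> fJ x.
have H y : {pX : 'rV[R]_n * 'M[R]_n | forall h,
  [/\ `|f (y + h) - f y - dot pX.1 h| <= K * `|h| ^+ 2,
      `|quad pX.2 h| <= K * `|h| ^+ 2 &
      `|f (y + h) - f y - dot pX.1 h - quad pX.2 h / 2| <= K * `|h| ^+ 3]}.
  by apply: cid; have [p [X J]] := fJ y; exists (p, X).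
pose a m := x + lam *: q m; pose b m := x - lam *: q m.
pose P y := (sval (H y)).1; pose X y := (sval (H y)).2.
have J y h := svalP (H y) h.
exists ((2 ^+ d)^-1 *: \sum_m 2^-1 *: (P (a m) + P (b m))).
exists ((2 ^+ d)^-1 *: \sum_m 2^-1 *: (X (a m) + X (b m))) => h.
have PE : dot ((2 ^+ d)^-1 *: \sum_m 2^-1 *: (P (a m) + P (b m))) h =
    (2 ^+ d)^-1 * \sum_m (dot (P (a m)) h + dot (P (b m)) h) / 2.
  rewrite dotZl; congr (_ * _).
  elim/big_rec2: _ => [|m y1 y2 _ E]; first exact: dot0l.
  by rewrite dotDl E dotZl dotDl mulrC.
have XE : quad ((2 ^+ d)^-1 *: \sum_m 2^-1 *: (X (a m) + X (b m))) h =
    (2 ^+ d)^-1 * \sum_m (quad (X (a m)) h + quad (X (b m)) h) / 2.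
  rewrite /quad -scalemxAr dotZl; congr (_ * _).
  elim/big_rec2: _ => [|m y1 y2 _ E]; first by rewrite mulmx0 dot0l.
  by rewrite mulmxDr dotDl E -scalemxAr mulmxDr dotZl dotDl mulrC.
have TE : Tstep lam f (x + h) =
    (2 ^+ d)^-1 * \sum_m (f (a m + h) + f (b m + h)) / 2.
  by congr (_ * _); apply: eq_bigr => m _; rewrite ![x + h + _]addrAC.
have half (z1 z2 c : R) : `|z1| <= c -> `|z2| <= c -> `|(z1 + z2) / 2| <= c.
  by rewrite !ler_norml => /andP[? ?] /andP[? ?]; apply/andP; split; lra.
split.
- rewrite TE PE -!mulrBr -!sumrB; apply: avg_norm_le => m.
  have [Ja _ _] := J (a m) h; have [Jb _ _] := J (b m) h.
  by rewrite [X in `|X|](_ : _ = (f (a m + h) - f (a m) - dot (P (a m)) h +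
    (f (b m + h) - f (b m) - dot (P (b m)) h)) / 2); [exact: half|field].
- rewrite XE; apply: avg_norm_le => m.
  have [_ Ja _] := J (a m) h; have [_ Jb _] := J (b m) h.
  exact: half.
- rewrite TE PE XE -mulrA mulr_suml -!mulrBr -!sumrB; apply: avg_norm_le => m.
  have [_ _ Ja] := J (a m) h; have [_ _ Jb] := J (b m) h.
  by rewrite [X in `|X|](_ : _ = (f (a m + h) - f (a m) - dot (P (a m)) h -
      quad (X (a m)) h / 2 + (f (b m + h) - f (b m) - dot (P (b m)) h -
      quad (X (b m)) h / 2)) / 2); [exact: half|field].
Qed.

(* Explicit Euler steps in time are controlled by the barriers, with a total error
   that is small uniformly in the initial profile and in the level. *)
Lemma heat_flow_bound (K eta : R) : 0 < K -> 0 < eta -> exists2 lam0, 0 < lam0 &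
  forall lam, 0 < lam <= lam0 -> forall u c f E, admissible u ->
  profile f -> jet K f -> super_level u c f E 1 ->
  forall k t, k%:R * lam ^+ 2 <= 1 ->
    0 <= t -> 1 - k.+1%:R * lam ^+ 2 <= t <= 1 - k%:R * lam ^+ 2 ->
    super_level u c (iter k (Tstep lam) f) (E + eta) t.
Proof.
move=> K0 eta0; have e2 : 0 < eta / 2 by rewrite divr_gt0.
have [l0 l00 Hl0] := refined K0 e2.
have s0 : 0 < 4 * n%:R * K + 1 :> R.
  by rewrite ltr_wpDl// mulr_ge0 ?mulr_ge0// ltW.
exists (Num.min l0 (Num.min 1 (eta / (2 * (4 * n%:R * K + 1))))).
  by rewrite !lt_min l00 ltr01 divr_gt0// mulr_gt0.
move=> lam /andP[lam_gt0]; rewrite !le_min => /and3P[l1 l2 l3].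
move=> u c f E au fP fJ fin k t kl t0 /andP[t1 t2].
have l20 : 0 < lam ^+ 2 by rewrite exprn_gt0.
have G j : profile (iter j (Tstep lam) f) /\ jet K (iter j (Tstep lam) f).
  by elim: j => [//|j [P J]]; split; [exact: Tstep_profile|exact: jet_Tstep].
have D j : j%:R * lam ^+ 2 <= 1 ->
    super_level u c (iter j (Tstep lam) f) (E + eta / 2 * (j%:R * lam ^+ 2))
      (1 - j%:R * lam ^+ 2).
  elim: j => [|j IH]; first by rewrite !mul0r mulr0 addr0 subr0.
  rewrite -natr1 mulrDl mul1r => jl.
  have [P J] := G j.
  have := Hl0 lam _ u c (iter j (Tstep lam) f) _ (1 - j%:R * lam ^+ 2) au P J _ (IH _).
  rewrite lam_gt0 l1 iterS => /(_ isT) H.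
  have -> : E + eta / 2 * (j%:R * lam ^+ 2 + lam ^+ 2) =
    E + eta / 2 * (j%:R * lam ^+ 2) + eta / 2 * lam ^+ 2 by ring.
  have -> : 1 - (j%:R * lam ^+ 2 + lam ^+ 2) = 1 - j%:R * lam ^+ 2 - lam ^+ 2.
    by ring.
  apply: H; last lra.
  have : 0 <= j%:R * lam ^+ 2 by rewrite mulr_ge0// ltW.
  by move=> ?; apply/andP; split; lra.
have [P J] := G k.
have t11 : 1 - k%:R * lam ^+ 2 <= 1 by rewrite gerBl mulr_ge0// ltW.
move=> x ux.
(* What remains is a fraction of one time step, for which the a priori bound suffices. *)
have := @apriori _ _ _ _ _ _ au P K0 J t11 (D _ kl) t _ x ux.
rewrite t0 t2 => /(_ isT)/le_trans; apply.
move: t1; rewrite -natr1 mulrDl mul1r => t1.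
have h1 : eta / 2 * (k%:R * lam ^+ 2) <= eta / 2 by rewrite ler_piMr// ltW.
have h2 : (4 * n%:R * K + 1) * (1 - k%:R * lam ^+ 2 - t) <= eta / 2.
  apply: (@le_trans _ _ ((4 * n%:R * K + 1) * lam)).
    rewrite ler_wpM2l ?(ltW s0)//.
    have : lam ^+ 2 <= lam by rewrite expr2 ler_piMr// ltW.
    lra.
  by move: l3; rewrite ler_pdivlMr ?mulr_gt0//; lra.
lra.
Qed.

End HeatStep.

(** * Mollification of Lipschitz profiles *)

Lemma lipschitz_continuous (R : realType) (V : normedModType R) (f : V -> R) L :
  (forall x y, `|f x - f y| <= L * `|x - y|) -> continuous f.
Proof.
move=> lip x; apply/cvgrPdist_le => e e0.
have L0 : 0 < `|L| + 1 by rewrite ltr_wpDl.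
near=> y; apply: (le_trans (lip _ _)).
apply: (@le_trans _ _ ((`|L| + 1) * `|x - y|)).
  by rewrite ler_wpM2r//; have := ler_norm L; lra.
rewrite mulrC -ler_pdivlMr//; near: y.
by apply: cvgr_dist_le; [exact: cvg_id|exact: divr_gt0].
Unshelve. all: by end_near.
Qed.

(** * Calculus in one variable *)

Section OneVariable.
Context {R : realType}.
Implicit Types (g dg phi psi : R -> R) (C s : R).

Lemma mvt_bound g dg C s :
  (forall z : R, `|z| <= `|s| -> is_derive z 1 g (dg z)) ->
  (forall z, `|z| <= `|s| -> `|dg z| <= C) -> `|g s - g 0| <= C * `|s|.
Proof.
move=> gD dgC.
have cg a b : (forall z, a <= z <= b -> `|z| <= `|s|) -> {within `[a, b], continuous g}.
  move=> H; apply: continuous_in_subspaceT => z.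
  rewrite inE /= in_itv /= => zab; have [dz _] := gD _ (H _ zab).
  exact/differentiable_continuous/derivable1_diffP.
have [s0|s0] := leP 0 s.
  have H z : 0 <= z <= s -> `|z| <= `|s|.
    by move=> /andP[z0 zs]; rewrite !ger0_norm.
  have D z : z \in `]0, s[%R -> is_derive z 1 g (dg z).
    by rewrite in_itv /= => /andP[/ltW z0 /ltW zs]; apply: gD; rewrite H ?z0.
  have [z] := MVT_segment s0 D (cg 0 s H); rewrite in_itv /= => /H zs ->.
  by rewrite subr0 normrM ler_wpM2r// dgC.
have H z : s <= z <= 0 -> `|z| <= `|s|.
  by move=> /andP[sz z0]; rewrite !ler0_norm ?lerN2// ltW.
have D z : z \in `]s, 0[%R -> is_derive z 1 g (dg z).
  by rewrite in_itv /= => /andP[/ltW z0 /ltW zs]; apply: gD; rewrite H ?z0.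
have [z] := MVT_segment (ltW s0) D (cg s 0 H); rewrite in_itv /= => /H zs E.
by rewrite distrC E sub0r normrM normrN ler_wpM2r// dgC.
Qed.

Lemma is_derive_quadratic g z a L : (forall s : R, `|g (z + s) - g z - s * a| <= L * s ^+ 2) ->
  is_derive z 1 g a.
Proof.
move=> H.
have lim : h^-1 *: ((g \o shift z) (h *: 1) - g z) @[h --> 0^'] --> a.
  apply/cvgrPdist_le => e e0.
  have L0 : 0 < `|L| + 1 by rewrite ltr_wpDl.
  near=> h.
  have h0 : h != 0 by near: h; exact: nbhs_dnbhs_neq.
  rewrite /= /GRing.scale /= mulr1 [h + z]addrC.
  rewrite -(ler_pM2l (x := `|h|)) ?normr_gt0// -normrM mulrBr mulVKf//.
  rewrite distrC; apply: (le_trans (H h)).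
  rewrite -real_normK ?num_real// expr2 mulrCA ler_wpM2l//.
  apply: (@le_trans _ _ ((`|L| + 1) * `|h|)).
    by rewrite ler_wpM2r//; have := ler_norm L; lra.
  rewrite mulrC -ler_pdivlMr//.
  near: h; apply: dnbhs0_le; exact: divr_gt0.
apply: DeriveDef; first by apply/cvg_ex; exists a.
exact: cvg_lim lim.
Unshelve. all: by end_near.
Qed.

Definition average phi : R := \int[lebesgue_measure]_(s in `[0, 1]) phi s.

Lemma primitive_exists phi (B : R) : continuous phi -> 0 < B ->
  exists g, forall s : R, - B < s < B -> is_derive s 1 g (phi s).
Proof.
move=> cphi B0.
exists (fun x => \int[lebesgue_measure]_(t in `[- B, x]) phi t) => s /andP[Bs sB].
have H : lebesgue_measure.-integrable `[- B, B] (EFin \o phi).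
  apply: continuous_compact_integrable; first exact: segment_compact.
  exact: continuous_subspaceT.
have [] := continuous_FTC1_closed sB H Bs (cphi s).
by rewrite derive1E => H1 H2; apply: DeriveDef.
Qed.

Lemma average_primitive phi g : continuous phi ->
  (forall s : R, 0 <= s <= 1 -> is_derive s 1 g (phi s)) -> average phi = g 1 - g 0.
Proof.
move=> cphi H.
have cg s : 0 <= s <= 1 -> {for s, continuous g}.
  by move=> /H[ds _]; apply/differentiable_continuous/derivable1_diffP.
rewrite /average /Rintegral (@continuous_FTC2 _ _ g)//.
- exact: continuous_subspaceT.
- split.
  + by move=> s; rewrite in_itv /= => /andP[s0 s1]; have [] : is_derive s 1 g (phi s)
      by apply: H; rewrite !ltW.
  + by apply: cvg_at_right_filter; apply: cg; rewrite lexx ler01.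
  + by apply: cvg_at_left_filter; apply: cg; rewrite lexx ler01.
- move=> s; rewrite in_itv /= => /andP[s0 s1]; rewrite derive1E.
  by have [] : is_derive s 1 g (phi s) by apply: H; rewrite !ltW.
Qed.

Lemma primitive01 phi : continuous phi ->
  exists2 g, (forall s : R, 0 <= s <= 1 -> is_derive s 1 g (phi s)) &
    average phi = g 1 - g 0.
Proof.
move=> cphi; have [g Hg] := primitive_exists cphi (ltr0n R 2).
have H (s : R) : 0 <= s <= 1 -> is_derive s 1 g (phi s).
  by move=> /andP[s0 s1]; apply: Hg; apply/andP; split; lra.
by exists g => //; exact: average_primitive.
Qed.

Lemma averageD phi psi a : continuous phi -> continuous psi ->
  average (fun s => phi s + a * psi s) = average phi + a * average psi.
Proof.
move=> c1 c2; have [g1 H1 ->] := primitive01 c1; have [g2 H2 ->] := primitive01 c2.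
transitivity ((fun s => g1 s + a * g2 s) 1 - (fun s => g1 s + a * g2 s) 0); last ring.
apply: (@average_primitive _ (fun s => g1 s + a * g2 s)).
  by move=> s; apply: cvgD; [exact: c1|apply: cvgM; [exact: cvg_cst|exact: c2]].
move=> s s01; have h1 := H1 _ s01; have h2 := H2 _ s01.
exact: (is_deriveD h1 (is_deriveZ a h2)).
Qed.

Lemma average_le phi C : continuous phi -> (forall s, 0 <= s <= 1 -> phi s <= C) ->
  average phi <= C.
Proof.
move=> cphi phiC; have [g Hg ->] := primitive01 cphi.
have D s : s \in `]0, 1[%R -> is_derive s 1 g (phi s).
  by rewrite in_itv /= => /andP[s0 s1]; apply: Hg; rewrite !ltW.
have cg : {within `[0, 1], continuous g}.
  apply: continuous_in_subspaceT => s; rewrite inE /= in_itv /= => /Hg[ds _].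
  exact/differentiable_continuous/derivable1_diffP.
have [s] := MVT_segment ler01 D cg; rewrite in_itv /= => s01 ->.
by rewrite subr0 mulr1 phiC.
Qed.

Lemma average_cst a : average (fun=> a) = a.
Proof.
transitivity ((fun s => a * s) 1 - (fun s => a * s) 0); last by rewrite /=; ring.
apply: (@average_primitive _ (fun s => a * s)); first exact: cst_continuous.
move=> s _; have := is_deriveZ a (is_derive_id s (1 : R)).
by rewrite /GRing.scale /= mulr1.
Qed.

Lemma average_norm_le phi C : continuous phi ->
  (forall s, 0 <= s <= 1 -> `|phi s| <= C) -> `|average phi| <= C.
Proof.
move=> cphi phiC; rewrite ler_norml; apply/andP; split; last first.
  by apply: average_le => // s /phiC; rewrite ler_norml => /andP[].
rewrite lerNl.
have -> : - average phi = average (fun s => 0 + (-1) * phi s).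
  rewrite averageD//; last exact: cst_continuous.
  have -> : average (fun=> 0) = 0 by exact: average_cst.
  by rewrite add0r mulN1r.
apply: average_le => [s|s /phiC].
  apply: cvgD; first exact: cvg_cst.
  by apply: cvgM; [exact: cvg_cst|exact: cphi].
by rewrite ler_norml => /andP[]; lra.
Qed.

(** The average of the shifted function has derivative phi (s + 1) - phi s in s, which differs from
    its value at s = 0 by at most 2 L |s|; the mean value bound supplies the other factor |s|. *)
Lemma average_shift phi L s : (forall x y, `|phi x - phi y| <= L * `|x - y|) ->
  `|average (fun z => phi (z + s)) - average phi - s * (phi 1 - phi 0)|
    <= 2 * L * s ^+ 2.
Proof.
move=> lip.
have cphi : continuous phi by exact: lipschitz_continuous lip.
have B0 : 0 < `|s| + 2 by rewrite ltr_wpDl.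
have [g Hg] := primitive_exists cphi B0.
have Hg' (z : R) : `|z| <= `|s| + 1 -> is_derive z 1 g (phi z).
  by rewrite ler_norml => /andP[z1 z2]; apply: Hg; apply/andP; split; lra.
have shiftD (a z : R) : `|a| + `|z| <= `|s| + 1 ->
    is_derive z 1 (fun y => g (y + a)) (phi (z + a)).
  move=> az; have [d1 d2] : is_derive (z + a) 1 g (phi (z + a)).
    by apply: Hg'; apply: le_trans az; rewrite addrC ler_normD.
  have E : (fun h : R => h^-1 *: (((fun y => g (y + a)) \o shift z) (h *: 1) - g (z + a))) =
      (fun h => h^-1 *: ((g \o shift (z + a)) (h *: 1) - g (z + a))).
    by apply/funext => h /=; rewrite addrA.
  by apply: DeriveDef; rewrite /derivable /derive E.
have cshift : continuous (fun z => phi (z + s)).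
  apply: (lipschitz_continuous (L := L)) => x y.
  by rewrite (_ : x - y = x + s - (y + s)) ?lip//; ring.
have -> : average phi = g 1 - g 0.
  apply: average_primitive => // z /andP[z0 z1]; apply: Hg'; rewrite ger0_norm//.
  by have := normr_ge0 s; lra.
have -> : average (fun z => phi (z + s)) = g (1 + s) - g (0 + s).
  apply: (@average_primitive _ (fun z => g (z + s))) => // z /andP[z0 z1].
  by apply: shiftD; rewrite lerD2l ger0_norm.
pose G z := g (z + 1) - g (z + 0) - z * (phi 1 - phi 0).
have -> : g (1 + s) - g (0 + s) - (g 1 - g 0) - s * (phi 1 - phi 0) = G s - G 0.
  by rewrite /G !add0r !addr0 [1 + s]addrC; ring.
rewrite -real_normK ?num_real// expr2 mulrA.
apply: (@mvt_bound G (fun z => phi (z + 1) - phi (z + 0) - (phi 1 - phi 0))) => z zs.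
- have h1 := @shiftD 1 z; rewrite normr1 addrC lerD2r in h1.
  have h0 := @shiftD 0 z; rewrite normr0 add0r in h0.
  have {}h0 : is_derive z 1 (fun y => g (y + 0)) (phi (z + 0)).
    by apply: h0; lra.
  have := is_deriveB (is_deriveB (h1 zs) h0)
    (is_deriveZ (phi 1 - phi 0) (is_derive_id z (1 : R))).
  rewrite /GRing.scale /= mulr1.
  rewrite (_ : _ - _ = G) //.
  by apply/funext => y; rewrite /G [in RHS]mulrC.
- apply: (@le_trans _ _ (2 * (L * `|z|))).
    have := lip (z + 1) 1; have := lip (z + 0) 0.
    rewrite addr0 subr0 addrK => h1 h2.
    rewrite (_ : _ - _ = (phi (z + 1) - phi 1) - (phi z - phi 0)); last ring.
    by apply: (le_trans (ler_normB _ _)); lra.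
  have := lip 1 0; rewrite subr0 normr1 mulr1 => L0.
  by rewrite -mulrA ler_wpM2l// ler_wpM2l// (le_trans _ L0).
Qed.

End OneVariable.

(** * Averaging along coordinate segments *)

Section Mollification.
Context {R : realType} {n : nat}.
Implicit Types (f g p : 'rV[R]_n -> R) (x y h : 'rV[R]_n) (L eps s : R).

Definition lip L f := forall x y, `|f x - f y| <= L * `|x - y|.

(** One-dimensional averages, iterated over the coordinates, take the place of a convolution in n
    variables. *)
Definition mollify1 eps (i : 'I_n) f x : R :=
  average (fun s => f (x + (eps * s) *: evec i)).

(* [reg k L f]: f is of class C^k with all derivatives of order at most k
   Lipschitz continuous with constant L. *)
Fixpoint reg (k : nat) L f : Prop := lip L f /\
  if k is k'.+1 then forall i, exists2 p, reg k' L p &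
    forall x s, `|f (x + s *: evec i) - f x - s * p x| <= L * s ^+ 2
  else True.

Lemma reg_lip k L f : reg k L f -> lip L f.
Proof. by case: k => [|k] []. Qed.

Lemma norm_evec i : `|evec i : 'rV[R]_n| = 1.
Proof.
apply/le_anti/andP; split.
  apply: norm_le_coord => // j; rewrite mxE eqxx /=.
  by case: (j == i); rewrite ?normr1 ?normr0.
by have := coord_le_norm (evec i : 'rV[R]_n) i; rewrite mxE !eqxx normr1.
Qed.

Lemma lip_ge0 L f (i : 'I_n) : lip L f -> 0 <= L.
Proof.
move=> /(_ (evec i) 0); rewrite subr0 norm_evec mulr1; exact: le_trans.
Qed.

Lemma lip_line L f x v : lip L f -> forall s z,
  `|f (x + s *: v) - f (x + z *: v)| <= L * `|v| * `|s - z|.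
Proof.
move=> fL s z; apply: (le_trans (fL _ _)).
by rewrite opprD addrACA subrr add0r -scalerBl normrZ -mulrA [`|_ - _| * _]mulrC.
Qed.

Lemma continuous_line L f x eps i : lip L f ->
  continuous (fun s => f (x + (eps * s) *: evec i)).
Proof.
move=> fL; apply: (@lipschitz_continuous _ _ _ (L * `|eps|)) => s z.
apply: (le_trans (lip_line _ _ fL _ _)).
by rewrite norm_evec mulr1 -mulrBr normrM mulrA.
Qed.

Lemma mollify1D L1 L2 eps i f g a x : lip L1 f -> lip L2 g ->
  mollify1 eps i (fun y => f y + a * g y) x =
  mollify1 eps i f x + a * mollify1 eps i g x.
Proof. by move=> fL gL; rewrite /mollify1 -averageD//; exact: continuous_line. Qed.

Lemma lip_shift L f v : lip L f -> lip L (fun x => f (x + v)).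
Proof.
move=> fL x y; apply: (le_trans (fL _ _)).
by rewrite opprD addrACA subrr addr0.
Qed.

Lemma lipD L1 L2 a f g : lip L1 f -> lip L2 g ->
  lip (L1 + `|a| * L2) (fun y => f y + a * g y).
Proof.
move=> fL gL x y; rewrite mulrDl.
rewrite (_ : _ - _ = f x - f y + a * (g x - g y)); last ring.
apply: (le_trans (ler_normD _ _)); rewrite lerD ?fL// normrM -mulrA.
by rewrite ler_wpM2l ?gL.
Qed.

Lemma mollify1_shift eps i f v x :
  mollify1 eps i (fun y => f (y + v)) x = mollify1 eps i f (x + v).
Proof. by rewrite /mollify1; under eq_fun do rewrite addrAC. Qed.

Lemma mollify1_norm_le L C eps i f x : lip L f -> (forall y, `|f y| <= C) ->
  `|mollify1 eps i f x| <= C.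
Proof.
by move=> fL fC; apply: average_norm_le => //; exact: continuous_line.
Qed.

Lemma mollify1_diff L eps i f v w x : lip L f ->
  mollify1 eps i (fun y => f (y + v) + (-1) * f (y + w)) x =
  mollify1 eps i f (x + v) - mollify1 eps i f (x + w).
Proof.
move=> fL; rewrite (mollify1D (L1 := L) (L2 := L)); try exact: lip_shift.
by rewrite !mollify1_shift mulN1r.
Qed.

Lemma lip_diff L f v w : lip L f -> lip (L + L) (fun y => f (y + v) + (-1) * f (y + w)).
Proof.
move=> fL; have := lipD (-1) (lip_shift v fL) (lip_shift w fL).
by rewrite normrN normr1 mul1r.
Qed.

Lemma mollify1_diff_le L C eps i f v w x : lip L f ->
  (forall y, `|f (y + v) - f (y + w)| <= C) ->
  `|mollify1 eps i f (x + v) - mollify1 eps i f (x + w)| <= C.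
Proof.
move=> fL H; rewrite -(mollify1_diff _ _ _ _ _ fL).
apply: (mollify1_norm_le _ _ _ (lip_diff v w fL)) => y.
by rewrite mulN1r.
Qed.

Lemma lip_mollify1 L eps i f : lip L f -> lip L (mollify1 eps i f).
Proof.
move=> fL x y; have := @mollify1_diff_le L (L * `|x - y|) eps i f (x - y) 0 y fL.
rewrite addr0 subrKC; apply => z; rewrite addr0; apply: (le_trans (fL _ _)).
by rewrite addrC addKr.
Qed.

(** Averaging is linear and commutes with translations, hence it preserves such pointwise bounds;
    with C = 0 it even preserves identities. *)
Lemma mollify1_first_order L L' C eps i f p v s x : lip L f -> lip L' p ->
  (forall y, `|f (y + v) - f y - s * p y| <= C) ->
  `|mollify1 eps i f (x + v) - mollify1 eps i f x - s * mollify1 eps i p x| <= C.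
Proof.
move=> fL pL H.
have H1 := lip_diff v 0 fL.
have E : mollify1 eps i (fun y => f (y + v) + (-1) * f (y + 0) + (- s) * p y) x =
    mollify1 eps i f (x + v) - mollify1 eps i f x - s * mollify1 eps i p x.
  by rewrite (mollify1D _ _ _ _ H1 pL) (mollify1_diff _ _ _ _ _ fL) addr0 mulNr.
rewrite -E; apply: (mollify1_norm_le _ _ _ (lipD (- s) H1 pL)) => y.
by rewrite addr0 mulN1r mulNr.
Qed.

Lemma reg_mollify1 k L eps i f : reg k L f -> reg k L (mollify1 eps i f).
Proof.
elim: k f => [|k IH] f [fL H]; split => //; try exact: lip_mollify1.
move=> j; have [p pk Hp] := H j; exists (mollify1 eps i p); first exact: IH.
move=> x s; apply: (mollify1_first_order _ _ _ fL (reg_lip pk)) => y.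
exact: Hp.
Qed.

Lemma reg_le k L1 L2 f : L1 <= L2 -> reg k L1 f -> reg k L2 f.
Proof.
move=> L12; elim: k f => [|k IH] f [fL H]; split => //;
  try by move=> x y; apply: (le_trans (fL _ _)); rewrite ler_wpM2r.
move=> j; have [p pk Hp] := H j; exists p; first exact: IH.
by move=> x s; apply: (le_trans (Hp _ _)); rewrite ler_wpM2r ?sqr_ge0.
Qed.

Lemma regD k L1 L2 a f g : reg k L1 f -> reg k L2 g ->
  reg k (L1 + `|a| * L2) (fun y => f y + a * g y).
Proof.
elim: k f g => [|k IH] f g [fL H] [gL H']; split => //; try exact: lipD.
move=> j; have [p pk Hp] := H j; have [p' pk' Hp'] := H' j.
exists (fun y => p y + a * p' y); first exact: IH.
move=> x s; rewrite (_ : _ - _ = f (x + s *: evec j) - f x - s * p x +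
  a * (g (x + s *: evec j) - g x - s * p' x)); last ring.
rewrite mulrDl; apply: (le_trans (ler_normD _ _)); rewrite lerD ?Hp//.
by rewrite normrM -mulrA ler_wpM2l ?Hp'.
Qed.

Lemma reg_shift k L f v : reg k L f -> reg k L (fun y => f (y + v)).
Proof.
elim: k f => [|k IH] f [fL H]; split => //; try exact: lip_shift.
move=> j; have [p pk Hp] := H j; exists (fun y => p (y + v)); first exact: IH.
by move=> x s; rewrite [x + _ + v]addrAC; exact: Hp.
Qed.

Lemma reg_scale k L a f : reg k L f -> reg k (`|a| * L) (fun y => a * f y).
Proof.
elim: k f => [|k IH] f [fL H]; split => //;
  try by move=> x y; rewrite -mulrBr normrM -mulrA ler_wpM2l ?fL.
move=> j; have [p pk Hp] := H j; exists (fun y => a * p y); first exact: IH.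
move=> x s; rewrite (_ : _ - _ = a * (f (x + s *: evec j) - f x - s * p x)); last ring.
by rewrite normrM -mulrA ler_wpM2l ?Hp.
Qed.

(* Averaging over a segment of length eps gains one derivative in the direction
   of the segment, namely a difference quotient. *)
Lemma mollify1_gain k L eps i f : 0 < eps -> reg k L f ->
  exists2 p, reg k (2 * L / eps) p & forall x s,
    `|mollify1 eps i f (x + s *: evec i) - mollify1 eps i f x - s * p x|
      <= 2 * L / eps * s ^+ 2.
Proof.
move=> eps0 fk; have fL := reg_lip fk.
exists (fun y => eps^-1 * (f (y + eps *: evec i) + (-1) * f y)).
  have := reg_scale eps^-1 (regD (-1) (reg_shift (eps *: evec i) fk) fk).
  rewrite normrN normr1 mul1r gtr0_norm ?invr_gt0//.
  by rewrite (_ : eps^-1 * (L + L) = 2 * L / eps)//; ring.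
move=> x s; pose phi z := f (x + (eps * z) *: evec i).
have phiL (y z : R) : `|phi y - phi z| <= (L * eps) * `|y - z|.
  apply: (le_trans (lip_line _ _ fL _ _)).
  by rewrite norm_evec mulr1 -mulrBr normrM (gtr0_norm eps0) mulrA.
have := average_shift (s / eps) phiL.
have -> : average (fun z => phi (z + s / eps)) =
    mollify1 eps i f (x + s *: evec i).
  rewrite /mollify1 /phi; congr average; apply/funext => z.
  by rewrite mulrDr scalerDl [eps * (s / eps)]mulrC divfK ?gt_eqF// addrA addrAC.
have -> : phi 1 - phi 0 = f (x + eps *: evec i) + -1 * f x.
  by rewrite /phi mulr1 mulr0 scale0r addr0 mulN1r.
rewrite -/(mollify1 eps i f x) -mulrA => H; apply: (le_trans H).
rewrite le_eqVlt; apply/orP; left; apply/eqP; field.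
by rewrite gt_eqF.
Qed.

Definition mollify eps f := foldr (mollify1 eps) f (enum 'I_n).

Lemma mollify_ind (P : ('rV[R]_n -> R) -> Prop) eps f :
  (forall i g, P g -> P (mollify1 eps i g)) -> P f -> P (mollify eps f).
Proof.
by move=> H Pf; rewrite /mollify; elim: (enum _) => [//|i r IH] /=; exact: H.
Qed.

(** Each average gains a derivative in its own direction only, and the later ones keep it. The
    induction carries regularity k in all directions and one more derivative in those already
    averaged. *)
Lemma reg_mollify k L eps f : (0 < n)%N -> 0 < eps <= 1 -> reg k L f ->
  reg k.+1 (2 * L / eps) (mollify eps f).
Proof.
move=> n_gt0 /andP[eps0 eps1] fk; pose i0 := Ordinal n_gt0.
have L0 := lip_ge0 i0 (reg_lip fk).
have LL : L <= 2 * L / eps by rewrite ler_pdivlMr//; nra.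
have G (r : seq 'I_n) : reg k L (foldr (mollify1 eps) f r) /\ forall i, i \in r -> exists2 p, reg k (2 * L / eps) p &
    forall x s, `|foldr (mollify1 eps) f r (x + s *: evec i) -
      foldr (mollify1 eps) f r x - s * p x| <= 2 * L / eps * s ^+ 2.
  elim: r => [//|j r [IH1 IH2]] /=; split; first exact: reg_mollify1.
  move=> i; rewrite inE => /predU1P[->|/IH2[p pk Hp]].
    exact: mollify1_gain.
  exists (mollify1 eps j p); first exact: reg_mollify1.
  move=> x s; apply: (mollify1_first_order _ _ _ (reg_lip IH1) (reg_lip pk)) => y.
  exact: Hp.
have [G1 G2] := G (enum 'I_n).
split=> [|i]; last by apply: G2; rewrite mem_enum.
by apply: (reg_lip (k := k)); exact: reg_le G1.
Qed.

End Mollification.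

(** * Taylor expansion, one coordinate at a time *)

Section Taylor.
Context {R : realType} {n : nat}.
Implicit Types (x y h : 'rV[R]_n) (L s : R) (r : seq 'I_n).

Definition first_order L (f : 'rV[R]_n -> R) (p : 'I_n -> 'rV[R]_n -> R) :=
  forall i x s, `|f (x + s *: evec i) - f x - s * p i x| <= L * s ^+ 2.

Lemma quad_delta (i j : 'I_n) h : quad (delta_mx i j) h = h 0 i * h 0 j.
Proof.
rewrite quadE (bigD1 j)//= [X in _ + X]big1 ?addr0 => [|k kj]; last first.
  by rewrite big1 ?mul0r// => l _; rewrite mxE (negbTE kj) andbF mulr0.
rewrite (bigD1 i)//= big1 ?addr0 => [|k ki]; last first.
  by rewrite mxE (negbTE ki) mulr0.
by rewrite mxE !eqxx mulr1.
Qed.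

Lemma quad_add (A B : 'M[R]_n) h : quad (A + B) h = quad A h + quad B h.
Proof. by rewrite /quad mulmxDr dotDl. Qed.

Lemma quad_scale a (A : 'M[R]_n) h : quad (a *: A) h = a * quad A h.
Proof. by rewrite /quad -scalemxAr dotZl. Qed.

Lemma quad_sum (I : Type) (r : seq I) (A : I -> 'M[R]_n) h :
  quad (\sum_(i <- r) A i) h = \sum_(i <- r) quad (A i) h.
Proof.
elim: r => [|i r IH]; first by rewrite !big_nil quad0.
by rewrite !big_cons quad_add IH.
Qed.

Lemma sum_evec h : \sum_(i <- enum 'I_n) h 0 i *: evec i = h.
Proof. by rewrite big_enum [RHS]row_sum_delta. Qed.

Lemma norm_sum_le (r : seq 'I_n) (F : 'I_n -> R) C :
  (forall i, `|F i| <= C) -> `|\sum_(i <- r) F i| <= (size r)%:R * C.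
Proof.
move=> FC; apply: (le_trans (ler_norm_sum _ _ _)).
elim: r => [|i r IH]; first by rewrite big_nil mul0r.
by rewrite big_cons -natr1 mulrDl mul1r addrC lerD.
Qed.

Lemma sqr_coord_le h i : h 0 i ^+ 2 <= `|h| ^+ 2.
Proof. by rewrite -real_normK ?num_real// lerXn2r ?nnegrE// coord_le_norm. Qed.

(** Coordinate i is moved first and the others from the new point y; the extra error is the
    variation of their partial derivatives between x and y. *)
Lemma taylor1 L f p r x h : 0 <= L ->
  first_order L f p -> (forall i, lip L (p i)) ->
  `|f (x + \sum_(i <- r) h 0 i *: evec i) - f x - \sum_(i <- r) h 0 i * p i x|
     <= (size r)%:R ^+ 2 * L * `|h| ^+ 2.
Proof.
move=> L0 fp pL; elim: r x => [|i r IH] x.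
  by rewrite !big_nil addr0 !subrr normr0 expr0n /= !mul0r.
rewrite !big_cons addrA; set y := x + h 0 i *: evec i.
have H1 := IH y; have H2 := fp i x (h 0 i); rewrite -/y in H2.
have H3 : `|\sum_(j <- r) h 0 j * (p j y - p j x)| <=
    (size r)%:R * (`|h| * (L * `|h|)).
  apply: norm_sum_le => j; rewrite normrM ler_pM ?coord_le_norm//.
  apply: (le_trans (pL j _ _)); rewrite ler_wpM2l//.
  by rewrite /y addrC addKr normrZ norm_evec mulr1 coord_le_norm.
have E : \sum_(j <- r) h 0 j * (p j y - p j x) =
    \sum_(j <- r) h 0 j * p j y - \sum_(j <- r) h 0 j * p j x.
  by rewrite -sumrB; apply: eq_bigr => j _; rewrite mulrBr.
rewrite E in H3.
have H4 := ler_wpM2l L0 (sqr_coord_le h i).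
have H5 : 0 <= (size r)%:R * (L * `|h| ^+ 2) by rewrite !mulr_ge0 ?sqr_ge0.
set A := \sum_(j <- r) _ *: _ in H1 *.
set B := \sum_(j <- r) _ * p j x in H3 *; set D := \sum_(j <- r) _ in H1 H3.
rewrite /= -natr1; move: H1 H2 H3; rewrite !ler_norml.
move=> /andP[? ?] /andP[? ?] /andP[? ?]; apply/andP; split; lra.
Qed.

(** The derivative of the remainder in s is the first-order remainder of [p i], of size L s^2; the
    mean value bound adds a factor |s|. *)
Lemma taylor_line L f p X x s i : 0 <= L ->
  first_order L f p -> (forall i, first_order L (p i) (X i)) ->
  `|f (x + s *: evec i) - f x - s * p i x - s ^+ 2 * X i i x / 2|
    <= L * `|s| ^+ 3.
Proof.
move=> L0 fp pX.
pose G (z : R) := f (x + z *: evec i) - z * p i x - z ^+ 2 * X i i x / 2.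
pose D (z : R) := p i (x + z *: evec i) - p i x - z * X i i x.
have -> : f (x + s *: evec i) - f x - s * p i x - s ^+ 2 * X i i x / 2 = G s - G 0.
  by rewrite /G scale0r addr0; ring.
rewrite exprSr mulrA; apply: (@mvt_bound _ _ D) => z zs.
  apply: (@is_derive_quadratic _ _ _ _ (L + `|X i i x|)) => t.
  have H := fp i (x + z *: evec i) t.
  have E : G (z + t) - G z - t * D z = f (x + z *: evec i + t *: evec i) -
      f (x + z *: evec i) - t * p i (x + z *: evec i) - t ^+ 2 * X i i x / 2.
    by rewrite /G /D scalerDl addrA; field.
  rewrite E; apply: (le_trans (ler_normB _ _)).
  rewrite mulrDl lerD// normrM [`|2^-1|]gtr0_norm// normrM [`|t ^+ 2|]ger0_norm ?sqr_ge0//.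
  have : 0 <= t ^+ 2 * `|X i i x| by rewrite mulr_ge0 ?sqr_ge0.
  lra.
apply: (le_trans (pX i i x z)); rewrite ler_wpM2l// -real_normK ?num_real//.
by rewrite lerXn2r ?nnegrE.
Qed.

Lemma taylor2 L f p X r : 0 <= L ->
  first_order L f p -> (forall i, lip L (p i)) ->
  (forall i, first_order L (p i) (X i)) -> (forall i j, lip L (X i j)) ->
  exists M : 'rV[R]_n -> 'M[R]_n,
    (forall x y h, `|quad (M x) h / 2 - quad (M y) h / 2| <=
       (size r)%:R ^+ 2 * (L * `|x - y|) * `|h| ^+ 2) /\
    forall x h, `|f (x + \sum_(i <- r) h 0 i *: evec i) - f x -
       \sum_(i <- r) h 0 i * p i x - quad (M x) h / 2|
       <= (size r)%:R ^+ 3 * L * `|h| ^+ 3.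
Proof.
move=> L0 fp pL pX XL; elim: r => [|i r [M [IH1 IH2]]].
  exists (fun=> 0); split => [x y h|x h].
    by rewrite subrr normr0 expr0n /= !mul0r.
  by rewrite !big_nil addr0 quad0 mul0r !subrr normr0 expr0n /= !mul0r.
(* With coordinate i moved first, the mixed derivatives that arise are the [X j i]. Only the
   quadratic form of the matrix counts, so each is put, doubled, into a single entry. *)
exists (fun x => M x + X i i x *: delta_mx i i +
  \sum_(j <- r) (2 * X j i x) *: delta_mx i j).
have ME x h : quad (M x + X i i x *: delta_mx i i +
    \sum_(j <- r) (2 * X j i x) *: delta_mx i j) h / 2 =
    quad (M x) h / 2 + X i i x * h 0 i ^+ 2 / 2 +
    \sum_(j <- r) h 0 j * (h 0 i * X j i x).
  rewrite !quad_add quad_sum quad_scale quad_delta -expr2 !mulrDl.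
  congr (_ + _); rewrite mulr_suml; apply: eq_bigr => j _.
  by rewrite quad_scale quad_delta; field.
have hh i1 i2 h : `|h 0 i1 * h 0 i2| <= `|h| ^+ 2.
  by rewrite normrM expr2 ler_pM ?coord_le_norm.
split => [x y h|x h].
  rewrite !ME /= -[(size r).+1%:R]natr1.
  have H1 := IH1 x y h.
  have H2 : `|h 0 i ^+ 2 * (X i i x - X i i y)| <= `|h| ^+ 2 * (L * `|x - y|).
    by rewrite normrM ler_pM ?XL// expr2.
  have H3 : `|\sum_(j <- r) h 0 j * h 0 i * (X j i x - X j i y)| <=
      (size r)%:R * (`|h| ^+ 2 * (L * `|x - y|)).
    by apply: norm_sum_le => j; rewrite normrM ler_pM ?XL.
  rewrite (eq_bigr (fun j => h 0 j * (h 0 i * X j i x) - h 0 j * (h 0 i * X j i y)))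
    in H3; last by move=> j _; ring.
  rewrite sumrB in H3.
  have H5 : 0 <= (L * `|x - y|) * `|h| ^+ 2 by rewrite !mulr_ge0 ?sqr_ge0.
  have H6 : 0 <= (size r)%:R * (`|h| ^+ 2 * (L * `|x - y|)).
    by rewrite !mulr_ge0 ?sqr_ge0.
  move: H1 H2 H3; rewrite !ler_norml.
  move=> /andP[? ?] /andP[? ?] /andP[? ?]; apply/andP; split; lra.
rewrite ME !big_cons addrA; set y := x + h 0 i *: evec i.
have yx : `|y - x| <= `|h|.
  by rewrite /y addrC addKr normrZ norm_evec mulr1 coord_le_norm.
have H1 := IH2 y h.
have H2 := taylor_line x (h 0 i) i L0 fp pX; rewrite -/y in H2.
have H3 : `|\sum_(j <- r) h 0 j * (p j y - p j x - h 0 i * X j i x)| <=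
    (size r)%:R * (`|h| * (L * `|h| ^+ 2)).
  apply: norm_sum_le => j; rewrite normrM ler_pM ?coord_le_norm//.
  by apply: (le_trans (pX j i x _)); rewrite ler_wpM2l// sqr_coord_le.
rewrite (eq_bigr (fun j => h 0 j * p j y - h 0 j * p j x -
  h 0 j * (h 0 i * X j i x))) in H3; last by move=> j _; ring.
rewrite !sumrB in H3.
have H4 : `|quad (M y) h / 2 - quad (M x) h / 2| <=
    (size r)%:R ^+ 2 * (L * `|h|) * `|h| ^+ 2.
  apply: (le_trans (IH1 _ _ _)); rewrite ler_wpM2r ?sqr_ge0// ler_wpM2l ?sqr_ge0//.
  by rewrite ler_wpM2l.
have {}H2 : `|f y - f x - h 0 i * p i x - h 0 i ^+ 2 * X i i x / 2| <= L * `|h| ^+ 3.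
  apply: (le_trans H2); rewrite ler_wpM2l//.
  by rewrite lerXn2r ?nnegrE// coord_le_norm.
have H5 : 0 <= L * `|h| ^+ 3 by rewrite mulr_ge0 ?exprn_ge0.
have H6 : 0 <= (size r)%:R * (L * `|h| ^+ 3) by rewrite mulr_ge0.
have H7 : 0 <= (size r)%:R ^+ 2 * (L * `|h| ^+ 3) by rewrite mulr_ge0 ?sqr_ge0.
rewrite /= -[(size r).+1%:R]natr1.
set A := \sum_(j <- r) _ *: _ in H1 *.
set B1 := \sum_(j <- r) _ * p j y in H1 H3.
set B2 := \sum_(j <- r) _ * p j x in H3 *.
set B3 := \sum_(j <- r) _ in H3 *.
move: H1 H2 H3 H4; rewrite !ler_norml.
move=> /andP[? ?] /andP[? ?] /andP[? ?] /andP[? ?]; apply/andP; split; lra.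
Qed.

Lemma jet_reg2 L (f : 'rV[R]_n -> R) : (0 < n)%N -> reg 2 L f -> jet (4 * n%:R ^+ 3 * L) f.
Proof.
move=> n_gt0 fk; pose i0 := Ordinal n_gt0.
have L0 := lip_ge0 i0 (reg_lip fk).
have [_ /= H] := fk.
have /choice[p pk] : forall i, exists pi, reg 1 L pi /\
    forall x s, `|f (x + s *: evec i) - f x - s * pi x| <= L * s ^+ 2.
  by move=> i; have [pi H1 H2] := H i; exists pi.
have fp : first_order L f p by move=> i x s; have [_] := pk i; exact.
have pL i : lip L (p i) by have [/reg_lip] := pk i.
have /choice[X Xk] : forall i, exists Xi : 'I_n -> 'rV[R]_n -> R, forall j,
    lip L (Xi j) /\
    forall x s, `|p i (x + s *: evec j) - p i x - s * Xi j x| <= L * s ^+ 2.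
  move=> i; have /choice[Xi HXi] : forall j, exists Xij, lip L Xij /\
      forall x s, `|p i (x + s *: evec j) - p i x - s * Xij x| <= L * s ^+ 2.
    by move=> j; have [[_ /= H'] _] := pk i; have [Xij [H1 _] H2] := H' j; exists Xij.
  by exists Xi.
have pX i : first_order L (p i) (X i).
  by move=> j x s; have [_] := Xk i j; exact.
have XL i j : lip L (X i j) by have [] := Xk i j.
have [M [_ HM]] := taylor2 (enum 'I_n) L0 fp pL pX XL.
have sz : size (enum 'I_n) = n by rewrite size_enum_ord.
have n1 : 1 <= n%:R :> R by rewrite ler1n.
have n23 : n%:R ^+ 2 <= n%:R ^+ 3 :> R by rewrite ler_weXn2l.
move=> x; exists (\row_i p i x), (M x) => h.
have pE : dot (\row_i p i x) h = \sum_(i <- enum 'I_n) h 0 i * p i x.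
  by rewrite big_enum; apply: eq_bigr => i _; rewrite mxE mulrC.
have T1 k : `|f (x + k) - f x - dot (\row_i p i x) k| <= n%:R ^+ 2 * L * `|k| ^+ 2.
  have := taylor1 (enum 'I_n) x k L0 fp pL; rewrite sum_evec sz.
  by rewrite (_ : dot _ k = \sum_(i <- enum 'I_n) k 0 i * p i x)// big_enum;
    apply: eq_bigr => i _; rewrite mxE mulrC.
have T2 k : `|f (x + k) - f x - dot (\row_i p i x) k - quad (M x) k / 2| <=
    n%:R ^+ 3 * L * `|k| ^+ 3.
  have := HM x k; rewrite sum_evec sz.
  by rewrite (_ : dot _ k = \sum_(i <- enum 'I_n) k 0 i * p i x)// big_enum;
    apply: eq_bigr => i _; rewrite mxE mulrC.
have nL : 0 <= n%:R ^+ 3 * L by rewrite mulr_ge0 ?exprn_ge0.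
have nL2 : n%:R ^+ 2 * L <= n%:R ^+ 3 * L by rewrite ler_wpM2r.
split.
- apply: (le_trans (T1 h)); rewrite ler_wpM2r ?sqr_ge0//; lra.
(* By homogeneity the form is bounded on unit vectors only, where subtracting the two expansions
   gives 2 (n^2 + n^3) L; this is the origin of the factor 4. *)
- have [->|h0] := eqVneq h 0.
    by rewrite /quad mul0mx dot0l !normr0 expr0n /= mulr0.
  pose k := `|h|^-1 *: h.
  have k1 : `|k| = 1 by rewrite normrZ normfV normr_id mulVf// normr_eq0.
  have -> : quad (M x) h = `|h| ^+ 2 * quad (M x) k.
    by rewrite -quadZ scalerA divff ?scale1r// normr_eq0.
  rewrite normrM [`|_ ^+ 2|]ger0_norm ?sqr_ge0//.
  rewrite mulrC ler_wpM2r ?sqr_ge0//.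
  have := T1 k; have := T2 k; rewrite k1 !expr1n !mulr1 !ler_norml.
  by move=> /andP[? ?] /andP[? ?]; apply/andP; split; lra.
- apply: (le_trans (T2 h)); rewrite ler_wpM2r ?exprn_ge0//; lra.
Qed.

End Taylor.

(** * Level sets of the payoff *)

Section Slack.
Context {R : realType} {n d : nat}.
Variable q : history d -> 'rV[R]_n.
Hypothesis n_gt0 : (0 < n)%N.
Implicit Types (f : 'rV[R]_n -> R) (x v : 'rV[R]_n).

(** For rho > 0 the slope along each q(m) is strictly below 1: this margin keeps the optimal f of
    the game in [-1, 1]. *)
Definition slack (rho : R) f := forall m mu x, 0 <= mu ->
  `|f (x + mu *: q m) - f x| <= mu * (1 - rho).

Lemma mollify1_profile L eps i f : lip L f -> profile f ->
  profile (mollify1 eps i f).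
Proof.
move=> fL fP x s; apply/eqP; rewrite -subr_eq0 -normr_le0.
have l1 : lip 0 (fun _ : 'rV[R]_n => 1 : R).
  by move=> y z; rewrite subrr normr0 mul0r.
have M1 : mollify1 eps i (fun _ : 'rV[R]_n => 1 : R) x = 1 by exact: average_cst.
(* The profile identity is a first-order expansion with slope 1, increment -s and error 0. *)
rewrite (_ : _ - _ = mollify1 eps i f (x + s *: one_vec) -
  mollify1 eps i f x - (- s) * mollify1 eps i (fun=> 1) x); last first.
  by rewrite M1; ring.
apply: (mollify1_first_order _ _ _ fL l1) => y.
by rewrite fP (_ : _ - _ = 0) ?normr0//; ring.
Qed.

Lemma mollify1_slack L rho eps i f : lip L f -> slack rho f ->
  slack rho (mollify1 eps i f).
Proof.
move=> fL fs m mu x mu0.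
have := @mollify1_diff_le R n L (mu * (1 - rho)) eps i f (mu *: q m) 0 x fL.
by rewrite !addr0; apply => y; rewrite addr0; exact: fs.
Qed.

Lemma mollify1_close eps i f x : 0 <= eps -> lip 1 f ->
  `|mollify1 eps i f x - f x| <= eps.
Proof.
move=> e0 fL; rewrite -[f x](average_cst).
rewrite (_ : _ - _ = average (fun s => f (x + (eps * s) *: evec i) + (-1) * f x)).
  apply: average_norm_le => [|s /andP[s0 s1]].
    move=> z; apply: cvgD; last exact: cvg_cst.
    exact: (@continuous_line _ _ _ f x eps i fL z).
  rewrite mulN1r; apply: (le_trans (fL _ _)).
  rewrite mul1r addrC addKr normrZ norm_evec mulr1 ger0_norm ?mulr_ge0//.
  by rewrite ler_piMr.
rewrite (averageD (-1) (@continuous_line _ _ _ f x eps i fL) (@cst_continuous _ _ (f x))).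
by rewrite mulN1r.
Qed.

Lemma mollify_close eps f x : 0 <= eps -> lip 1 f ->
  `|mollify eps f x - f x| <= n%:R * eps.
Proof.
move=> e0 fL; rewrite /mollify -[n in n%:R]size_enum_ord.
have G (r : seq 'I_n) : lip 1 (foldr (mollify1 eps) f r) /\
    `|foldr (mollify1 eps) f r x - f x| <= (size r)%:R * eps.
  elim: r => [|i r [IH1 IH2]] /=; first by rewrite subrr normr0 mul0r.
  split; first exact: lip_mollify1.
  rewrite -natr1 mulrDl mul1r [leRHS]addrC.
  apply: (le_trans (ler_distD (foldr (mollify1 eps) f r x) _ _)).
  by apply: lerD => //; exact: mollify1_close.
by have [] := G (enum 'I_n).
Qed.

(** Two rounds of mollification lead from Lipschitz functions to Lipschitz second derivatives. K is
    chosen before f and rho, hence is common to all levels. *)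
Lemma smooth_profile (eps : R) : 0 < eps <= 1 -> exists2 K, 0 < K &
  forall rho f, lip 1 f -> profile f -> slack rho f ->
  exists F, [/\ jet K F, profile F, slack rho F &
    forall x, `|F x - f x| <= 2 * n%:R * eps].
Proof.
move=> /[dup] eps01 /andP[eps0 eps1].
exists (4 * n%:R ^+ 3 * (2 * (2 * 1 / eps) / eps)).
  by rewrite !mulr_gt0 ?exprn_gt0 ?invr_gt0// ltr0n.
move=> rho f fL fP fs; exists (mollify eps (mollify eps f)).
have G : [/\ lip 1 (mollify eps f), profile (mollify eps f) &
    slack rho (mollify eps f)].
  apply: (mollify_ind (P := fun f' => [/\ lip 1 f', profile f' & slack rho f'])).
    move=> i f' [l1 l2 l3]; split.
    - exact: lip_mollify1.
    - exact: mollify1_profile l1 l2.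
    - exact: mollify1_slack l1 l3.
  by split.
have [G1 G2 G3] := G.
have r0 : reg 0 1 f by split.
split.
- apply: jet_reg2 => //; do 2 apply: reg_mollify => //.
- apply: (mollify_ind (P := fun f' => lip 1 f' /\ profile f') _ (conj G1 G2)).2.
  move=> i f' [l1 l2]; split; [exact: lip_mollify1|exact: mollify1_profile l1 l2].
- apply: (mollify_ind (P := fun f' => lip 1 f' /\ slack rho f') _ (conj G1 G3)).2.
  move=> i f' [l1 l2]; split; [exact: lip_mollify1|exact: mollify1_slack l1 l2].
- move=> x; apply: (le_trans (ler_distD (mollify eps f x) _ _)).
  rewrite (_ : 2 * n%:R * eps = n%:R * eps + n%:R * eps); last ring.
  by apply: lerD; apply: mollify_close => //; exact: ltW.
Qed.

End Slack.

Lemma finite_pos_lb (R : realType) (I : finType) (F : I -> R) :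
  (forall i, 0 < F i) -> exists2 rho, 0 < rho & forall i, rho <= F i.
Proof.
move=> F0; have S0 : 0 < 1 + \sum_i (F i)^-1.
  by rewrite ltr_pwDl// sumr_ge0// => i _; rewrite invr_ge0 ltW.
exists (1 + \sum_i (F i)^-1)^-1 => [|i]; first by rewrite invr_gt0.
rewrite -[leRHS]invrK lef_pV2 ?posrE ?invr_gt0//.
rewrite (bigD1 i)//= addrCA lerDl addr_ge0// sumr_ge0// => j _.
by rewrite invr_ge0 ltW.
Qed.

(** * Heights of the level sets of g *)

Section LevelProfile.
Context {R : realType} {n : nat}.
Hypothesis n_gt0 : (0 < n)%N.
Variables (g : 'rV[R]_n -> R) (theta Lg : R).
Hypotheses (theta_gt0 : 0 < theta) (Lg_gt0 : 0 < Lg).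
Hypotheses (gmono : payoff_monotone theta g) (gL : lip Lg g).
Implicit Types (x v : 'rV[R]_n) (c s : R).

Lemma payoff_up x s : 0 <= s -> g x + n%:R * theta * s <= g (x + s *: one_vec).
Proof.
move=> s0; apply: le_trans (gmono _ _) => [|i]; last by rewrite !mxE mulr1.
rewrite dotZl (_ : dot one_vec one_vec = n%:R); first by rewrite lerD2l; lra.
rewrite /dot (eq_bigr (fun=> 1)) => [|i _]; last by rewrite !mxE mulr1.
by rewrite sumr_const card_ord.
Qed.

Let nt_gt0 : 0 < n%:R * theta.
Proof. by rewrite mulr_gt0// ltr0n. Qed.

Lemma payoff_strict x s1 s2 : g (x + s1 *: one_vec) <= g (x + s2 *: one_vec) ->
  s1 <= s2.
Proof.
move=> H; rewrite leNgt; apply/negP => s21.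
have s0 : 0 <= s1 - s2 by rewrite subr_ge0 ltW.
have := payoff_up (x + s2 *: one_vec) s0.
rewrite -addrA -scalerDl subrKC.
have : 0 < n%:R * theta * (s1 - s2) by rewrite mulr_gt0// subr_gt0.
lra.
Qed.

Lemma payoff_lip1 x s : 0 <= s -> g (x + s *: one_vec) <= g x + Lg * s.
Proof.
move=> s0; have := gL (x + s *: one_vec) x.
rewrite [x + _ - x]addrC addKr normrZ norm_one_vec// mulr1 ger0_norm// ler_norml.
move=> /andP[_]; lra.
Qed.

Lemma level_exists c x : exists s, g (x + s *: one_vec) = c.
Proof.
pose B := `|c - g x| / (n%:R * theta).
have B0 : 0 <= B by rewrite divr_ge0// ltW.
have BE : n%:R * theta * B = `|c - g x| by rewrite mulrC divfK// gt_eqF.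
have h1 := payoff_up x B0; rewrite BE in h1.
have h2 := payoff_up (x + (- B) *: one_vec) B0.
rewrite BE -addrA -scalerDl addNr scale0r addr0 in h2.
have n1 := ler_norm (c - g x); have n2 := ler_norm (- (c - g x)).
rewrite normrN in n2.
have cont : {within `[- B, B], continuous (fun s => g (x + s *: one_vec))}.
  apply: continuous_subspaceT; apply: (@lipschitz_continuous _ _ _ Lg) => s z.
  by have := lip_line x one_vec gL s z; rewrite norm_one_vec// mulr1.
have cB : Num.min (g (x + - B *: one_vec)) (g (x + B *: one_vec)) <= c <=
    Num.max (g (x + - B *: one_vec)) (g (x + B *: one_vec)).
  by rewrite ge_min le_max; apply/andP; split; apply/orP; [left|right]; lra.
have BB : - B <= B by lra.
by have [s _ <-] := IVT BB cont cB; exists s.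
Qed.

(** The default 0 is never taken, by [level_exists]. *)
Definition level c x : R := xget 0 [set s | g (x + s *: one_vec) = c].

Lemma levelP c x : g (x + level c x *: one_vec) = c.
Proof. by rewrite /level; case: xgetP => // H; have [s /H] := level_exists c x. Qed.

Lemma level_ge c x s : g (x + s *: one_vec) <= c -> s <= level c x.
Proof. by rewrite -{1}(levelP c x); exact: payoff_strict. Qed.

Lemma level_le c x s : c <= g (x + s *: one_vec) -> level c x <= s.
Proof. by rewrite -{1}(levelP c x); exact: payoff_strict. Qed.

Lemma level_ge0 c x : g x <= c -> 0 <= level c x.
Proof. by move=> gc; apply: level_ge; rewrite scale0r addr0. Qed.

Lemma level_le0 c x : c <= g x -> level c x <= 0.
Proof. by move=> gc; apply: level_le; rewrite scale0r addr0. Qed.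

Lemma level_profile c : profile (level c).
Proof.
move=> x s; apply/le_anti/andP; split.
  by apply: level_le; rewrite -addrA -scalerDl subrKC levelP.
by apply: level_ge; rewrite -addrA -scalerDl subrKC levelP.
Qed.

(** The move v raises g by at least theta <v, 1>, and going down by s lowers it by at most Lg s. *)
Lemma level_mono c x v : (forall i, 0 <= v 0 i) ->
  level c (x + v) <= level c x - theta / Lg * dot v one_vec.
Proof.
move=> v0; set s := _ * dot v _.
have s0 : 0 <= s.
  rewrite mulr_ge0 ?divr_ge0 ?(ltW theta_gt0) ?(ltW Lg_gt0)//.
  by apply: sumr_ge0 => i _; rewrite mxE mulr1.
apply: level_le.
have := gmono (x + (level c x - s) *: one_vec) v0.
have := payoff_lip1 (x + (level c x - s) *: one_vec) s0.
rewrite -addrA -scalerDl subrK levelP => h1.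
have -> : x + (level c x - s) *: one_vec + v = x + v + (level c x - s) *: one_vec.
  by rewrite addrAC.
have : Lg * s = theta * dot v one_vec by rewrite /s; field; rewrite gt_eqF.
lra.
Qed.

(** In the maximum norm, [|x - y| *: one_vec - (x - y)] has nonnegative entries, so the height at y
    + |x - y| 1 is at most that at x. The constant 1 is the same for all c. *)
Lemma level_lip c : lip 1 (level c).
Proof.
have H x y : level c y - level c x <= `|x - y|.
  have w0 i : 0 <= (`|x - y| *: one_vec - (x - y)) 0 i.
    rewrite mxE [X in X + _]mxE [X in _ * X]mxE mulr1 [X in _ + X]mxE subr_ge0.
    by apply: (le_trans (ler_norm _)); exact: coord_le_norm.
  have := level_mono c x w0.
  have -> : x + (`|x - y| *: one_vec - (x - y)) = y + `|x - y| *: one_vec.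
    by rewrite addrCA opprB subrKC addrC.
  rewrite level_profile.
  have : 0 <= theta / Lg * dot (`|x - y| *: one_vec - (x - y)) one_vec.
    rewrite mulr_ge0 ?divr_ge0 ?(ltW theta_gt0) ?(ltW Lg_gt0)//.
    by apply: sumr_ge0 => i _; rewrite mulr_ge0// mxE.
  lra.
move=> x y; rewrite mul1r ler_norml; apply/andP; split.
  have := H x y; lra.
by have := H y x; rewrite distrC; lra.
Qed.

Lemma level_shift c k x : 0 <= k -> level c x + k / Lg <= level (c + k) x.
Proof.
move=> k0; apply: level_ge; rewrite scalerDl addrA.
have kL : 0 <= k / Lg by rewrite divr_ge0// ltW.
apply: (le_trans (payoff_lip1 _ kL)).
by rewrite levelP lerD2l mulrC divfK// gt_eqF.
Qed.

(** [one_vec + q m] and [one_vec - q m] are nonzero with nonnegative entries, and m has finitely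
    many values. [level_mono] along these vectors, together with the exact slope -1 along [one_vec],
    bounds the slope along q(m) from both sides. *)
Lemma level_slack d (q : history d -> 'rV[R]_n) : expert_predictions q ->
  exists2 rho, 0 < rho & forall c, slack q rho (level c).
Proof.
move=> qE.
have pos (v : 'rV[R]_n) : (forall i, 0 <= v 0 i) -> v <> 0 -> 0 < dot v one_vec.
  move=> v0 vn0; rewrite lt_neqAle; apply/andP; split; last first.
    by apply: sumr_ge0 => i _; rewrite mulr_ge0// mxE.
  apply/eqP => E; apply: vn0; apply/rowP => i; rewrite mxE.
  have /psumr_eq0P : forall j : 'I_n, true -> 0 <= v 0 j * one_vec 0 j.
    by move=> j _; rewrite mulr_ge0// mxE.
  by move=> /(_ (esym E))/(_ i isT); rewrite mxE mulr1.
have qb m i : -1 <= q m 0 i <= 1 by have [] := qE m.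
have up0 m i : 0 <= (one_vec + q m) 0 i.
  by rewrite !mxE; have := qb m i; lra.
have dn0 m i : 0 <= (one_vec - q m) 0 i.
  by rewrite !mxE; have := qb m i; lra.
have [r1 r10 Hr1] : exists2 r, 0 < r & forall m, r <= dot (one_vec + q m) one_vec.
  apply: finite_pos_lb => m; apply: pos (up0 m) _ => E.
  by have [_ [_]] := qE m; apply; apply/eqP; rewrite -subr_eq0 opprK addrC E.
have [r2 r20 Hr2] : exists2 r, 0 < r & forall m, r <= dot (one_vec - q m) one_vec.
  apply: finite_pos_lb => m; apply: pos (dn0 m) _ => E.
  by have [_ [+ _]] := qE m; apply; apply/eqP; rewrite eq_sym -subr_eq0 E.
pose k := theta / Lg; have k0 : 0 < k by rewrite divr_gt0.
exists (k * Num.min r1 r2); first by rewrite mulr_gt0// lt_min r10.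
move=> c m mu x mu0.
have m1 : Num.min r1 r2 <= dot (one_vec + q m) one_vec.
  by apply: le_trans (Hr1 m); rewrite ge_min lexx.
have m2 : Num.min r1 r2 <= dot (one_vec - q m) one_vec.
  by apply: le_trans (Hr2 m); rewrite ge_min lexx orbT.
have h1 : level c (x + mu *: q m) - level c x <= mu * (1 - k * Num.min r1 r2).
  have v0 i : 0 <= (mu *: (one_vec + q m)) 0 i by rewrite mxE mulr_ge0.
  have := level_mono c x v0; rewrite dotZl scalerDr addrA addrAC level_profile -/k.
  have := ler_wpM2l (mulr_ge0 mu0 (ltW k0)) m1; lra.
have h2 : level c x - level c (x + mu *: q m) <= mu * (1 - k * Num.min r1 r2).
  have v0 i : 0 <= (mu *: (one_vec - q m)) 0 i by rewrite mxE mulr_ge0.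
  have := level_mono c (x + mu *: q m) v0.
  rewrite dotZl scalerBr addrA addrAC addrK level_profile -/k.
  have := ler_wpM2l (mulr_ge0 mu0 (ltW k0)) m2; lra.
by rewrite ler_norml; apply/andP; split; lra.
Qed.

End LevelProfile.

(** * The game *)

Section HistoryAverage.
Context {R : realType} {d : nat}.
Implicit Types (b : history d -> R) (m : history d).

Definition hist_step b m : R := (b (push m true) + b (push m false)) / 2.

Lemma iter_hist_step_agree j b m m' : (forall i : 'I_d, (j <= i)%N -> m i = m' i) ->
  iter j hist_step b m = iter j hist_step b m'.
Proof.
elim: j m m' => [|j IH] m m' H /=; first by congr b; apply/ffunP => i; exact: H.
have E v : iter j hist_step b (push m v) = iter j hist_step b (push m' v).
  apply: IH => i ji; rewrite !ffunE; case: insubP => [k _ kE|//].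
  by apply: H; rewrite kE.
by rewrite /hist_step !E.
Qed.

Hypothesis d_gt0 : (0 < d)%N.

(** Invariance of the uniform distribution: appending a bit while recording the entry that drops out
    is a bijection of pairs. *)
Lemma sum_hist_step b : \sum_m hist_step b m = \sum_m b m.
Proof.
pose F (mv : history d * bool) := (push mv.1 mv.2, mv.1 (Ordinal d_gt0)).
have Finj : injective F.
  move=> [m v] [m' v'] [E E0].
  have Ei (i : 'I_d) := congr1 (fun h : history d => h i) E.
  have -> : v = v'.
    have last_lt : (d.-1 < d)%N by rewrite prednK.
    have := Ei (Ordinal last_lt); rewrite !ffunE /=.
    by case: insubP => [k /=|//]; rewrite prednK// ltnn.
  congr (_, _); apply/ffunP => -[[|i] Hi].
    by have -> : Ordinal Hi = Ordinal d_gt0 by exact: val_inj.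
  have := Ei (Ordinal (ltnW Hi)); rewrite !ffunE /=.
  case: insubP => [k /= _ kE|]; last by rewrite Hi.
  by have -> : Ordinal Hi = k by exact: val_inj.
have : \sum_(mv : history d * bool) b (F mv).1 =
    \sum_(mv : history d * bool) b mv.1.
  by rewrite [RHS](reindex_inj Finj).
rewrite -(pair_bigA _ (fun m v => b (push m v))) -(pair_bigA _ (fun m v => b m)) /=.
rewrite (eq_bigr (fun m => hist_step b m * 2)) => [|m _]; last first.
  by rewrite big_bool /hist_step divfK.
rewrite [RHS](eq_bigr (fun m => b m * 2)) => [|m _]; last first.
  by rewrite big_bool mulr_natr mulr2n.
by rewrite -!mulr_suml => /mulIf; apply.
Qed.

(* After d rounds the initial history is forgotten, and the current one uniform. *)
Lemma iter_hist_step_avg b m : \sum_m b m = 0 -> iter d hist_step b m = 0.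
Proof.
move=> b0; have C m' : iter d hist_step b m' = iter d hist_step b m.
  by apply: iter_hist_step_agree => i; rewrite leqNgt ltn_ord.
have S j : \sum_m' iter j hist_step b m' = 0.
  by elim: j => [|j IH] /=; [exact: b0|rewrite sum_hist_step].
move: (S d); rewrite (eq_bigr _ (fun m' _ => C m')) sumr_const => /eqP.
by rewrite mulrn_eq0 card_history expn_eq0 /= => /eqP.
Qed.

Lemma iter_hist_step_le j b B m : (forall m, `|b m| <= B) ->
  `|iter j hist_step b m| <= B.
Proof.
move=> H; elim: j m => [//|j IH] m /=; rewrite /hist_step.
have := IH (push m true); have := IH (push m false); rewrite !ler_norml.
by move=> /andP[? ?] /andP[? ?]; apply/andP; split; lra.
Qed.

Lemma iter_hist_step_diff j b1 b2 B m : (forall m, `|b1 m - b2 m| <= B) ->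
  `|iter j hist_step b1 m - iter j hist_step b2 m| <= B.
Proof.
move=> H; elim: j m => [//|j IH] m /=; rewrite /hist_step.
have := IH (push m true); have := IH (push m false); rewrite !ler_norml.
by move=> /andP[? ?] /andP[? ?]; apply/andP; split; lra.
Qed.

(** The Neumann series solving the Poisson equation of the history chain; for b of mean zero it
    stops, since the d-th iterate vanishes. *)
Definition corrector b m : R := \sum_(i < d) iter i hist_step b m.

Lemma correctorP b m : \sum_m b m = 0 ->
  (corrector b (push m true) + corrector b (push m false)) / 2 = corrector b m - b m.
Proof.
move=> b0; rewrite /corrector -big_split /= mulr_suml.
transitivity (\sum_(i < d) iter i.+1 hist_step b m); first exact: eq_bigr.
have H : \sum_(i < d.+1) iter i hist_step b m = \sum_(i < d) iter i hist_step b m.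
  by rewrite big_ord_recr /= iter_hist_step_avg// addr0.
by rewrite -H big_ord_recl /= addrC addKr.
Qed.

Lemma corrector_le b B m : (forall m, `|b m| <= B) -> `|corrector b m| <= d%:R * B.
Proof.
move=> H; apply: (le_trans (ler_norm_sum _ _ _)).
rewrite mulr_natl -[X in _ *+ X]card_ord -sumr_const; apply: ler_sum => i _.
exact: iter_hist_step_le.
Qed.

Lemma corrector_diff b1 b2 B m : (forall m, `|b1 m - b2 m| <= B) ->
  `|corrector b1 m - corrector b2 m| <= d%:R * B.
Proof.
move=> H; rewrite /corrector -sumrB; apply: (le_trans (ler_norm_sum _ _ _)).
rewrite mulr_natl -[X in _ *+ X]card_ord -sumr_const; apply: ler_sum => i _.
exact: iter_hist_step_diff.
Qed.

End HistoryAverage.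

(** * Heights as strategies in the game *)

Section Game.
Context {R : realType} {n d : nat}.
Variable q : history d -> 'rV[R]_n.
Hypothesis n_gt0 : (0 < n)%N.
Hypothesis d_gt0 : (0 < d)%N.
Hypothesis q_le1 : forall m, `|q m| <= 1.
Implicit Types (F g : 'rV[R]_n -> R) (x y v s : 'rV[R]_n) (m : history d).

Lemma norm_move (b : bool) m (f : R) : `|f| <= 1 ->
  `|sgn b *: (q m - f *: one_vec)| <= 2.
Proof.
move=> f1; rewrite normrZ.
have -> : `|sgn b : R| = 1 by case: b; rewrite /= ?normrN normr1.
rewrite mul1r; apply: (le_trans (ler_normB _ _)).
by rewrite normrZ norm_one_vec// mulr1; have := q_le1 m; lra.
Qed.

Definition moves g x k m s : set R :=
  [set Num.max (minmax q g x k (push m true) (s + sgn true *: (q m - f *: one_vec)))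
               (minmax q g x k (push m false) (s + sgn false *: (q m - f *: one_vec)))
    | f in [set f : R | `|f| <= 1]].

Lemma moves_nonempty g x k m s : moves g x k m s !=set0.
Proof. by eexists; exists 0 => //=; rewrite normr0 ler01. Qed.

(** A round displaces the position by at most 2. The point is that the set of [moves] is bounded
    below, without which its [inf] would say nothing. *)
Lemma minmax_lb L g x k m s : lip L g -> g (x + s) - 2 * L * k%:R <= minmax q g x k m s.
Proof.
move=> gL; have L0 := lip_ge0 (Ordinal n_gt0) gL.
elim: k m s => [|k IH] m s /=; first by rewrite mulr0 subr0.
apply: (lb_le_inf (moves_nonempty g x k m s)) => _ [f /= f1 <-].
rewrite le_max; apply/orP; left; apply: le_trans (IH _ _).
have := gL (x + (s + sgn true *: (q m - f *: one_vec))) (x + s).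
rewrite addrA [x + s + _ - _]addrC addKr ler_norml => /andP[+ _].
have := ler_wpM2l L0 (norm_move true m f1); rewrite -natr1; lra.
Qed.

Lemma moves_lbound L g x k m s : lip L g -> has_lbound (moves g x k m s).
Proof.
move=> gL; have L0 := lip_ge0 (Ordinal n_gt0) gL.
exists (g (x + s) - 2 * L * k.+1%:R) => _ [f /= f1 <-].
rewrite le_max; apply/orP; left; apply: le_trans (minmax_lb _ _ _ _ gL).
have := gL (x + (s + sgn true *: (q m - f *: one_vec))) (x + s).
rewrite addrA [x + s + _ - _]addrC addKr ler_norml => /andP[+ _].
have := ler_wpM2l L0 (norm_move true m f1); rewrite -natr1; lra.
Qed.

Section Strategies.
Variables (g : 'rV[R]_n -> R) (L lam c : R) (x : 'rV[R]_n).
Hypotheses (gL : lip L g) (gH : payoff_homogeneous g) (lam_gt0 : 0 < lam).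
Variable z : nat -> 'rV[R]_n -> history d -> R.
Hypothesis zP : forall k m, profile (z k ^~ m).

Let shift_move b m (f : R) s : lam *: (x + (s + sgn b *: (q m - f *: one_vec))) =
  lam *: (x + s) + (sgn b * lam) *: q m + (- (sgn b * lam * f)) *: one_vec.
Proof.
rewrite addrA scalerDr -addrA; congr (_ + _).
by rewrite scalerA scalerBr scalerA scaleNr [lam * _]mulrC.
Qed.

(** [0 <= z k y m] is to certify a value of at most c from y with k rounds left. The best f
    equalises the heights after the two outcomes; the second hypothesis says that the common height
    does not fall, the third that this f is allowed. *)
Lemma game_upper k m s :
  (forall y m, 0 <= z 0 y m -> g y <= c) ->
  (forall j, (j < k)%N -> forall y m, z j.+1 y m <=
     (z j (y + lam *: q m) (push m true) + z j (y - lam *: q m) (push m false)) / 2) ->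
  (forall j, (j < k)%N -> forall y m,
     `|z j (y + lam *: q m) (push m true) - z j (y - lam *: q m) (push m false)|
       <= 2 * lam) ->
  0 <= z k (lam *: (x + s)) m -> lam * minmax q g x k m s <= c.
Proof.
move=> base; elim: k m s => [|k IH] m s step sl /=.
  by move=> /base; rewrite gH.
move=> z0; set y := lam *: (x + s) in z0.
pose A := z k (y + lam *: q m) (push m true).
pose B := z k (y - lam *: q m) (push m false).
have AB : 0 <= A + B.
  by have := le_trans z0 (step k (ltnSn k) y m); rewrite -/A -/B; lra.
have AB2 : `|A - B| <= 2 * lam by exact: sl.
(* As z is a profile, f changes the heights to A + lam f and B - lam f, both equal to (A + B) /
   2. *)
pose f := (B - A) / (2 * lam).
have lf : lam * f = (B - A) / 2 by rewrite /f; field; rewrite gt_eqF.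
have f1 : `|f| <= 1.
  rewrite /f normrM normfV (@gtr0_norm _ (2 * lam)) ?mulr_gt0//.
  by rewrite ler_pdivrMr ?mulr_gt0// mul1r distrC.
have IH' := IH _ _ (fun j jk => step j (ltnW jk)) (fun j jk => sl j (ltnW jk)).
rewrite mulrC -ler_pdivlMr//.
apply: (@le_trans _ _ (Num.max
   (minmax q g x k (push m true) (s + sgn true *: (q m - f *: one_vec)))
   (minmax q g x k (push m false) (s + sgn false *: (q m - f *: one_vec))))).
  by apply: (ge_inf (moves_lbound x k m s gL)); exists f.
rewrite ge_max; apply/andP; split; rewrite ler_pdivlMr// mulrC; apply: IH';
  rewrite shift_move zP /=.
  by rewrite mul1r -/y -/A lf; lra.
by rewrite mulN1r scaleNr -/y -/B mulNr lf; lra.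
Qed.

(** Whatever f is played, its contributions to the two heights cancel in their average. *)
Lemma game_lower k m s :
  (forall y m, g y < c -> 0 <= z 0 y m) ->
  (forall j, (j < k)%N -> forall y m,
     (z j (y + lam *: q m) (push m true) + z j (y - lam *: q m) (push m false)) / 2
     <= z j.+1 y m) ->
  lam * minmax q g x k m s < c -> 0 <= z k (lam *: (x + s)) m.
Proof.
move=> base; elim: k m s => [|k IH] m s step /=.
  by move=> H; apply: base; rewrite gH.
rewrite mulrC -ltr_pdivlMr// => /(inf_lt (moves_nonempty g x k m s)).
move=> [_ [f /= f1 <-]]; rewrite gt_max !ltr_pdivlMr// ![_ * lam]mulrC.
have IH' := IH _ _ (fun j jk => step j (ltnW jk)).
move=> /andP[/IH' H1 /IH' H2].
apply: le_trans (step k (ltnSn k) _ m).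
have E1 := shift_move true m f s; have E2 := shift_move false m f s.
rewrite /= in E1 E2.
by move: H1 H2; rewrite E1 E2 !zP !mul1r mulN1r scaleNr; lra.
Qed.

End Strategies.

Definition second_diff lam F y m : R :=
  (F (y + lam *: q m) + F (y - lam *: q m)) / 2 - F y.

(** The part of one round that depends on the history; its mean over m is zero, as the corrector
    requires. *)
Definition excess lam F y m : R :=
  (F (y + lam *: q m) + F (y - lam *: q m)) / 2 - Tstep q lam F y.

Lemma excess_sum lam F y : \sum_m excess lam F y m = 0.
Proof.
rewrite sumrB sumr_const card_history.
rewrite -[X in _ - X]mulr_natl natrX /Tstep mulVKf ?subrr//.
Qed.

Lemma excessE lam F y m : excess lam F y m =
  second_diff lam F y m - (2 ^+ d)^-1 * \sum_m' second_diff lam F y m'.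
Proof.
rewrite /second_diff sumrB mulrBr avg_cst /excess /Tstep; ring.
Qed.

Lemma second_diff_le K lam F y m : 0 < lam -> 0 < K -> jet K F ->
  `|second_diff lam F y m| <= K * lam ^+ 2.
Proof.
move=> l0 K0 /(_ y)[p [X J]].
have [H1 _ _] := J (lam *: q m); have [H2 _ _] := J (- (lam *: q m)).
have nq : K * `|lam *: q m| ^+ 2 <= K * lam ^+ 2.
  rewrite ler_wpM2l ?(ltW K0)// lerXn2r ?nnegrE ?(ltW l0)//.
  by rewrite normrZ gtr0_norm// ler_piMr// ltW.
rewrite normrN dotNr in H2; rewrite /second_diff.
move: H1 H2; rewrite !ler_norml => /andP[? ?] /andP[? ?]; apply/andP; split; lra.
Qed.

Lemma excess_le K lam F y m : 0 < lam -> 0 < K -> jet K F ->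
  `|excess lam F y m| <= 2 * K * lam ^+ 2.
Proof.
move=> l0 K0 FJ; rewrite excessE.
have H := fun m => second_diff_le y m l0 K0 FJ.
apply: (le_trans (ler_normB _ _)).
have := H m; have := avg_norm_le H; lra.
Qed.

(** All values are expanded at the same point y, where the linear and quadratic terms cancel. The
    cubic remainders add up to (8 + 8) / 2 + 1 + (1 + 1) / 2 = 10. *)
Lemma second_diff_lip K lam F y v m : 0 < lam -> 0 < K -> jet K F -> `|v| <= lam ->
  `|second_diff lam F (y + v) m - second_diff lam F y m| <= 10 * K * lam ^+ 3.
Proof.
move=> l0 K0 /(_ y)[p [X J]] vl.
have nq : `|lam *: q m| <= lam by rewrite normrZ gtr0_norm// ler_piMr// ltW.
have cube (w : 'rV[R]_n) : `|w| <= 2 * lam -> K * `|w| ^+ 3 <= 8 * (K * lam ^+ 3).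
  move=> wl; rewrite [leRHS]mulrCA ler_wpM2l ?(ltW K0)//.
  apply: (@le_trans _ _ ((2 * lam) ^+ 3)).
    by rewrite lerXn2r ?nnegrE// mulr_ge0// ltW.
  by rewrite exprMn; lra.
have cube1 (w : 'rV[R]_n) : `|w| <= lam -> K * `|w| ^+ 3 <= K * lam ^+ 3.
  by move=> wl; rewrite ler_wpM2l ?(ltW K0)// lerXn2r ?nnegrE ?(ltW l0).
set w := lam *: q m in nq *.
have [_ _ H1] := J (v + w); have [_ _ H2] := J (v - w); have [_ _ H3] := J v.
have [_ _ H4] := J w; have [_ _ H5] := J (- w).
have c1 : K * `|v + w| ^+ 3 <= 8 * (K * lam ^+ 3).
  by apply: cube; apply: (le_trans (ler_normD _ _)); lra.
have c2 : K * `|v - w| ^+ 3 <= 8 * (K * lam ^+ 3).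
  by apply: cube; apply: (le_trans (ler_normB _ _)); lra.
have c3 := cube1 _ vl; have c4 := cube1 _ nq.
rewrite /second_diff -/w -!addrA.
rewrite !quadD quadN mulNmx dotNl !dotDr !dotNr in H1 H2 H5.
rewrite normrN in H5.
rewrite !ler_norml in H1 H2 H3 H4 H5 *.
case/andP: H1 => ? ?; case/andP: H2 => ? ?; case/andP: H3 => ? ?.
case/andP: H4 => ? ?; case/andP: H5 => ? ?.
apply/andP; split; lra.
Qed.

Lemma excess_lip K lam F y v m : 0 < lam -> 0 < K -> jet K F -> `|v| <= lam ->
  `|excess lam F (y + v) m - excess lam F y m| <= 20 * K * lam ^+ 3.
Proof.
move=> l0 K0 FJ vl; rewrite !excessE.
have H := fun m => second_diff_lip y m l0 K0 FJ vl.
have := avg_norm_le H; rewrite sumrB mulrBr; have := H m.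
set A := _ * \sum_m' _; set B := _ * \sum_m' _.
by rewrite !ler_norml => /andP[? ?] /andP[? ?]; apply/andP; split; lra.
Qed.

(** Both operations combine translates of F and hence commute; the change of the excess over a time
    step thus reduces to its change in space. *)
Lemma excess_Tstep lam F y m : excess lam (Tstep q lam F) y m =
  Tstep q lam (excess lam F ^~ m) y.
Proof.
rewrite /excess; set G := Tstep q lam F.
rewrite [in RHS]/Tstep.
rewrite (eq_bigr (fun m' =>
  ((F (y + lam *: q m + lam *: q m') + F (y + lam *: q m - lam *: q m')) / 2 +
   (F (y - lam *: q m + lam *: q m') + F (y - lam *: q m - lam *: q m')) / 2) / 2
  - (G (y + lam *: q m') + G (y - lam *: q m')) / 2)); last first.
  move=> m' _; rewrite /G.
  rewrite [y + lam *: q m' + _]addrAC [y + lam *: q m' - _]addrAC.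
  rewrite [y - lam *: q m' + _]addrAC [y - lam *: q m' - _]addrAC.
  by field.
rewrite sumrB mulrBr; congr (_ - _).
by rewrite -mulr_suml big_split /= {1 2}/G /Tstep; ring.
Qed.

Lemma excess_Tstep_diff K lam F y m : 0 < lam -> 0 < K -> jet K F ->
  `|excess lam (Tstep q lam F) y m - excess lam F y m| <= 20 * K * lam ^+ 3.
Proof.
move=> l0 K0 FJ; rewrite excess_Tstep.
rewrite -[X in _ - X](@avg_cst R d) /Tstep -mulrBr -sumrB.
apply: avg_norm_le => m'.
have nq : `|lam *: q m'| <= lam by rewrite normrZ gtr0_norm// ler_piMr// ltW.
have nq' : `|- (lam *: q m')| <= lam by rewrite normrN.
have := excess_lip y m l0 K0 FJ nq; have := excess_lip y m l0 K0 FJ nq'.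
by rewrite !ler_norml => /andP[? ?] /andP[? ?]; apply/andP; split; lra.
Qed.

Lemma excess_profile lam F y m (s : R) : profile F ->
  excess lam F (y + s *: one_vec) m = excess lam F y m.
Proof.
move=> FP; rewrite /excess (Tstep_profile q lam FP).
by rewrite addrAC FP [y + _ - _]addrAC FP; field.
Qed.

Lemma slack_Tstep rho lam F : slack q rho F -> slack q rho (Tstep q lam F).
Proof.
move=> Fs m mu x mu0; rewrite /Tstep -mulrBr -sumrB; apply: avg_norm_le => m'.
have := Fs m mu (x + lam *: q m') mu0; have := Fs m mu (x - lam *: q m') mu0.
rewrite [x + mu *: _ + _]addrAC [x + mu *: _ - _]addrAC.
by rewrite !ler_norml => /andP[? ?] /andP[? ?]; apply/andP; split; lra.
Qed.

(* The heat flow, corrected at order lam ^+ 2 to average out the history, is an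
   almost exact solution of the dynamic programming principle. *)
Definition corrected lam F k y m : R :=
  iter k (Tstep q lam) F y + corrector (excess lam (iter k (Tstep q lam) F) y) m.

Section GameBounds.
Variables (K rho lam : R) (F : 'rV[R]_n -> R).
Hypotheses (K_gt0 : 0 < K) (lam_gt0 : 0 < lam).
Hypotheses (FJ : jet K F) (FP : profile F) (Fs : slack q rho F).

Let Fk k := iter k (Tstep q lam) F.

Let FkJ k : jet K (Fk k).
Proof. by elim: k => [|k IH] //=; exact: jet_Tstep. Qed.

Let FkP k : profile (Fk k).
Proof. by elim: k => [|k IH] //=; exact: Tstep_profile. Qed.

Let Fks k : slack q rho (Fk k).
Proof. by elim: k => [|k IH] //=; exact: slack_Tstep. Qed.

Lemma corrected_profile k m : profile (corrected lam F k ^~ m).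
Proof.
move=> y s; rewrite /corrected -!/(Fk k) FkP addrAC; congr (_ + _ - _); congr corrector.
by apply/funext => m'; exact: excess_profile.
Qed.

Lemma corrected_close k y m :
  `|corrected lam F k y m - Fk k y| <= d%:R * (2 * K * lam ^+ 2).
Proof.
rewrite /corrected -!/(Fk k) addrC addKr; apply: corrector_le => m'.
exact: excess_le.
Qed.

(** [correctorP] removes the excess of the round. What is left are the changes of the corrector when
    its base point moves by lam q(m) and when time advances by one step, each contributing 20 d K
    lam^3. *)
Lemma corrected_step k y m :
  `|corrected lam F k.+1 y m - (corrected lam F k (y + lam *: q m) (push m true) +
     corrected lam F k (y - lam *: q m) (push m false)) / 2|
    <= d%:R * (40 * K * lam ^+ 3).
Proof.
have nq : `|lam *: q m| <= lam by rewrite normrZ gtr0_norm// ler_piMr// ltW.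
have nq' : `|- (lam *: q m)| <= lam by rewrite normrN.
have E := correctorP d_gt0 m (excess_sum lam (Fk k) y).
have D1 := corrector_diff (push m true)
  (fun m' => excess_lip y m' lam_gt0 K_gt0 (FkJ k) nq).
have D2 := corrector_diff (push m false)
  (fun m' => excess_lip y m' lam_gt0 K_gt0 (FkJ k) nq').
have D3 := corrector_diff m (fun m' => excess_Tstep_diff y m' lam_gt0 K_gt0 (FkJ k)).
have EF : (Fk k (y + lam *: q m) + Fk k (y - lam *: q m)) / 2 =
    Tstep q lam (Fk k) y + excess lam (Fk k) y m.
  by rewrite /excess subrKC.
rewrite /corrected iterS -/(Fk k).
move: D1 D2 D3; rewrite !ler_norml => /andP[? ?] /andP[? ?] /andP[? ?].
by apply/andP; split; lra.
Qed.

(** The heat flow contributes at most 2 lam (1 - rho), and the margin 2 lam rho pays for two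
    correctors of size 2 d K lam^2. *)
Lemma corrected_slack k y m : 2 * d%:R * K * lam <= rho ->
  `|corrected lam F k (y + lam *: q m) (push m true) -
    corrected lam F k (y - lam *: q m) (push m false)| <= 2 * lam.
Proof.
move=> small.
have C1 := corrected_close k (y + lam *: q m) (push m true).
have C2 := corrected_close k (y - lam *: q m) (push m false).
have l20 : 0 <= 2 * lam by rewrite mulr_ge0// ltW.
have := Fks k m (y - lam *: q m) l20.
rewrite (_ : y - lam *: q m + (2 * lam) *: q m = y + lam *: q m); last first.
  by rewrite -addrA -scaleNr -scalerDl; congr (_ + _ *: _); ring.
have := ler_wpM2l (ltW lam_gt0) small.
move: C1 C2; rewrite !ler_norml => /andP[? ?] /andP[? ?] ? /andP[? ?].
by apply/andP; split; lra.
Qed.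

Lemma game_bounds g L c E x k m s : lip L g -> payoff_homogeneous g ->
  2 * d%:R * K * lam <= rho -> lam <= 1 -> k%:R * lam ^+ 2 <= 1 ->
  (forall y, E <= F y -> g y <= c) -> (forall y, g y < c -> - E <= F y) ->
  (E + 44 * d%:R * K * lam <= Fk k (lam *: (x + s)) ->
     lam * minmax q g x k m s <= c) /\
  (lam * minmax q g x k m s < c ->
     - E - 44 * d%:R * K * lam <= Fk k (lam *: (x + s))).
Proof.
move=> gL gH small l1 kl up lo.
(* The constant 44 is 40 + 2 + 2: the accumulated errors of at most lam^-2 rounds, and the size of
   the corrector at the end and at the start of the game, with lam^2 <= lam. *)
pose e := d%:R * (40 * K * lam ^+ 3); pose E0 := E + d%:R * (2 * K * lam).
have dK : 0 <= d%:R * K by rewrite mulr_ge0// ltW.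
have l2 : d%:R * (2 * K * lam ^+ 2) <= d%:R * (2 * K * lam).
  have : lam ^+ 2 <= lam by rewrite expr2 ler_piMr// ltW.
  by move=> /(ler_wpM2l dK); lra.
have ke : k%:R * e <= 40 * d%:R * K * lam.
  have := ler_wpM2l (mulr_ge0 dK (ltW lam_gt0)) kl; rewrite /e; lra.
have Ck := corrected_close k (lam *: (x + s)) m.
rewrite ler_norml in Ck; case/andP: Ck => Ck1 Ck2.
split=> H.
- pose z j y m := corrected lam F j y m + (- (j%:R * e) - E0).
  have zP j m' : profile (z j ^~ m').
    by move=> y t; rewrite /z corrected_profile; ring.
  apply: (game_upper gL gH lam_gt0 zP).
  + move=> y m'; rewrite /z mul0r => z0; apply: up.
    have := corrected_close 0 y m'; rewrite ler_norml /= => /andP[? ?].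
    by rewrite /E0 in z0; lra.
  + move=> j _ y m'; rewrite /z -[j.+1%:R]natr1.
    by have := corrected_step j y m'; rewrite -/e ler_norml => /andP[? ?]; lra.
  + move=> j _ y m'; rewrite /z.
    rewrite [X in `|X|](_ : _ = corrected lam F j (y + lam *: q m') (push m' true) -
      corrected lam F j (y - lam *: q m') (push m' false)); last by ring.
    exact: corrected_slack.
  + by rewrite /z /E0; lra.
- pose z j y m := corrected lam F j y m + (j%:R * e + E0).
  have zP j m' : profile (z j ^~ m').
    by move=> y t; rewrite /z corrected_profile; ring.
  suff : 0 <= z k (lam *: (x + s)) m by rewrite /z /E0; lra.
  apply: (game_lower gH lam_gt0 zP) H.
  + move=> y m' /lo; rewrite /z mul0r.
    have := corrected_close 0 y m'; rewrite ler_norml /= => /andP[? ?].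
    by rewrite /E0; lra.
  + move=> j _ y m'; rewrite /z -[j.+1%:R]natr1.
    by have := corrected_step j y m'; rewrite -/e ler_norml => /andP[? ?]; lra.
Qed.

End GameBounds.

End Game.

(** * Convergence *)

(* By homogeneity the modulus of continuity at one scale controls all scales. *)
Lemma homogeneous_lip (R : realType) (n : nat) (g : 'rV[R]_n -> R) :
  unif_continuous g -> payoff_homogeneous g -> exists2 L, 0 < L & lip L g.
Proof.
move=> /unif_continuousP/(_ 1 ltr01)[e e0 He] gH.
exists (2 / e); first by rewrite divr_gt0.
move=> x y; have [->|xy] := eqVneq x y.
  by rewrite !subrr normr0 normr0 mulr0.
have r0 : 0 < `|x - y| by rewrite normr_gt0 subr_eq0.
pose s := e / (2 * `|x - y|).
have s0 : 0 < s by rewrite divr_gt0// mulr_gt0.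
have : ball (g (s *: x)) 1 (g (s *: y)).
  apply: (He (s *: x, s *: y)); rewrite -ball_normE /= -scalerBr normrZ gtr0_norm//.
  rewrite (_ : s * _ = e / 2); first lra.
  by rewrite /s; field; rewrite gt_eqF.
rewrite -ball_normE /= !gH// -mulrBr normrM gtr0_norm// => H.
rewrite -(ler_pM2l s0); apply: (le_trans (ltW H)).
rewrite le_eqVlt; apply/orP; left; apply/eqP; rewrite /s; field.
by rewrite !gt_eqF.
Qed.

(** * Extension in time and reflection *)

Section Clamp.
Context {R : realType} {n d : nat}.
Variable q : history d -> 'rV[R]_n.
Implicit Types (u : 'rV[R]_n * R -> R) (x : 'rV[R]_n) (t : R).

Definition clamp t : R := Num.max 0 (Num.min 1 t).

(** The constant extension beyond the time interval gives continuity on the whole space and changes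
    nothing near points where the equation is tested. *)
Definition clamped u (p : 'rV[R]_n * R) : R := u (p.1, clamp p.2).

Lemma clamp01 t : 0 <= clamp t <= 1.
Proof. by rewrite /clamp le_max lexx ge_max ler01 ge_min lexx. Qed.

Lemma clamp_id t : 0 <= t <= 1 -> clamp t = t.
Proof. by move=> /andP[t0 t1]; rewrite /clamp (min_idPr t1) (max_idPr t0). Qed.

Lemma clamp_lip s t : `|clamp s - clamp t| <= 1 * `|s - t|.
Proof.
have E z : [\/ z <= 0 /\ clamp z = 0, 0 <= z <= 1 /\ clamp z = z | 1 <= z /\ clamp z = 1].
  have [z0|z0] := leP z 0; [apply: Or31|have [z1|z1] := leP z 1; [apply: Or32|apply: Or33]].
  - split=> //; rewrite /clamp; apply/max_idPl; rewrite ge_min z0 orbT.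
    by [].
  - by rewrite clamp_id ?(ltW z0).
  - split; first exact: ltW.
    by rewrite /clamp (min_idPl (ltW z1)) (max_idPr ler01).
have := ler_norm (s - t); have := ler_norm (t - s); rewrite [`|t - s|]distrC mul1r.
move=> h1 h2; rewrite ler_norml.
by case: (E s) => -[? ->]; case: (E t) => -[? ->]; apply/andP; split; lra.
Qed.

Lemma clamped_continuous u : {within cylinder, continuous u} ->
  continuous (clamped u).
Proof.
move=> /subspace_continuousP cu p.
have cyl (y : 'rV[R]_n * R) : cylinder (y.1, clamp y.2) by exact: clamp01.
have H := cu _ (cyl p).
have cc : (fun y : 'rV[R]_n * R => (y.1, clamp y.2)) @ p -->
    within cylinder (nbhs (p.1, clamp p.2)).
  have c1 : (fun y : 'rV[R]_n * R => (y.1, clamp y.2)) @ p --> (p.1, clamp p.2).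
    have c2 : snd @ p --> p.2 by exact: cvg_snd.
    have c3 := continuous_comp c2 (lipschitz_continuous clamp_lip (x := p.2)).
    have cf : (fun y : 'rV[R]_n * R => y.1) @ p --> p.1 by exact: cvg_fst.
    exact: (cvg_pair cf c3).
  move=> A HA.
  have G : \forall y \near p, cylinder (y.1, clamp y.2) -> A (y.1, clamp y.2).
    exact: c1 _ HA.
  by move: G; apply: (@filterS _ (nbhs p)) => y; apply; exact: cyl.
exact: cvg_comp cc H.
Qed.

Lemma near_clamped u (p : 'rV[R]_n * R) : 0 < p.2 < 1 ->
  \forall y \near p, clamped u y = u y.
Proof.
move=> /andP[p0 p1]; have c2 : snd @ p --> p.2 by exact: cvg_snd.
near=> y; rewrite /clamped clamp_id -?surjective_pairing//.
apply/andP; split; apply: ltW; near: y.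
- exact: cvgr_gt c2 _ p0.
- exact: cvgr_lt c2 _ p1.
Unshelve. all: by end_near.
Qed.

Lemma clamped_local_max u e p : 0 < p.2 < 1 ->
  local_max (fun y => clamped u y - peval e y) p ->
  local_max (fun y => u y - peval e y) p.
Proof.
move=> p01 H; have E := near_clamped u p01.
rewrite /local_max in H *; near=> y.
rewrite -(nbhs_singleton E) -(near E y)//; by near: y.
Unshelve. all: by end_near.
Qed.

(** This reflection turns supersolutions into subsolutions and keeps the monotonicity along
    [one_vec]: the gradient of a test function is preserved, while its time derivative and Hessian
    change sign. *)
Definition flipped u (p : 'rV[R]_n * R) : R := - u (- p.1, p.2).

Fixpoint Pflip (e : pexp R n) : pexp R n :=
  match e with
  | Aff a c b => Aff a (- c) b
  | Padd e1 e2 => Padd (Pflip e1) (Pflip e2)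
  | Pmul e1 e2 => Pmul (Pflip e1) (Pflip e2)
  end.

Lemma peval_flip e p : peval (Pflip e) p = peval e (- p.1, p.2).
Proof.
by elim: e => [a c b|e1 IH1 e2 IH2|e1 IH1 e2 IH2] /=; rewrite ?IH1 ?IH2// dotNl dotNr.
Qed.

Lemma pd_flip v e : pd v (Pflip e) = Pflip (pd (- v.1, v.2) e).
Proof.
elim: e => [a c b|e1 IH1 e2 IH2|e1 IH1 e2 IH2] /=; rewrite ?IH1 ?IH2//.
by rewrite dotNl dotNr oppr0.
Qed.

Lemma Fop_opp (X : 'M[R]_n) p : Fop q (- X) p = - Fop q X p.
Proof.
rewrite /Fop; case: ifP => _; first by rewrite oppr0.
rewrite -mulrN -sumrN; congr (_ * _); apply: eq_bigr => m _.
by rewrite linearN /= mulmxN dotNl.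
Qed.

Lemma admissible_clamped u : {within cylinder, continuous u} -> linear_growth u ->
  (exists2 theta, 0 < theta & theta_increasing theta u) ->
  viscosity_subsolution q u -> admissible q (clamped u).
Proof.
move=> cu [C uC] [th th0 uth] [_ usub]; split.
- exact: clamped_continuous.
- by exists th => // x t s s0; apply: uth => //; exact: clamp01.
- exists C => x t; apply: (le_trans (ler_norm _)); exact: uC (clamp01 t).
- move=> e p p01 /(clamped_local_max p01); apply: usub => //; exact: smooth_eval.
Qed.

Lemma admissible_flipped u : {within cylinder, continuous u} -> linear_growth u ->
  (exists2 theta, 0 < theta & theta_increasing theta u) ->
  viscosity_supersolution q u -> admissible q (flipped (clamped u)).
Proof.
move=> cu [C uC] [th th0 uth] [_ usup]; split.
- move=> p; apply: cvgN.
  have c1 : (fun y : 'rV[R]_n * R => (- y.1, y.2)) @ p --> (- p.1, p.2).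
    have cf : fst @ p --> p.1 by exact: cvg_fst.
    have cs : (fun y : 'rV[R]_n * R => y.2) @ p --> p.2 by exact: cvg_snd.
    exact: (cvg_pair (cvgN cf) cs).
  exact: cvg_comp c1 (@clamped_continuous u cu (- p.1, p.2)).
- exists th => // x t s s0; rewrite /flipped /=.
  have := uth (- (x + s *: one_vec)) (clamp t) s (clamp01 t) s0.
  by rewrite opprD subrK /clamped /=; lra.
- exists C => x t; apply: (le_trans (ler_norm _)).
  by rewrite normrN -(normrN x); exact: uC (clamp01 t).
- move=> e p p01 lmax.
  pose e' := Pscale (- 1) (Pflip e); pose p' := (- p.1, p.2).
  have e'E y : peval e' y = - peval e (- y.1, y.2).
    by rewrite pevalZ peval_flip mulN1r.
  have lmin : local_min (fun y => u y - peval e' y) p'.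
    have [r r0 Hr] := near_box lmax.
    have E := near_clamped u (p01 : 0 < p'.2 < 1).
    have H : \forall y \near p', clamped u p' - peval e' p' <=
        clamped u y - peval e' y.
      apply: (box_near r0) => y [y1 y2].
      have := Hr (- y.1, y.2); rewrite /flipped !e'E /= !opprK -!surjective_pairing.
      suff Hb : box p r (- y.1, y.2) by move=> /(_ Hb); lra.
      by split => //=; rewrite -opprD normrN; move: y1; rewrite /= opprK.
    rewrite /local_min; near=> y.
    rewrite -(nbhs_singleton E) -(near E y)//; by near: y.
  have := usup _ _ (smooth_eval e') (p01 : 0 < p'.2 < 1) lmin.
  have D v : peval (pd v e') p' = - peval (pd (- v.1, v.2) e) p.
    rewrite /= pd_flip !peval_flip !dot0l /p' /= opprK -surjective_pairing; ring.
  have D2 v w : peval (pd v (pd w e')) p' =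
      - peval (pd (- v.1, v.2) (pd (- w.1, w.2) e)) p.
    rewrite /= !pd_flip !peval_flip !dot0l /p' /= opprK -surjective_pairing; ring.
  have dN (i : 'I_n) : (- (dir_x i).1, (dir_x i).2) = (- 1) *: dir_x i :> 'rV[R]_n * R.
    by rewrite [RHS]surjective_pairing /= scaleN1r scaler0.
  have -> : time_deriv (peval e') p' = - time_deriv (peval e) p.
    by rewrite /time_deriv !derive_evalE D /= oppr0.
  have -> : grad (peval e') p' = grad (peval e) p.
    by apply/rowP => i; rewrite !mxE !derive_evalE D dN pdZ mulN1r opprK.
  have -> : hess (peval e') p' = - hess (peval e) p.
    apply/matrixP => i j; rewrite !mxE !derive_eval !derive_evalE D2 !dN.
    by rewrite pdZ pdC pdZ pdC; ring.
  rewrite Fop_opp; lra.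
Unshelve. all: by end_near.
Qed.

End Clamp.

Lemma ceil_steps (R : realType) (N : nat) (t : R) : (0 < N)%N -> 0 <= t <= 1 ->
  exists2 k, (N - `|Num.ceil (N%:R * t)|%N = k)%N &
    k%:R * N%:R^-1 <= 1 :> R /\ 1 - k.+1%:R * N%:R^-1 <= t <= 1 - k%:R * N%:R^-1.
Proof.
move=> N0 /andP[t0 t1]; have N0' : 0 < N%:R :> R by rewrite ltr0n.
have Nt0 : 0 <= N%:R * t by rewrite mulr_ge0.
have c0 : (0 <= Num.ceil (N%:R * t))%R by rewrite ceil_ge0; lra.
set l := `|_|%N; have lE : l%:R = (Num.ceil (N%:R * t))%:~R :> R.
  by rewrite /l natr_absz ger0_norm.
have l1 : N%:R * t <= l%:R by rewrite lE ceil_ge.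
have l2 : l%:R - 1 < N%:R * t by have := ceilB1_lt (N%:R * t); rewrite intrB lE.
have lN : (l <= N)%N.
  have : l%:R < N.+1%:R :> R.
    by rewrite -natr1; have := ler_wpM2l (ltW N0') t1; lra.
  by rewrite ltr_nat ltnS.
exists (N - l)%N => //; rewrite -natr1 natrB//.
split; first by rewrite ler_pdivrMr// mul1r gerBl.
apply/andP; split.
  rewrite -(ler_pM2l N0') mulrBr mulrCA divff ?gt_eqF// !mulr1; lra.
by rewrite -(ler_pM2l N0') mulrBr mulrCA divff ?gt_eqF// !mulr1; lra.
Qed.

(** * Uniform convergence *)

Section Convergence.
Context {R : realType} {n d : nat}.
Variable q : history d -> 'rV[R]_n.
Hypothesis n_gt0 : (0 < n)%N.
Hypothesis d_gt0 : (0 < d)%N.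
Implicit Types (F g : 'rV[R]_n -> R) (u : 'rV[R]_n * R -> R) (x : 'rV[R]_n) (t : R).

Lemma iter_Tstep_le lam F G a k x : (forall y, F y + a <= G y) ->
  iter k (Tstep q lam) F x + a <= iter k (Tstep q lam) G x.
Proof.
move=> H; elim: k x => [|k IH] x //=.
rewrite {1 3}/Tstep -[a](@avg_cst R d) -mulrDr -big_split /=.
rewrite ler_wpM2l ?invr_ge0 ?exprn_ge0//; apply: ler_sum => m _.
by have := IH (x + lam *: q m); have := IH (x - lam *: q m); lra.
Qed.

Definition flip F x : R := - F (- x).

Lemma iter_Tstep_flip lam F k x :
  iter k (Tstep q lam) (flip F) x = - iter k (Tstep q lam) F (- x).
Proof.
elim: k x => [|k IH] x //=; rewrite {1 3}/Tstep -mulrN -sumrN; congr (_ * _).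
apply: eq_bigr => m _; rewrite !IH.
by rewrite opprD opprB [lam *: q m - x]addrC; field.
Qed.

Lemma flip_profile F : profile F -> profile (flip F).
Proof.
move=> FP x s; rewrite /flip; have := FP (- (x + s *: one_vec)) s.
by rewrite opprD subrK => ->; ring.
Qed.

Lemma flip_jet K F : jet K F -> jet K (flip F).
Proof.
move=> FJ x; have [p [X J]] := FJ (- x); exists p, (- X) => h.
have QN : quad (- X) h = - quad X h by rewrite /quad mulmxN dotNl.
have [] := J (- h); rewrite normrN quadN dotNr QN /flip opprD => J1 J2 J3.
split.
- apply: le_trans J1; rewrite -normrN le_eqVlt; apply/orP; left.
  by apply/eqP; congr `|_|; ring.
- by rewrite normrN.
- apply: le_trans J3; rewrite -normrN le_eqVlt; apply/orP; left.
  by apply/eqP; congr `|_|; field.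
Qed.

Variables (g : 'rV[R]_n -> R) (theta : R) (u : 'rV[R]_n * R -> R).
Hypotheses (qE : expert_predictions q) (g_uc : unif_continuous g).
Hypotheses (theta_gt0 : 0 < theta) (gM : payoff_monotone theta g).
Hypotheses (gH : payoff_homogeneous g) (uS : solves_P q g u).

Lemma expert_norm m : `|q m| <= 1.
Proof.
by apply: norm_le_coord => // i; have [+ _] := qE m; move=> /(_ i); rewrite ler_norml.
Qed.

Lemma rescaled_close (eta0 : R) : 0 < eta0 -> exists N0, forall N, (N0 <= N)%N ->
  forall x t m, 0 <= t <= 1 -> `|rescaled q g N x t m - u (x, t)| <= eta0.
Proof.
move=> eta00; have [L L0 gL] := homogeneous_lip g_uc gH.
have n0 : 0 < n%:R :> R by rewrite ltr0n.
(* The levels c and c - eta0, or c + eta0, are at least eta0 / L = 7 eta apart in height. Mollifying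
   both profiles leaves 5 eta, the heat flow and the game use 2 eta each, and one eta remains for
   strictness. *)
pose eta := eta0 / (7 * L).
have eta_gt0 : 0 < eta by rewrite divr_gt0 ?mulr_gt0.
have etaL : 7 * eta = eta0 / L by rewrite /eta; field; rewrite gt_eqF.
pose eps := Num.min 1 (eta / (2 * n%:R)).
have n20 : 0 < 2 * n%:R :> R by rewrite mulr_gt0.
have eps01 : 0 < eps <= 1 by rewrite lt_min ltr01 ge_min lexx (divr_gt0 eta_gt0).
have epsE : 2 * n%:R * eps <= eta.
  by rewrite mulrC -ler_pdivlMr// ge_min lexx orbT.
have [K K0 smooth] := smooth_profile q n_gt0 eps01.
have [rho rho0 lslack] := level_slack n_gt0 theta_gt0 L0 gM gL qE.
have [lam0 lam00 flow] := heat_flow_bound n_gt0 expert_norm K0 eta_gt0.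
have d0 : 0 < d%:R :> R by rewrite ltr0n.
pose lam1 := Num.min lam0 (Num.min 1 (Num.min (rho / (2 * d%:R * K)) (eta / (44 * d%:R * K)))).
have dK0 a : 0 < a -> 0 < a * d%:R * K by move=> a0; rewrite !mulr_gt0.
have lam10 : 0 < lam1.
  by rewrite !lt_min lam00 ltr01 (divr_gt0 rho0) ?(divr_gt0 eta_gt0) ?dK0.
have [uc [usub usup] ufin ugr uth] := uS.
have au := admissible_clamped uc ugr uth usub.
have av := admissible_flipped uc ugr uth usup.
exists (Num.trunc (lam1 ^- 2)).+1 => N NN0 x t m t01.
have NR : lam1 ^- 2 < N%:R.
  by apply: (lt_le_trans (truncnS_gt _)); rewrite ler_nat.
have N0' : 0 < N%:R :> R by apply: lt_trans NR; rewrite invr_gt0 exprn_gt0.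
have N_gt0 : (0 < N)%N by rewrite -(ltr_nat R).
pose lam : R := (Num.sqrt N%:R)^-1.
have lam_gt0 : 0 < lam by rewrite invr_gt0 sqrtr_gt0.
have lam2 : lam ^+ 2 = N%:R^-1 by rewrite exprVn sqr_sqrtr// ltW.
have laml : lam <= lam1.
  rewrite -(@ler_pXn2r _ 2) ?nnegrE ?ltW// lam2 -[lam1 ^+ 2]invrK.
  by rewrite ltf_pV2 ?posrE// invr_gt0 exprn_gt0.
have [l0 l1 l2 l3] : [/\ lam <= lam0, lam <= 1, 2 * d%:R * K * lam <= rho &
    44 * d%:R * K * lam <= eta].
  move: laml; rewrite !le_min => /and4P[-> -> h2 h3]; split=> //.
    by move: h2; rewrite ler_pdivlMr ?dK0// mulrC.
  by move: h3; rewrite ler_pdivlMr ?dK0// mulrC.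
have [k kE [k1 k2]] := ceil_steps N_gt0 t01; rewrite -lam2 in k1 k2.
have prof c : exists F, [/\ jet K F, profile F, slack q rho F &
    forall y, `|F y - level g c y| <= eta].
  have [F [F1 F2 F3 F4]] := smooth rho (level g c)
    (level_lip n_gt0 theta_gt0 L0 gM gL c) (level_profile n_gt0 theta_gt0 gM gL c) (lslack c).
  by exists F; split => // y; apply: le_trans (F4 y) epsE.
pose c := u (x, t); pose kap := eta0.
have [F [FJ FP Fs FG]] := prof c.
have FG' y : - eta <= F y - level g c y <= eta by rewrite -ler_norml.
have l0' : 0 < lam <= lam0 by rewrite lam_gt0.
have t0 : 0 <= t by case/andP: t01.
have ct : clamped u (x, t) = c by rewrite /clamped clamp_id.
have c1 y : clamped u (y, 1) = g y by rewrite /clamped clamp_id ?ufin// ler01 lexx.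
(* As u(x, t) = c, the point x itself lies in {u >= c} at time t. For the bound from below, -x lies
   in the super-level set of the reflection at level -c. *)
have up : iter k (Tstep q lam) F x <= 2 * eta.
  have fin : super_level (clamped u) c F eta 1.
    move=> y; rewrite c1 => /(level_le0 n_gt0 theta_gt0 gM gL).
    by have := FG' y; lra.
  have := flow lam l0' _ c F eta au FP FJ fin k t k1 t0 k2 x.
  by rewrite ct => /(_ (lexx _)); lra.
have dn : - (2 * eta) <= iter k (Tstep q lam) F x.
  have fin : super_level (flipped (clamped u)) (- c) (flip F) eta 1.
    move=> y; rewrite /flipped c1 lerN2 => /(level_ge0 n_gt0 theta_gt0 gM gL).
    by rewrite /flip; have := FG' (- y); lra.
  have := flow lam l0' _ (- c) (flip F) eta av (flip_profile FP) (flip_jet FJ)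
    fin k t k1 t0 k2 (- x).
  by rewrite /flipped /= opprK ct iter_Tstep_flip opprK => /(_ (lexx _)); lra.
have base1 c' F' : (forall y, `|F' y - level g c' y| <= eta) ->
    forall y, eta <= F' y -> g y <= c'.
  move=> FG1 y Fy; have := FG1 y; rewrite ler_norml => /andP[_ h].
  rewrite -(levelP n_gt0 theta_gt0 gM gL c' y).
  have lv : 0 <= level g c' y by lra.
  apply: le_trans (payoff_up gM y lv).
  by rewrite lerDl mulr_ge0// mulr_ge0// ltW.
have base2 c' F' : (forall y, `|F' y - level g c' y| <= eta) ->
    forall y, g y < c' -> - eta <= F' y.
  move=> FG1 y /ltW/(level_ge0 n_gt0 theta_gt0 gM gL).
  by have := FG1 y; rewrite ler_norml => /andP[? _]; lra.
have resE : rescaled q g N x t m = lam * minmax q g (Num.sqrt N%:R *: x) k m 0.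
  by rewrite /rescaled /value kE.
have sx : lam *: (Num.sqrt N%:R *: x + 0) = x.
  by rewrite addr0 scalerA mulVf ?scale1r// gt_eqF// sqrtr_gt0.
have kapL : kap / L = 7 * eta by rewrite etaL.
have kap0 : 0 <= kap by exact: ltW.
rewrite resE ler_norml; apply/andP; split.
- rewrite leNgt; apply/negP => H.
  have {}H : lam * minmax q g (Num.sqrt N%:R *: x) k m 0 < c - kap by rewrite /kap /c; lra.
  have [F' [F'J F'P F's F'G]] := prof (c - kap).
  have [_ lo] := game_bounds n_gt0 d_gt0 expert_norm K0 lam_gt0 F'J F'P F's
    (Num.sqrt N%:R *: x) m 0 gL gH l2 l1 k1 (base1 _ _ F'G) (base2 _ _ F'G).
  have := lo H; rewrite sx.
  have : iter k (Tstep q lam) F' x + 5 * eta <= iter k (Tstep q lam) F x.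
    apply: iter_Tstep_le => y.
    have := level_shift n_gt0 theta_gt0 L0 gM gL (c - kap) y kap0; rewrite subrK kapL.
    by have := FG' y; have := F'G y; rewrite ler_norml => /andP[? ?] /andP[? ?]; lra.
  lra.
- have [F' [F'J F'P F's F'G]] := prof (c + kap).
  have [hi _] := game_bounds n_gt0 d_gt0 expert_norm K0 lam_gt0 F'J F'P F's
    (Num.sqrt N%:R *: x) m 0 gL gH l2 l1 k1 (base1 _ _ F'G) (base2 _ _ F'G).
  have : iter k (Tstep q lam) F x + 5 * eta <= iter k (Tstep q lam) F' x.
    apply: iter_Tstep_le => y.
    have := level_shift n_gt0 theta_gt0 L0 gM gL c y kap0; rewrite kapL.
    by have := FG' y; have := F'G y; rewrite ler_norml => /andP[? ?] /andP[? ?]; lra.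
  move=> h; rewrite lerBlDl; apply: hi; rewrite sx; lra.
Qed.

End Convergence.

(** * Linear payoffs *)

Lemma max_hist_close (R : realType) d (f : history d -> R) a e :
  (forall m, `|f m - a| <= e) -> `|max_hist f - a| <= e.
Proof.
move=> H; rewrite /max_hist; apply: (big_ind (fun z => `|z - a| <= e)) => // y z.
by rewrite /Num.max; case: ifP.
Qed.

Lemma min_hist_close (R : realType) d (f : history d -> R) a e :
  (forall m, `|f m - a| <= e) -> `|min_hist f - a| <= e.
Proof.
move=> H; rewrite /min_hist; apply: (big_ind (fun z => `|z - a| <= e)) => // y z.
by rewrite /Num.min; case: ifP.
Qed.

Lemma uniform_close_cvg (R : realType) (U : choiceType) (A : set U)
    (f : nat -> U -> R) (h : U -> R) :
  (forall e, 0 < e -> exists N0, forall N, (N0 <= N)%N ->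
     forall y, A y -> `|f N y - h y| <= e) ->
  {uniform A, f @ \oo --> h}.
Proof.
move=> H P /uniform_nbhs[E [entE EP]].
move: entE; rewrite -entourage_ballE => -[e /= e0 He].
have e20 : 0 < e / 2 by rewrite divr_gt0.
have [N0 HN] := H _ e20; exists N0 => // N /= N0N.
apply: EP => y Ay /=; apply: He; rewrite /= -ball_normE /= distrC.
by apply: (le_lt_trans (HN _ N0N _ Ay)); lra.
Qed.

Section LinearPayoff.
Context {R : realType} {n d : nat}.
Variable q : history d -> 'rV[R]_n.
Hypothesis n_gt0 : (0 < n)%N.
Implicit Types (g : 'rV[R]_n -> R) (a x s : 'rV[R]_n).

(* The partial derivatives of a homogeneous function are constant along rays from
   the origin, so that continuity at the origin makes them constant. *)
Lemma homogeneous_C1_increment g i x (h : R) : payoff_homogeneous g ->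
  (forall y, derivable g y (evec i)) -> {for 0, continuous ('D_(evec i) g)} ->
  g (x + h *: evec i) - g x = h * 'D_(evec i) g 0.
Proof.
move=> gH dg cD; apply/eqP; rewrite -subr_eq0 -normr_le0.
apply/ler_addgt0Pr => e e0; rewrite add0r.
have h1 : 0 < `|h| + 1 by rewrite ltr_wpDl.
have e1 : 0 < e / (`|h| + 1) by rewrite divr_gt0.
have /cvgrPdist_le/(_ _ e1)/nbhs_ballP[r /= r0 Hr] := cD.
pose B := `|x| + `|h| + 1; have B0 : 0 < B by rewrite ltr_wpDl// addr_ge0.
have [s s0 sB] : exists2 s, 0 < s & s * B = r / 2.
  exists (r / (2 * B)); first by rewrite divr_gt0// mulr_gt0.
  by field; rewrite gt_eqF.
pose G (z : R) := g (s *: x + z *: evec i) - z * 'D_(evec i) g 0.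
pose D (z : R) := 'D_(evec i) g (s *: x + z *: evec i) - 'D_(evec i) g 0.
have := @mvt_bound R G D (e / (`|h| + 1)) (s * h).
have -> : G (s * h) - G 0 = s * (g (x + h *: evec i) - g x - h * 'D_(evec i) g 0).
  by rewrite /G scale0r addr0 -(scalerA s h) -scalerDr !gH//; ring.
rewrite !normrM (gtr0_norm s0) mulrCA ler_pM2l// => H.
apply: (le_trans (H _ _)).
- move=> z _; rewrite /D.
  have [d1 d2] : is_derive (s *: x + z *: evec i) (evec i) g
      ('D_(evec i) g (s *: x + z *: evec i)) by apply: derivableP; exact: dg.
  have E : (fun k : R => k^-1 *: (((fun y => g (s *: x + y *: evec i)) \o shift z) (k *: 1)
       - g (s *: x + z *: evec i))) =
      (fun k : R => k^-1 *: ((g \o shift (s *: x + z *: evec i)) (k *: evec i)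
       - g (s *: x + z *: evec i))).
    apply/funext => k /=; congr (_ *: (g _ - _)).
    have -> : k *: 1 = k :> R by exact: mulr1.
    by rewrite scalerDl addrCA.
  have dl : is_derive z 1 (fun y => g (s *: x + y *: evec i))
      ('D_(evec i) g (s *: x + z *: evec i)).
    by apply: DeriveDef; rewrite /derivable /derive E.
  have := is_deriveB dl (is_deriveZ ('D_(evec i) g 0) (is_derive_id z (1 : R))).
  rewrite /GRing.scale /= mulr1 (_ : _ - _ = G)//.
  by apply/funext => y; rewrite /G [in RHS]mulrC.
- move=> z zs.
  rewrite /D distrC; apply: Hr; rewrite -ball_normE /= sub0r normrN.
  apply: (le_lt_trans (ler_normD _ _)); rewrite !normrZ norm_evec mulr1 (gtr0_norm s0).
  have : s * (`|x| + `|h|) < s * B by rewrite ltr_pM2l// /B; lra.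
  by rewrite sB; lra.
- by rewrite mulrAC ler_pdivrMr// ler_wpM2l ?ltW//; lra.
Qed.

Lemma homogeneous_C1_linear g : payoff_homogeneous g -> Ck space_basis 1 g ->
  exists a, forall x, g x = dot a x.
Proof.
move=> gH [_ gC]; exists (\row_i 'D_(evec i) g 0) => x.
have g0 : g 0 = 0 by have := gH 0 2 (ltr0n R 2); rewrite scaler0; lra.
have inc i y h : g (y + h *: evec i) - g y = h * 'D_(evec i) g 0.
  have [dg cD] := gC (evec i) (ex_intro2 _ _ i I erefl).
  exact: (homogeneous_C1_increment _ _ gH dg (cD 0)).
have H (r : seq 'I_n) : g (\sum_(i <- r) x 0 i *: evec i) =
    \sum_(i <- r) x 0 i * 'D_(evec i) g 0.
  elim: r => [|i r IH]; first by rewrite !big_nil.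
  by rewrite !big_cons -IH [X in g X]addrC; apply/eqP; rewrite -subr_eq inc.
rewrite -{1}(sum_evec x) H big_enum /dot; apply: eq_bigr => i _.
by rewrite mxE mulrC.
Qed.

(** The vectors added for the two outcomes are opposite, so one of them does not lower a linear
    payoff, whatever f is. Some f annihilates both contributions. *)
Lemma minmax_linear a x k m s : expert_predictions q -> (forall i, 0 < a 0 i) ->
  minmax q (dot a) x k m s = dot a (x + s).
Proof.
move=> qE a0; elim: k m s => [//|k IH] m s.
have a1 : 0 < dot a one_vec.
  rewrite /dot (bigD1 (Ordinal n_gt0))//= mxE mulr1 ltr_pwDl// sumr_ge0// => i _.
  by rewrite mxE mulr1 ltW.
have lb v : moves q (dot a) x k m s v -> dot a (x + s) <= v.
  move=> [f /= f1 <-]; rewrite !IH le_max !addrA ![dot a (x + s + _)]dotDr.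
  rewrite !dotZr mul1r mulN1r; set w := dot a (q m - _).
  by have [w0|w0] := leP 0 w; apply/orP; [left|right]; lra.
apply/le_anti/andP; split; last first.
  by apply: (lb_le_inf (moves_nonempty q (dot a) x k m s)); exact: lb.
(* A mean of the coordinates of q(m) with positive weights, hence in [-1, 1]. *)
pose f := dot a (q m) / dot a one_vec.
suff : moves q (dot a) x k m s (dot a (x + s)).
  by apply: ge_inf; exists (dot a (x + s)) => v; exact: lb.
exists f => /=.
  rewrite /f normrM normfV (gtr0_norm a1) ler_pdivrMr// mul1r.
  apply: (le_trans (ler_norm_sum _ _ _)); apply: ler_sum => i _.
  rewrite normrM (gtr0_norm (a0 i)) mxE; apply: ler_wpM2l; first exact: ltW.
  by rewrite ler_norml; have [+ _] := qE m; exact.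
rewrite !IH !addrA ![dot a (x + s + _)]dotDr !dotZr [dot a (q m - _)]dotDr dotNr dotZr /f divfK ?gt_eqF//.
by rewrite subrr !mulr0 addr0 maxxx.
Qed.

Lemma rescaled_linear a N x t m : (0 < N)%N -> expert_predictions q ->
  (forall i, 0 < a 0 i) -> rescaled q (dot a) N x t m = dot a x.
Proof.
move=> N0 qE a0; rewrite /rescaled /value minmax_linear// addr0 dotZr mulKf//.
by rewrite gt_eqF// sqrtr_gt0 ltr0n.
Qed.

End LinearPayoff.

Theorem theorem1p2 (R : realType) (n : nat) (n_ge2 : (2 <= n)%N) :
  (forall (d : nat) (q : history d -> 'rV[R]_n) (g : 'rV[R]_n -> R)
      (theta_g : R) (u : 'rV[R]_n * R -> R),
    (1 <= d)%N -> expert_predictions q ->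
    unif_continuous g -> 0 < theta_g -> payoff_monotone theta_g g ->
    payoff_homogeneous g -> solves_P q g u ->
    {uniform cylinder, (fun N => u_plus q g N) @ \oo --> u} /\
    {uniform cylinder, (fun N => u_minus q g N) @ \oo --> u})
  /\
  (forall theta_g K : R, 0 < theta_g ->
    exists C1 C2 : R, [/\ 0 < C1, 0 < C2 &
      forall (d : nat) (q : history d -> 'rV[R]_n) (g : 'rV[R]_n -> R)
        (u : 'rV[R]_n * R -> R),
      (1 <= d)%N -> expert_predictions q ->
      unif_continuous g -> payoff_monotone theta_g g ->
      payoff_homogeneous g -> solves_P q g u ->
      Ck space_basis 4 g -> Ck_seminorm 4 g = K%:E ->
      forall (t : R) (N : nat), 0 <= t <= 1 ->
        Num.max (d.+1%:R ^+ 6 / d%:R ^+ 2) (C1 * d%:R / vartheta q ^+ 3) <= N%:R ->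
        let rate := C2 * ((1 - t) * d%:R `^ (2 / 3) * N%:R `^ (- (1 / 6))
                          + d%:R `^ (1 / 3) * N%:R `^ (- (1 / 3))) in
        (sup_dist (u_plus q g N) u t <= rate%:E)%E /\
        (sup_dist (u_minus q g N) u t <= rate%:E)%E]).
Proof.
have n_gt0 : (0 < n)%N by exact: ltnW.
split.
  move=> d q g theta u d1 qE gU th0 gM gH uS.
  have close := rescaled_close n_gt0 d1 qE gU th0 gM gH uS.
  split; apply: uniform_close_cvg => e /close[N0 H]; exists N0 => N N0N [x t] t01.
    by apply: max_hist_close => m; exact: H.
  by apply: min_hist_close => m; exact: H.
(* The error will turn out to be zero, so any positive constants serve. *)
move=> theta K th0; exists 1, 1; split=> //.
move=> d q g u d1 qE gU gM gH uS [gc gC4] _ t N t01 Nbig rate.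
have N_gt0 : (0 < N)%N.
  rewrite -(ltr_nat R); apply: lt_le_trans Nbig.
  by rewrite lt_max divr_gt0 ?exprn_gt0// ltr0n.
have [a ga] : exists a, forall x, g x = dot a x.
  apply: homogeneous_C1_linear => //; split=> // v Ev.
  by have [dg [cD _]] := gC4 v Ev.
have {}ga : g = dot a by exact/funext.
have a0 i : 0 < a 0 i.
  have e0 (j : 'I_n) : 0 <= (evec i : 'rV[R]_n) 0 j.
    by rewrite mxE; case: (_ && _); rewrite ?ler01 ?lexx.
  have := gM 0 (evec i) e0; rewrite ga dot0r !add0r dot_evec dotC dot_evec mxE mulr1.
  exact: lt_le_trans.
have close := rescaled_close n_gt0 d1 qE gU th0 gM gH uS.
have resE N' x m : (0 < N')%N -> rescaled q g N' x t m = dot a x.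
  by move=> N'0; rewrite ga; exact: rescaled_linear.
(* The rescaled value is the same for all N >= 1, so its distance to u can be read off at
   arbitrarily large N; [maxn 1 N0] excludes N = 0. *)
have uE x m : `|rescaled q g N x t m - u (x, t)| <= 0.
  apply/ler_addgt0Pr => e e0; rewrite add0r resE//.
  have [N0 /(_ (maxn 1 N0) (leq_maxr _ _) x t m t01)] := close e e0.
  by rewrite resE// leq_max.
have rate0 : 0 <= rate.
  have /andP[_ t1] := t01; rewrite /rate mul1r addr_ge0// mulr_ge0 ?powR_ge0//.
  by rewrite mulr_ge0 ?powR_ge0// subr_ge0.
split; apply: ge_ereal_sup => _ [x _ <-]; rewrite lee_fin; apply: le_trans rate0.
  by apply: max_hist_close => m; exact: uE.
by apply: min_hist_close => m; exact: uE.
Qed.
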